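(* Let $G\subset SO(3)$ be one of the three polyhedral rotation groups: the tetrahedral group $T$ (the 12 rotational symmetries of a regular tetrahedron), the octahedral group $O$ (the 24 rotational symmetries of a cube), or the icosahedral group $I$ (the 60 rotational symmetries of a regular icosahedron). (i) If $G=O$ or $G=I$, then there exists an admissible real basis for $G$. (ii) If $G=T$, then there does not exist an admissible real basis for $G$.
   Context: For a finite group $G\subset SO(3)$, write $R_g\in\mathbb{R}^{3\times 3}$ for the rotation matrix of $g\in G$. Let $p\in\{1,\dots,N_{\rm rep}\}$ index the inequivalent irreducible complex representations (irreps) of $G$, and let $d_p$ be the dimension of the $p$th irrep. $Y_{l,m}$ ($l\in\{0,1,\dots\}$, $m\in\{-l,\dots,l\}$) are the usual complex spherical harmonics on the unit sphere $S^2\subset\mathbb{R}^3$, orthonormal in $L^2(S^2)$ with respect to surface measure. An admissible real basis for $G$ consists of a choice, for each $p$, of a unitary matrix realization $g\mapsto\Gamma^p(g)\in\mathbb{C}^{d_p\times d_p}$ of the $p$th irrep, together with a family of functions $F_{p,l,n,j}$ on $S^2$, where $p\in\{1,\dots,N_{\rm rep}\}$, $l\in\{0,1,\dots\}$, $n\in\{1,\dots,N_{p;l}\}$ for some integers $N_{p;l}\ge 0$, and $j\in\{1,\dots,d_p\}$, such that: 1. each $F_{p,l,n,j}$ is a (complex) linear combination of the spherical harmonics $Y_{l,m}$, $m\in\{-l,\dots,l\}$, of the fixed degree $l$; 2. each $F_{p,l,n,j}$ is real-valued; 3. the functions are orthonormal in $L^2(S^2)$: $\int_{S^2}F_{p,l,n,j}F_{p',l',n',j'}\,d\Omega=\delta_{p,p'}\delta_{l,l'}\delta_{n,n'}\delta_{j,j'}$;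 4. with $F_{p,l,n}=(F_{p,l,n,1},\dots,F_{p,l,n,d_p})^T$, one has $F_{p,l,n}(R_g^{-1}u)=(\Gamma^p(g))^T F_{p,l,n}(u)$ for all $g\in G$ and $u\in S^2$ (so $F_{p,l,n,j}$ transforms as the $j$th row of the $p$th irrep); 5. the family is complete in $L^2(S^2)$, i.e. its closed linear span is the space of all square-integrable functions on $S^2$. *)

(* Defs.v *)
From HB Require Import structures.
From mathcomp Require Import all_boot all_order all_algebra fingroup.
From mathcomp Require Import mxrepresentation spectral.
From mathcomp Require Import complex.
From mathcomp Require Import all_classical all_reals all_analysis.
From mathcomp Require Import measurable_realfun.

Set Implicit Arguments.
Unset Strict Implicit.
Unset Printing Implicit Defensive.

Import Order.TTheory GRing.Theory Num.Theory.
Import numFieldNormedType.Exports.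

Local Open Scope classical_set_scope.
Local Open Scope ring_scope.
Local Open Scope complex_scope.

Definition borel3 (R : realType) := g_sigma_algebraType (@open 'cV[R]_3).

Definition S2 (R : realType) : set (borel3 R) :=
  [set u : 'cV[R]_3 | u^T *m u = 1%:M].

Definition col3 (R : realType) (x y z : R) : 'cV[R]_3 :=
  \col_i [:: x; y; z]`_i.

(* a = (theta, phi): colatitude and longitude *)
Definition spherical (R : realType) (a : R * R) : 'cV[R]_3 :=
  col3 (sin a.1 * cos a.2) (sin a.1 * sin a.2) (cos a.1).

(* The image of the measure sin(theta) dtheta dphi on [0, pi] x [0, 2 pi];
   it is carried by S2. *)
Definition surface_measure (R : realType) (A : set (borel3 R)) : \bar R :=
  \int[(lebesgue_measure \x lebesgue_measure)%E]_(a in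
      (`[0, pi] `*` `[0, 2 * pi]) `&` @spherical R @^-1` A)
    (sin a.1)%:E.

Section surface_measure_is_measure.
Context {R : realType}.

Lemma measurable_spherical :
  measurable_fun setT (@spherical R : R * R -> borel3 R).
Proof.
have mcoord i j : measurable_fun setT (fun a : R * R => spherical a i j).
  have msin := continuous_measurable_fun (@continuous_sin R).
  have mcos := continuous_measurable_fun (@continuous_cos R).
  have ms := measurableT_comp msin (@measurable_fst _ _ R R).
  have mc := measurableT_comp mcos (@measurable_fst _ _ R R).
  have ms2 := measurableT_comp msin (@measurable_snd _ _ R R).
  have mc2 := measurableT_comp mcos (@measurable_snd _ _ R R).
  have -> : (fun a : R * R => spherical a i j) =
    (fun a => [:: sin a.1 * cos a.2; sin a.1 * sin a.2; cos a.1]`_i).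
    by apply/funext => a; rewrite mxE.
  case: i => -[|[|[|//]]] ?; [exact: measurable_funM|exact: measurable_funM|].
  exact: mc.
apply: (@measurability _ _ (R * R)%type (borel3 R) setT _ (@open 'cV[R]_3)) => //.
move=> _ [U oU <-]; rewrite setTI.
pose q2v (q : 'cV[rat]_3) : 'cV[R]_3 := map_mx ratr q.
have -> : @spherical R @^-1` U = \bigcup_(p in [set p : 'cV[rat]_3 * nat |
    ball (q2v p.1) p.2.+1%:R^-1 `<=` U])
    @spherical R @^-1` (ball (q2v p.1) p.2.+1%:R^-1).
  apply/seteqP; split => [a Ua|a [p /= pU /pU //]].
  have /nbhs_ballP[e /= e0 eU] : nbhs (spherical a) U by exact: open_nbhs_nbhs.
  have [n ne] : exists n : nat, (n.+1%:R^-1 : R) < e / 2.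
    have e20 : 0 < (e / 2)^-1 by rewrite invr_gt0 divr_gt0.
    exists (Num.truncn (e / 2)^-1).
    by rewrite invf_plt ?posrE ?divr_gt0// truncnS_gt.
  have n0 : 0 < n.+1%:R^-1 :> R by rewrite invr_gt0.
  have /choice[q qP] (i : 'I_3) :
      exists q : rat, `|spherical a i 0 - ratr q| < n.+1%:R^-1.
    have : spherical a i 0 - n.+1%:R^-1 < spherical a i 0 + n.+1%:R^-1.
      by rewrite ltrBlDr -addrA ltrDl addr_gt0.
    move=> /rat_in_itvoo[q]; rewrite in_itv/= => /andP[q1 q2].
    by exists q; rewrite distrC ltr_distl q1.
  have aq : ball (q2v (\col_i q i)) n.+1%:R^-1 (spherical a).
    split=> // i j; rewrite ord1 /ball /= distrC.
    by have := qP i; rewrite !mxE.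
  exists (\col_i q i, n) => //= v vq; apply: eU.
  apply: (@le_ball _ _ _ (n.+1%:R^-1 + n.+1%:R^-1)).
    by rewrite [leRHS]splitr lerD// ltW.
  by apply: ball_triangle vq; exact: ball_sym.
rewrite bigcup_mkcond; apply: countable_bigcupT_measurable => [|[q n] /=].
  exact: countableP.
case: ifPn => _; last exact: measurable0.
rewrite (_ : _ @^-1` _ = \bigcap_(i in [set: 'I_3])
    [set a : R * R | ball (q2v q i 0) n.+1%:R^-1 (spherical a i 0)]).
  apply: fin_bigcap_measurable => // i _.
  rewrite -[X in measurable X]setTI.
  by apply: (mcoord i 0) => //; apply: open_measurable; exact: ball_open.
apply/seteqP; split => a /=.
  by move=> [_ ba] i _; exact: ba.
by move=> ba; split=> // i j; rewrite ord1; exact: ba.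
Qed.

Let surface_measure0 : surface_measure (set0 : set (borel3 R)) = 0%E.
Proof. by rewrite /surface_measure preimage_set0 setI0 integral_set0. Qed.

Let sin_ge0 (a : R * R) : (`[0, pi] `*` `[0, 2 * pi]) a -> (0 <= (sin a.1)%:E)%E.
Proof. by move=> [+ _]; rewrite lee_fin /= in_itv /= => /sin_ge0_pi. Qed.

Let surface_measure_ge0 (A : set (borel3 R)) : (0 <= surface_measure A)%E.
Proof. by apply: integral_ge0 => a [/sin_ge0]. Qed.

Let surface_measure_sigma_additive : semi_sigma_additive (@surface_measure R).
Proof.
move=> A mA tA mUA; rewrite /surface_measure preimage_bigcup setI_bigcupr.
have mS B : measurable B -> measurable (@spherical R @^-1` (B : set (borel3 R))).
  by move=> mB; rewrite -[X in measurable X]setTI; exact: measurable_spherical.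
rewrite ge0_integral_bigcup//=.
- by apply: is_cvg_ereal_nneg_natsum_cond => n _ _; apply: integral_ge0 => a [/sin_ge0].
- by move=> k; apply: measurableI; [exact: measurableX|exact: mS].
- apply/measurable_EFinP; apply: measurable_funTS.
  exact: measurableT_comp (continuous_measurable_fun (@continuous_sin R)) measurable_fst.
- by move=> a [k _ [/sin_ge0]].
- by apply/trivIset_setIl; move=> i j _ _ [a [/= Ai Aj]]; apply: tA => //; exists (spherical a).
Qed.

HB.instance Definition _ := isMeasure.Build _ _ _ (@surface_measure R)
  surface_measure0 surface_measure_ge0 surface_measure_sigma_additive.

End surface_measure_is_measure.

(* Functions on S2 are represented by functions on the ambient space; only
   their values on S2 matter. *)
Definition sphere_integral (R : realType) (f : 'cV[R]_3 -> R[i]) : R[i] :=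
  \int[@surface_measure R]_(u in @S2 R) complex.Re (f u) +i*
  \int[@surface_measure R]_(u in @S2 R) complex.Im (f u).

Definition L2normsq (R : realType) (f : 'cV[R]_3 -> R[i]) : \bar R :=
  \int[@surface_measure R]_(u in @S2 R) (ComplexField.Normc.normc (f u) ^+ 2)%:E.

Definition in_L2 (R : realType) (f : 'cV[R]_3 -> R[i]) : Prop :=
  [/\ measurable_fun (@S2 R) (fun u : borel3 R => complex.Re (f u)),
      measurable_fun (@S2 R) (fun u : borel3 R => complex.Im (f u)) &
      (L2normsq f < +oo)%E].

(* Rodrigues' formula *)
Definition legendre (R : realType) (l : nat) : {poly R} :=
  (2 ^+ l * l`!%:R)^-1 *: (('X^2 - 1) ^+ l)^`(l).

(* For 0 <= m, Y_{l,m} = sqrt ((2l+1)/(4 pi) (l-m)!/(l+m)!)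
   P_l^m(cos theta) exp(i m phi) with the Condon-Shortley convention
   P_l^m(t) = (-1)^m (1 - t^2)^(m/2) P_l^(m)(t).  At
   u = (x, y, z) = spherical (theta, phi) one has z = cos theta and
   sin(theta)^m exp(i m phi) = (x + i y)^m. *)
Definition sph_harmonic_nat (R : realType) (l m : nat) (u : 'cV[R]_3) : R[i] :=
  (Num.sqrt ((2 * l + 1)%:R / (4 * pi) * ((l - m)`!%:R / (l + m)`!%:R)))%:C
  * ((-1) ^+ m * ((legendre R l)^`(m)).[u 2 0])%:C * (u 0 0 +i* u 1 0) ^+ m.

(* Y_{l,-m} = (-1)^m conj Y_{l,m} *)
Definition sph_harmonic (R : realType) (l : nat) (m : int) (u : 'cV[R]_3) :
    R[i] :=
  match m with
  | Posz k => sph_harmonic_nat l k u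
  | Negz k => (-1) ^+ k.+1 * (sph_harmonic_nat l k.+1 u)^*
  end.

Record admissible_real_basis (R : realType) (gT : finGroupType)
    (G : {group gT}) (rot : mx_representation R G 3) := AdmissibleRealBasis {
  nrep : nat;
  irrdim : 'I_nrep -> nat;
  Gam : forall p, mx_representation R[i] G (irrdim p);
  Gam_irr : forall p, mx_irreducible (Gam p);
  Gam_inequiv : forall p q, mx_rsim (Gam p) (Gam q) -> p = q;
  Gam_exhaust : forall n (rG : mx_representation R[i] G n),
    mx_irreducible rG -> exists p, mx_rsim rG (Gam p);
  Gam_unitary : forall p g, g \in G -> Gam p g \is unitarymx;

  mult : 'I_nrep -> nat -> nat;
  (* indices (p, l, n, j) *)
  bindex :=
    {pl : 'I_nrep * nat & ('I_(mult pl.1 pl.2) * 'I_(irrdim pl.1))%type};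
  basisF : forall (p : 'I_nrep) (l : nat),
    'I_(mult p l) -> 'I_(irrdim p) -> 'cV[R]_3 -> R[i];
  basisFb (b : bindex) := basisF (tagged b).1 (tagged b).2;

  basisF_harmonic : forall p l (n : 'I_(mult p l)) j,
    exists c : 'I_(2 * l).+1 -> R[i], forall u, @S2 R u ->
      basisF n j u = \sum_(k < (2 * l).+1) c k * sph_harmonic l (k%:Z - l%:Z) u;
  basisF_real : forall p l (n : 'I_(mult p l)) j u, @S2 R u ->
    basisF n j u \is Num.real;
  basisF_orthonormal : forall b b' : bindex,
    sphere_integral (fun u => basisFb b u * basisFb b' u) = (b == b')%:R;
  basisF_equivariant : forall p l (n : 'I_(mult p l)) g u, g \in G -> @S2 R u ->
    \col_j basisF n j (invmx (rot g) *m u) = (Gam p g)^T *m \col_j basisF n j u;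
  basisF_complete : forall f : 'cV[R]_3 -> R[i], in_L2 f ->
    forall eps : R, 0 < eps ->
    exists (s : seq bindex) (c : bindex -> R[i]),
      (L2normsq (fun u => f u - \sum_(b <- s) c b * basisFb b u)%R < eps%:E)%E
}.

Definition tetrahedron0 (R : realType) : set 'cV[R]_3 :=
  [set col3 1 1 1; col3 1 (-1) (-1); col3 (-1) 1 (-1); col3 (-1) (-1) 1].

Definition cube0 (R : realType) : set 'cV[R]_3 :=
  [set v | forall i, `|v i 0| = 1].

(* the cyclic permutations of (0, +-1, +-golden ratio); i + 1, i + 2 mod 3 *)
Definition icosahedron0 (R : realType) : set 'cV[R]_3 :=
  [set v | exists i : 'I_3, [/\ v i 0 = 0, `|v (i + 1) 0| = 1 &
    `|v (i + 2) 0| = (1 + Num.sqrt 5) / 2]].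

(* Any two regular tetrahedra (cubes, icosahedra) centered at the origin differ
   by an origin-fixing similarity, so the orientation of V is arbitrary. *)
Definition similar_copy (R : realType) (V0 V : set 'cV[R]_3) : Prop :=
  exists (c : R) (Q : 'M[R]_3),
    [/\ 0 < c, Q *m Q^T = 1%:M & V = (fun v => c *: (Q *m v)) @` V0].

Definition rotational_symmetries (R : realType) (V : set 'cV[R]_3) :
    set 'M[R]_3 :=
  [set A | [/\ A *m A^T = 1%:M, \det A = 1 & (fun v => A *m v) @` V = V]].

(* The rotation matrix R_g is rot g. *)
Definition polyhedral_group (R : realType) (V0 : set 'cV[R]_3)
    (gT : finGroupType) (G : {group gT}) (rot : mx_representation R G 3) :
    Prop :=
  mx_faithful rot /\
  exists2 V, similar_copy V0 V &
    [set rot g | g in [set g | g \in G]] = rotational_symmetries V.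

Definition is_tetrahedral (R : realType) (gT : finGroupType) (G : {group gT})
    (rot : mx_representation R G 3) := polyhedral_group (@tetrahedron0 R) rot.
Definition is_octahedral (R : realType) (gT : finGroupType) (G : {group gT})
    (rot : mx_representation R G 3) := polyhedral_group (@cube0 R) rot.
Definition is_icosahedral (R : realType) (gT : finGroupType) (G : {group gT})
    (rot : mx_representation R G 3) := polyhedral_group (@icosahedron0 R) rot.

(* Main.v *)
From Stdlib Require Import BinInt.
Require Import Defs.
From mathcomp Require Import all_boot all_order all_algebra fingroup.
From mathcomp Require Import mxrepresentation spectral.
From mathcomp Require Import complex.
From mathcomp Require Import all_classical all_reals all_analysis.
From mathcomp Require Import measurable_realfun.
From mathcomp Require Import ring lra zify ssrZ polyrcf cauchyreals.

(** Every irreducible complex representation of the octahedral and of the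
    icosahedral group can be realized over the real numbers, while the
    tetrahedral group has a one-dimensional representation of order 3, whose
    values are not real.  This difference decides the existence of a real basis.

    Existence.  Suppose that real orthogonal matrices Gamma_p(g) realize all
    irreducible representations (real_irreps).  A space of real harmonics of
    degree l is invariant under rotations (Vl_rot), and the operators
    (d_p / #|G|) sum_g Gamma_p(g)_ij g multiply on it like matrix units
    (proj_same, proj_diff).  An orthonormal basis of the image of the (0, 0) unit
    is carried by the (j, 0) units to orthonormal real functions which transform
    as the rows of Gamma_p and together span the harmonics of degree l
    (real_irreps_basis).  Completeness reduces to the density of polynomials in
    L2 of the sphere (cpf_dense) and to the fact that polynomials restrict to
    sums of harmonics (cpf_Ysp).

    The matrices Gamma_p come from an explicit list of the rotations of the cube
    and of the icosahedron, with entries in Z[phi] for phi the golden ratio.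
    Each Gamma_p is the action X |-> M X N^T on an invariant space of 3 x 3
    matrices, where M and N are the rotation or a twist of it: by the sign
    character of the octahedral group, or by the Galois conjugation of Q(sqrt 5)
    for the icosahedral group.  That these representations form a full set
    follows from two numerical identities checked on the list, the sum of the
    squared dimensions and the regular character (specs_ok, schur_relations,
    CGamma_exhaust).

    Non-existence.  Tetrahedral rotations permute the squares of the coordinates
    cyclically, so F = x^2 + omega y^2 + omega^2 z^2 is multiplied by a cubic
    root of unity chi(g) (quad_shift).  A basis function not orthogonal to F
    would belong to a representation on which g acts by the scalar
    conj (chi g), and a nonzero real function cannot be multiplied by a nonreal
    number and remain real (ip_basis0).  Hence F is orthogonal to every basis
    function, against completeness (no_admissible_basis). *)

Set Implicit Arguments.
Unset Strict Implicit.
Unset Printing Implicit Defensive.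

Import Order.TTheory GRing.Theory Num.Theory.
Import numFieldNormedType.Exports.

Local Open Scope classical_set_scope.
Local Open Scope ring_scope.

(** * The surface integral in spherical coordinates *)

Section SurfaceIntegral.
Variable R : realType.
Local Notation V := 'cV[R]_3.
Local Notation sigma := (@surface_measure R).
Local Notation mu2 := ((@lebesgue_measure R) \x (@lebesgue_measure R))%E.

Definition angles : set (R * R) := `[0, pi] `*` `[0, 2 * pi].

Lemma measurable_angles : measurable angles.
Proof. exact: measurableX. Qed.

Lemma measurable_sin1 (D : set (R * R)) :
  measurable_fun D (fun a : R * R => (sin a.1)%:E).
Proof.
apply/measurable_EFinP/measurable_funTS.
exact: measurableT_comp (continuous_measurable_fun (@continuous_sin R)) measurable_fst.
Qed.

Lemma sin1_ge0 a : angles a -> 0 <= sin a.1.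
Proof. by move=> [+ _]; rewrite /= in_itv /= => /sin_ge0_pi. Qed.

Import HBNNSimple.

(** The surface measure of a set is the weighted area of its preimage under
    spherical; simple functions and monotone convergence extend this change of
    variables from sets to nonnegative functions. *)
Lemma ge0_surface_integral (f : borel3 R -> \bar R) :
  measurable_fun setT f -> (forall u, (0 <= f u)%E) ->
  (\int[sigma]_u f u =
   \int[mu2]_(a in angles) (f (spherical a) * (sin a.1)%:E))%E.
Proof.
move=> mf f0.
have mS : measurable_fun setT (@spherical R : R * R -> borel3 R).
  exact: measurable_spherical.
have mA := measurable_angles.
pose h := nnsfun_approx measurableT mf.
have -> : (\int[sigma]_u f u =
    lim (\int[sigma]_u (EFin \o h n) u @[n --> \oo]))%E.
  have fE u : f u = lim ((EFin \o h n) u @[n --> \oo]).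
    by apply/esym/cvg_lim => //; exact: cvg_nnsfun_approx.
  under eq_integral => u _ do rewrite fE.
  apply: monotone_convergence => //.
  - by move=> n; apply/measurable_EFinP.
  - by move=> n u _ //=; rewrite lee_fin.
  - by move=> u _ a b ab; rewrite lee_fin; exact/lefP/nd_nnsfun_approx.
have mhS n D : measurable_fun D (fun a => (h n (spherical a))%:E).
  apply/measurable_EFinP/measurable_funTS.
  exact: (measurableT_comp (@measurable_funPT _ _ _ _ (h n)) mS).
have -> : (\int[mu2]_(a in angles) (f (spherical a) * (sin a.1)%:E) =
    lim (\int[mu2]_(a in angles) ((h n (spherical a))%:E * (sin a.1)%:E)
         @[n --> \oo]))%E.
  have fE a : (f (spherical a) * (sin a.1)%:E =
      lim (((h n (spherical a))%:E * (sin a.1)%:E) @[n --> \oo]))%E.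
    apply/esym/cvg_lim => //; apply: cvgeZr => //.
    exact: (@cvg_nnsfun_approx _ _ _ _ measurableT _ mf (fun x _ => f0 x)
              (spherical a) I).
  under eq_integral => a _ do rewrite fE.
  apply: monotone_convergence => //.
  - by move=> n; apply: emeasurable_funM; [exact: mhS|exact: measurable_sin1].
  - by move=> n a /sin1_ge0 s0; rewrite mule_ge0 ?lee_fin.
  - move=> a /sin1_ge0 s0 m n mn; rewrite lee_wpmul2r ?lee_fin//.
    by move: (nd_nnsfun_approx measurableT mf mn) => /lefP; exact.
suff suf n : (\int[mu2]_(a in angles) ((h n (spherical a))%:E * (sin a.1)%:E) =
    \int[sigma]_u (EFin \o h n) u)%E.
  by under [in RHS]eq_fun do rewrite suf.
transitivity (\int[sigma]_u
   (\sum_(y \in range (h n)) (y * \1_(h n @^-1` [set y]) u)%:E))%E; last first.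
  by apply: eq_integral => t tE; rewrite /= fimfunE -fsumEFin.
have indich r : measurable_fun setT
    (fun u => (r * \1_(h n @^-1` [set r]) u)%:E : \bar R).
  by apply: (measurable_comp measurableT) => //; exact: measurable_funM.
rewrite ge0_integral_fsum//; last by move=> m y Ey; exact: nnfun_muleindic_ge0.
transitivity (\int[mu2]_(a in angles) (\sum_(y \in range (h n))
    (y * \1_(h n @^-1` [set y]) (spherical a))%:E * (sin a.1)%:E))%E.
  apply: eq_integral => a aD.
  rewrite -ge0_mule_fsuml => [|y]; last exact: nnfun_muleindic_ge0.
  by rewrite [in LHS](fimfunE (h n) (spherical a)) -fsumEFin.
have mind r D : measurable_fun D (fun a => (r * \1_(h n @^-1` [set r]) (spherical a))%:E : \bar R).
  apply: measurable_funTS.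
  exact: (measurableT_comp (indich r) mS).
rewrite ge0_integral_fsum//; last 2 first.
  - by move=> y; apply: emeasurable_funM; [exact: mind|exact: measurable_sin1].
  - by move=> y a /sin1_ge0 s0; rewrite mule_ge0 ?nnfun_muleindic_ge0.
apply: eq_fsbigr => r rhn.
under [RHS]eq_integral do rewrite EFinM.
rewrite integralZl_indic_nnsfun => //.
under eq_integral do rewrite EFinM -muleA.
rewrite ge0_integralZl//.
- rewrite integral_indic// setIT; congr (_ * _)%E.
  rewrite [RHS](_ : _ = \int[mu2]_(a in angles `&`
     @spherical R @^-1` (h n @^-1` [set r])) (sin a.1)%:E)%E //.
  rewrite [RHS]integral_mkcondr; apply: eq_integral => a _.
  rewrite /patch indicE; case: ifPn => aI.
    by rewrite mem_set ?mul1e//; move: aI; rewrite inE.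
  by rewrite memNset ?mul0e//; move: aI; rewrite notin_setE.
- apply: emeasurable_funM; last exact: measurable_sin1.
  apply/measurable_EFinP/measurable_funTS.
  by apply: (measurableT_comp _ mS); exact: measurable_indic.
- by move=> a /sin1_ge0 s0; rewrite mule_ge0 ?lee_fin.
- by move: rhn; rewrite inE => -[t _ <-]; rewrite lee_fin.
Qed.

End SurfaceIntegral.

Section SurfaceIntegral2.
Variable R : realType.
Local Notation V := 'cV[R]_3.
Local Notation sigma := (@surface_measure R).
Local Notation mu := (@lebesgue_measure R).
Local Notation mu2 := ((@lebesgue_measure R) \x (@lebesgue_measure R))%E.
Local Notation angles := (@angles R).

Lemma measurable_coord (i : 'I_3) :
  measurable_fun setT (fun u : borel3 R => (u : V) i 0).
Proof.
apply: (measurability (@RGenOInfty.G R) (RGenOInfty.measurableE R)).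
move=> _ [_ [a ->] <-]; rewrite setTI; apply: sub_sigma_algebra => /=.
have oi : open (`]a, +oo[%classic : set R).
  exact: interval_open.
move/continuousP: (@coord_continuous R 3 1 i 0) => /(_ _ oi).
by [].
Qed.

Lemma S2E (u : V) : S2 u <-> \sum_i u i 0 ^+ 2 = 1.
Proof.
rewrite /S2 /=; split => [/matrixP/(_ 0 0)|h].
  rewrite mxE [RHS]mxE /= mulr1n => <-; apply: eq_bigr => i _.
  by rewrite !mxE expr2.
apply/matrixP => i j; rewrite !ord1 !mxE /= -h; apply: eq_bigr => k _.
by rewrite !mxE expr2.
Qed.

Lemma measurable_S2 : measurable (@S2 R).
Proof.
have mf : measurable_fun setT (fun u : borel3 R => \sum_i (u : V) i 0 ^+ 2).
  apply: measurable_sum => i; apply: measurable_funX; exact: measurable_coord.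
have := mf measurableT [set 1] (measurable_set1 1).
rewrite setTI; congr (measurable _).
by apply/seteqP; split => u /= /S2E.
Qed.

Lemma spherical_S2 a : S2 (@spherical R a).
Proof.
apply/S2E; rewrite !big_ord_recr big_ord0 /= add0r !mxE /=.
rewrite !exprMn -mulrDr cos2Dsin2 mulr1.
by rewrite addrC cos2Dsin2.
Qed.

Lemma angles_lty : (mu2 angles < +oo)%E.
Proof.
rewrite product_measure1E//= !lebesgue_measure_itv /=.
by do 2!case: ifP => _; rewrite ?mule0 ?mul0e// -!EFinD -EFinM ltry.
Qed.

Lemma surface_measure_lty : (sigma setT < +oo)%E.
Proof.
have -> : sigma setT = (\int[mu2]_(a in angles) (sin a.1)%:E)%E.
  by rewrite [LHS](_ : _ = \int[mu2]_(a in angles `&` setT) (sin a.1)%:E)%E // setIT.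
apply: le_lt_trans (angles_lty).
rewrite -[leRHS]mul1e -integral_cst; last exact: measurable_angles.
apply: ge0_le_integral => //.
- exact: measurable_angles.
- by move=> a /sin1_ge0; rewrite lee_fin.
- exact: measurable_sin1.
- by move=> a _ /=; rewrite lee_fin sin_le1.
Qed.

(** The image of spherical lies in the sphere, so the restriction to S2 costs
    nothing, and the two signs of f are treated separately. *)
Lemma surface_integral (f : borel3 R -> \bar R) :
  measurable_fun setT f ->
  (\int[sigma]_(u in @S2 R) f u =
   \int[mu2]_(a in angles) (f (spherical a) * (sin a.1)%:E))%E.
Proof.
move=> mf.
have mfS : measurable_fun setT (f \_ (@S2 R)).
  by apply: (measurable_restrictT _ measurable_S2).1; exact: measurable_funTS.
have h (g : borel3 R -> \bar R) a : (g \_ (@S2 R)) (spherical a) = g (spherical a).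
  by rewrite /patch mem_set//; exact: spherical_S2.
rewrite integral_mkcond integralE.
rewrite !ge0_surface_integral; [|exact: measurable_funeneg|by []
  |exact: measurable_funepos|by []].
rewrite [RHS]integralE; congr (_ - _)%E; apply: eq_integral => a;
  rewrite inE => /sin1_ge0 s0.
  by rewrite !funeposE h maxeMl ?mul0e// lee_fin.
by rewrite !funenegE h maxeMl ?mul0e ?mulNe// lee_fin.
Qed.

Lemma surface_integrable (f : borel3 R -> R) (M : R) :
  measurable_fun setT f -> (forall u, @S2 R u -> `|f u| <= M) ->
  sigma.-integrable (@S2 R) (EFin \o f).
Proof.
move=> mf fM; apply: measurable_bounded_integrable.
- exact: measurable_S2.
- apply: le_lt_trans surface_measure_lty.
  by apply: le_measure; rewrite ?inE; [exact: measurable_S2|exact: measurableT|].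
- exact: measurable_funTS.
- exists M; split; first exact: num_real.
  by move=> x Mx u Su; apply: le_trans (fM _ Su) (ltW Mx).
Qed.

Lemma angles_fubini (g h : R -> R) : continuous g -> continuous h ->
  (\int[mu2]_(a in angles) (g a.1 * h a.2)%:E =
   (\int[mu]_(x in `[0%R, pi]) g x * \int[mu]_(x in `[0%R, (2 * pi)%R]) h x)%:E)%E.
Proof.
move=> cg ch.
have intc (f : R -> R) (a b : R) : continuous f -> mu.-integrable `[a, b] (EFin \o f).
  move=> cf; apply: continuous_compact_integrable; first exact: segment_compact.
  exact: continuous_subspaceT.
have bnd (f : R -> R) (a b : R) : continuous f ->
    exists M, forall x, x \in `[a, b] -> `|f x| <= M.
  move=> cf.
  have /compact_bounded[M [_ Mf]] : compact (f @` `[a, b]).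
    apply: continuous_compact; last exact: segment_compact.
    exact: continuous_subspaceT.
  exists (M + 1) => x xab; apply: (Mf (M + 1)); first by rewrite ltrDl.
  by exists x.
have [Mg hMg] := bnd g 0 pi cg; have [Mh hMh] := bnd h 0 (2 * pi) ch.
have mgh D : measurable_fun D (fun a : R * R => g a.1 * h a.2).
  apply: measurable_funTS; apply: measurable_funM.
    exact: measurableT_comp (continuous_measurable_fun cg) measurable_fst.
  exact: measurableT_comp (continuous_measurable_fun ch) measurable_snd.
have igh : mu2.-integrable angles (EFin \o (fun a : R * R => g a.1 * h a.2)).
  apply: measurable_bounded_integrable.
  - exact: measurable_angles.
  - exact: angles_lty.
  - exact: mgh.
  - exists (Mg * Mh); split; first exact: num_real.
    move=> x Mx a [a1 a2]; apply: le_trans (ltW Mx).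
    by rewrite normrM ler_pM// ?hMg ?hMh.
have igh' : mu2.-integrable setT
    ((EFin \o (fun a : R * R => g a.1 * h a.2)) \_ angles).
  by apply: (iffLR (integrable_mkcond _ _) igh); exact: measurable_angles.
rewrite integral_mkcond -(integral12_prod_meas1 igh') /fubini_F.
transitivity (\int[mu]_x ((fun x => (g x)%:E * (\int[mu]_(y in `[0%R, (2 * pi)%R]) (h y)%:E)) \_ `[0%R, pi]) x)%E.
  apply: eq_integral => x _.
  rewrite /patch; case: ifPn => xI.
    rewrite -integralZl//; last exact: intc.
    rewrite [RHS]integral_mkcond; apply: eq_integral => y _.
    rewrite /patch /= EFinM.
    have -> : ((x, y) \in angles) = (y \in `[0%R, 2 * pi]%classic); last by [].
    by rewrite /angles in_setX xI.
  rewrite (eq_integral (cst 0%E)) ?integral0// => y _.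
  have -> // : ((x, y) \in angles) = false.
  by rewrite /angles in_setX (negbTE xI).
rewrite -integral_mkcond.
have hfin : (\int[mu]_(y in `[0%R, (2 * pi)%R]) (h y)%:E)%E \is a fin_num.
  by apply: integrable_fin_num => //; exact: (intc h).
rewrite -(fineK hfin).
rewrite (@integralZr _ _ _ mu _ (measurable_itv _) _ (intc _ _ _ cg)).
have gfin : (\int[mu]_(y in `[0%R, pi]) (g y)%:E)%E \is a fin_num.
  by apply: integrable_fin_num => //; exact: (intc g).
by rewrite /comp -(fineK gfin) -EFinM.
Qed.

Definition sincos (p q : nat) (x : R) : R := sin x ^+ p * cos x ^+ q.

Definition trig_int (b : R) (p q : nat) : R :=
  \int[mu]_(x in `[0%R, b]) sincos p q x.

Lemma continuous_sincos p q : continuous (sincos p q).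
Proof.
move=> x.
apply: (@continuousM _ _ (fun x : R => sin x ^+ p) (fun x : R => cos x ^+ q)).
  apply: (@continuous_comp _ _ _ (@sin R) (fun y => y ^+ p)).
    exact: continuous_sin.
  exact: exprn_continuous.
apply: (@continuous_comp _ _ _ (@cos R) (fun y => y ^+ q)).
  exact: continuous_cos.
exact: exprn_continuous.
Qed.

Lemma integrable_sincos b p q : mu.-integrable `[0%R, b] (EFin \o sincos p q).
Proof.
apply: continuous_compact_integrable; first exact: segment_compact.
apply: continuous_subspaceT; exact: continuous_sincos.
Qed.

Lemma continuousZ_sincos p q c : continuous (fun x => c * sincos p q x).
Proof.
move=> x.
by apply: (@continuousM _ _ (fun=> c)); [exact: cvg_cst|exact: continuous_sincos].
Qed.

Lemma integrableZ_sincos b p q c :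
  mu.-integrable `[0%R, b] (EFin \o (fun x => c * sincos p q x)).
Proof.
apply: continuous_compact_integrable; first exact: segment_compact.
apply: continuous_subspaceT; exact: continuousZ_sincos.
Qed.

Lemma FTC_everywhere (F f : R -> R) (b : R) : 0 < b -> continuous f ->
  (forall x : R, is_derive x (1 : R) F (f x)) ->
  \int[mu]_(x in `[0%R, b]) f x = F b - F 0.
Proof.
move=> b0 cf dF; rewrite /Rintegral.
have cF : continuous F.
  move=> x; apply: differentiable_continuous; apply/derivable1_diffP.
  by case: (dF x).
rewrite (@continuous_FTC2 _ f F)//.
- exact: continuous_subspaceT.
- split.
  + by move=> x _; by case: (dF x).
  + exact: cvg_at_right_filter (cF 0).
  + exact: cvg_at_left_filter (cF b).
- by move=> x _; rewrite derive1E; case: (dF x).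
Qed.

Lemma trig_intD b p q : trig_int b p q = trig_int b p.+2 q + trig_int b p q.+2.
Proof.
rewrite /trig_int -RintegralD//; try exact: integrable_sincos.
apply: eq_Rintegral => x _; rewrite /sincos.
have := cos2Dsin2 x; rewrite !exprS expr0 !mulr1 => h.
by rewrite -[LHS]mulr1 -h; ring.
Qed.

(** The boundary terms of sin^(p+1) cos^(q+1) vanish at 0 and b. *)
Lemma trig_int_parts b p q : 0 < b -> sin b = 0 ->
  p.+1%:R * trig_int b p q.+2 = q.+1%:R * trig_int b p.+2 q.
Proof.
move=> b0 sb.
have := @FTC_everywhere (sincos p.+1 q.+1)
  (fun x => p.+1%:R * sincos p q.+2 x - q.+1%:R * sincos p.+2 q x) b b0.
have -> : sincos p.+1 q.+1 b - sincos p.+1 q.+1 0 = 0.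
  by rewrite /sincos sb sin0 !exprS !mul0r subrr.
move=> FT.
apply/eqP; rewrite -subr_eq0; apply/eqP.
rewrite -[LHS]subr0 -[X in _ - X]FT.
- rewrite RintegralB//; try exact: integrableZ_sincos.
  by rewrite !RintegralZl//; [rewrite subrr|exact: integrable_sincos..].
- move=> x; apply: (@continuousB _ _ _ (fun x => p.+1%:R * sincos p q.+2 x)
    (fun x => q.+1%:R * sincos p.+2 q x)); exact: continuousZ_sincos.
- move=> x.
  have -> : sincos p.+1 q.+1 = (@sin R) ^+ p.+1 * (@cos R) ^+ q.+1.
    by apply/funext => y; rewrite /sincos !fctE.
  apply: is_derive_eq; rewrite /sincos /GRing.scale /= !fctE.
  rewrite !exprS; move: (sin x ^+ p) (cos x ^+ q) (p.+1%:R : R) (q.+1%:R : R).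
  by move=> s c m n; ring.
Qed.

End SurfaceIntegral2.

(** * Moments of polynomials on the sphere *)

Section Moments.
Variable R : realType.
Local Notation V := 'cV[R]_3.
Local Notation sigma := (@surface_measure R).

(** Not normalized: avg of the constant 1 is the area of the sphere. *)
Definition avg (f : V -> R) : R := \int[sigma]_(u in @S2 R) f u.

Lemma S2_coord (u : V) i : S2 u -> `|u i 0| <= 1.
Proof.
move/S2E => h.
rewrite -[leRHS]sqrtr1 -sqrtr_sqr ler_sqrt// -h.
by rewrite (bigD1 i)//= lerDl sumr_ge0// => j _; exact: sqr_ge0.
Qed.

Definition dot (v u : V) : R := \sum_i v i 0 * u i 0.

Definition mprod (s : seq V) (u : V) : R := \prod_(v <- s) dot v u.

Lemma mprod_cons v s u : mprod (v :: s) u = dot v u * mprod s u.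
Proof. by rewrite /mprod big_cons. Qed.

Lemma mprod_cat s t u : mprod (s ++ t) u = mprod s u * mprod t u.
Proof. by rewrite /mprod big_cat. Qed.

(** Real polynomial functions as combinations of products of linear forms, a
    presentation on which linear maps act through the vectors. *)
Definition rpoly := seq (R * seq V).

Definition reval (P : rpoly) (u : V) : R := \sum_(p <- P) p.1 * mprod p.2 u.

(** Degrees are not recorded here; only values on the sphere count. *)
Definition polyfun (f : V -> R) := exists P : rpoly, forall u, S2 u -> f u = reval P u.

Lemma measurable_dot v : measurable_fun setT (fun u : borel3 R => dot v u).
Proof.
apply: measurable_sum => i; apply: measurable_funM; first exact: measurable_cst.
exact: measurable_coord.
Qed.

Lemma measurable_mprod s : measurable_fun setT (fun u : borel3 R => mprod s u).
Proof.
by rewrite /mprod; apply: measurable_prod => v _; exact: measurable_dot.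
Qed.

Lemma dot_bounded v u : S2 u -> `|dot v u| <= \sum_i `|v i 0|.
Proof.
move=> Su; apply: le_trans (ler_norm_sum _ _ _) _; apply: ler_sum => i _.
by rewrite normrM ler_piMr// S2_coord.
Qed.

Lemma reval_measurable P : measurable_fun setT (fun u : borel3 R => reval P u).
Proof.
apply: measurable_sum => p; apply: measurable_funM; first exact: measurable_cst.
exact: measurable_mprod.
Qed.

Lemma reval_bounded P : exists M, forall u, S2 u -> `|reval P u| <= M.
Proof.
have hs s : exists M, forall u, S2 u -> `|mprod s u| <= M.
  elim: s => [|v s [M hM]].
    by exists 1 => u _; rewrite /mprod big_nil normr1.
  exists ((\sum_i `|v i 0|) * M) => u Su.
  by rewrite mprod_cons normrM ler_pM// ?dot_bounded// hM.
elim: P => [|p P [M hM]].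
  by exists 0 => u _; rewrite /reval big_nil normr0.
have [N hN] := hs p.2.
exists (`|p.1| * N + M) => u Su; rewrite /reval big_cons.
apply: le_trans (ler_normD _ _) _; apply: lerD; last exact: hM.
by rewrite normrM ler_wpM2l// hN.
Qed.

Lemma reval_integrable P : sigma.-integrable (@S2 R) (EFin \o reval P).
Proof.
have [M hM] := reval_bounded P.
by apply: (surface_integrable (M := M)); [exact: reval_measurable|exact: hM].
Qed.

Lemma reval_cat P Q u : reval (P ++ Q) u = reval P u + reval Q u.
Proof. by rewrite /reval big_cat. Qed.

Definition rscale (c : R) (P : rpoly) : rpoly := [seq (c * p.1, p.2) | p <- P].

Lemma reval_scale c P u : reval (rscale c P) u = c * reval P u.
Proof.
by rewrite /reval /rscale big_map mulr_sumr; apply: eq_bigr => p _ /=; rewrite mulrA.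
Qed.

Lemma eq_avg (f g : V -> R) : (forall u, S2 u -> f u = g u) -> avg f = avg g.
Proof. by move=> fg; apply: eq_Rintegral => u; rewrite inE => /fg. Qed.

Lemma polyfun_integrable f : polyfun f -> sigma.-integrable (@S2 R) (EFin \o f).
Proof.
move=> [P fP]; apply: eq_integrable (reval_integrable P).
  exact: measurable_S2.
by move=> u; rewrite inE => Su /=; rewrite fP.
Qed.

Lemma polyfunD f g : polyfun f -> polyfun g -> polyfun (fun u => f u + g u).
Proof. by move=> [P h] [Q k]; exists (P ++ Q) => u Su; rewrite reval_cat h// k. Qed.

Lemma polyfunZ c f : polyfun f -> polyfun (fun u => c * f u).
Proof. by move=> [P h]; exists (rscale c P) => u Su; rewrite reval_scale h. Qed.

Lemma polyfun_mprod s : polyfun (mprod s).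
Proof. by exists [:: (1, s)] => u _; rewrite /reval big_seq1 mul1r. Qed.

Lemma polyfun_reval P : polyfun (reval P).
Proof. by exists P. Qed.

Lemma avgD f g : polyfun f -> polyfun g ->
  avg (fun u => f u + g u) = avg f + avg g.
Proof.
move=> hf hg; rewrite /avg RintegralD//; try exact: polyfun_integrable.
exact: measurable_S2.
Qed.

Lemma avgZ c f : polyfun f -> avg (fun u => c * f u) = c * avg f.
Proof.
move=> hf; rewrite /avg RintegralZl//; last exact: polyfun_integrable.
exact: measurable_S2.
Qed.

Lemma avg_reval P : avg (reval P) = \sum_(p <- P) p.1 * avg (mprod p.2).
Proof.
elim: P => [|p P IH].
  rewrite big_nil (@eq_avg _ (fun u => 0 * mprod [::] u)).
    by rewrite avgZ ?mul0r//; exact: polyfun_mprod.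
  by move=> u _; rewrite /reval big_nil mul0r.
rewrite big_cons -IH -avgZ; last exact: polyfun_mprod.
rewrite -avgD//; first by apply: eq_avg => u _; rewrite /reval big_cons.
  by apply: polyfunZ; exact: polyfun_mprod.
exact: polyfun_reval.
Qed.

Definition mono (a b c : nat) (u : V) : R := u 0 0 ^+ a * u 1 0 ^+ b * u 2 0 ^+ c.

(** Spherical coordinates separate a monomial, and the Jacobian sin theta
    contributes one more power of sin theta. *)
Lemma avg_mono a b c : avg (mono a b c) =
  trig_int pi (a + b).+1 c * trig_int (2 * pi) b a :> R.
Proof.
have mm : measurable_fun setT (EFin \o (mono a b c : borel3 R -> R)).
  apply/measurable_EFinP; rewrite /mono; do ![apply: measurable_funM];
    by apply: measurable_funX; exact: measurable_coord.
rewrite /avg /Rintegral (surface_integral mm).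
rewrite -[RHS]/(fine (_%:E)); congr fine.
rewrite -[RHS]angles_fubini; try exact: continuous_sincos.
apply: eq_integral => x _; rewrite -EFinM /= /mono !mxE /=; congr (_%:E).
rewrite /sincos !exprMn exprS exprD.
by move: (sin x.1) (_ ^+ a) (sin x.1 ^+ b) => s ? ?; ring.
Qed.

End Moments.

(** * Rotation invariance of moments *)

Section Recursion.
Variable R : realType.
Local Notation V := 'cV[R]_3.
Local Notation sigma := (@surface_measure R).
Local Notation trig_int := (@trig_int R).

Lemma trig_int_cos b p q : 0 < b -> sin b = 0 ->
  (p + q).+2%:R * trig_int b p q.+2 = q.+1%:R * trig_int b p q.
Proof.
move=> b0 sb; rewrite (trig_intD _ p q) mulrDr -trig_int_parts// -mulrDl -natrD.
by congr (_%:R * _); lia.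
Qed.

Lemma trig_int_sin b p q : 0 < b -> sin b = 0 ->
  (p + q).+2%:R * trig_int b p.+2 q = p.+1%:R * trig_int b p q.
Proof.
move=> b0 sb; rewrite (trig_intD _ p q) mulrDr trig_int_parts// -mulrDl -natrD.
by congr (_%:R * _); lia.
Qed.

Lemma trig_int_cos1 b p : 0 < b -> sin b = 0 -> trig_int b p 1 = 0.
Proof.
move=> b0 sb.
have := @FTC_everywhere R (sincos p.+1 0) (fun x => p.+1%:R * sincos p 1 x) b b0.
have -> : sincos p.+1 0 b - sincos p.+1 0 0 = 0 :> R.
  by rewrite /sincos sb sin0 !exprS !mul0r subrr.
rewrite RintegralZl//; last exact: integrable_sincos.
move=> FT; apply/eqP.
suff : p.+1%:R * trig_int b p 1 == 0 by rewrite mulf_eq0 pnatr_eq0.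
apply/eqP; apply: FT; first exact: continuousZ_sincos.
move=> x; have -> : sincos p.+1 0 = (@sin R) ^+ p.+1.
  by apply/funext => y; rewrite /sincos !fctE expr0 mulr1.
by apply: is_derive_eq; rewrite /sincos /GRing.scale /= mulrA.
Qed.

Lemma trig_int_sin1 q : trig_int (2 * pi) 1 q = 0.
Proof.
have b0 : 0 < 2 * pi :> R by rewrite mulr_gt0// pi_gt0.
have := @FTC_everywhere R (sincos 0 q.+1) (fun x => - q.+1%:R * sincos 1 q x) _ b0.
have -> : sincos 0 q.+1 (2 * pi) - sincos 0 q.+1 0 = 0 :> R.
  rewrite /sincos !expr0 mulr_natl.
  by rewrite -[pi *+ 2]add0r cosD2pi subrr.
rewrite RintegralZl//; last exact: integrable_sincos.
move=> FT; apply/eqP.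
suff : - q.+1%:R * trig_int (2 * pi) 1 q == 0 by rewrite mulf_eq0 oppr_eq0 pnatr_eq0.
apply/eqP; apply: FT; first exact: continuousZ_sincos.
move=> x; have -> : sincos 0 q.+1 = (@cos R) ^+ q.+1.
  by apply/funext => y; rewrite /sincos !fctE expr0 mul1r.
apply: is_derive_eq; rewrite /sincos /GRing.scale /=.
by move: (cos x ^+ q) (sin x) (q.+1%:R : R) => *; ring.
Qed.

Lemma sin2pi0 : sin (2 * pi) = 0 :> R.
Proof. by rewrite mulr_natl -[pi *+ 2]add0r sinD2pi sin0. Qed.

Let pi0 := @pi_gt0 R.
Let pi20 : 0 < 2 * pi :> R. Proof. by rewrite mulr_gt0// pi_gt0. Qed.

(** The recursion int z^(c+1) f = c / (deg + 2) int z^(c-1) f; when c = 0 the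
    factor c annihilates the arbitrary value of c.-1. *)
Lemma avg_mono_z a b c :
  (a + b + c).+2%:R * avg (@mono R a b c.+1) = c%:R * avg (@mono R a b c.-1).
Proof.
rewrite !avg_mono; case: c => [|c]; first by rewrite trig_int_cos1 ?sinpi// !mul0r mulr0.
have := trig_int_cos (a + b).+1 c pi0 (@sinpi R).
by rewrite !addnS !addSn -[c.+1.-1]/c mulrA => ->; rewrite mulrA.
Qed.

Lemma avg_mono_x a b c :
  (a + b + c).+2%:R * avg (@mono R a.+1 b c) = a%:R * avg (@mono R a.-1 b c).
Proof.
rewrite !avg_mono; case: a => [|a]; first by rewrite trig_int_cos1 ?sin2pi0// mulr0 mul0r mulr0.
have h1 := trig_int_cos b a pi20 sin2pi0.
have h2 := trig_int_sin (a + b).+1 c pi0 (@sinpi R).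
rewrite !addSn in h2 *; rewrite mulrA h2 -mulrA -[a.+1.-1]/a.
rewrite (addnC b) in h1; rewrite mulrCA h1; ring.
Qed.

Lemma avg_mono_y a b c :
  (a + b + c).+2%:R * avg (@mono R a b.+1 c) = b%:R * avg (@mono R a b.-1 c).
Proof.
rewrite !avg_mono; case: b => [|b]; first by rewrite trig_int_sin1// mulr0 mul0r mulr0.
have h1 := trig_int_sin b a pi20 sin2pi0.
have h2 := trig_int_sin (a + b).+1 c pi0 (@sinpi R).
rewrite !addnS !addSn in h2 *; rewrite mulrA h2 -mulrA -[b.+1.-1]/b.
rewrite (addnC b) in h1; rewrite mulrCA h1; ring.
Qed.

Definition ev (i : 'I_3) : V := delta_mx i 0.

Lemma ord3_ind (P : 'I_3 -> Prop) : P 0 -> P 1 -> P 2 -> forall i, P i.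
Proof.
move=> P0 P1 P2 [[|[|[|//]]] p].
- by have -> : Ordinal p = 0 by exact/val_inj.
- by have -> : Ordinal p = 1 by exact/val_inj.
- by have -> : Ordinal p = 2 by exact/val_inj.
Qed.

Lemma dot_ev i u : dot (ev i) u = u i 0.
Proof.
rewrite /dot (bigD1 i)//= mxE !eqxx mul1r big1 ?addr0// => j /negbTE ji.
by rewrite mxE ji mul0r.
Qed.

(** The derivative in the direction v of the product of the linear forms in s. *)
Fixpoint dlist (v : V) (s : seq V) : rpoly R :=
  if s is w :: s' then
    (dot v w, s') :: [seq (p.1, w :: p.2) | p <- dlist v s'] else [::].

Lemma dlist_cons v w s u :
  reval (dlist v (w :: s)) u = dot v w * mprod s u + dot w u * reval (dlist v s) u.
Proof.
rewrite /= /reval big_cons big_map; congr (_ + _).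
rewrite mulr_sumr; apply: eq_bigr => p _ /=.
by rewrite mprod_cons mulrCA.
Qed.

Definition cmono (r : seq 'I_3) := mono (count_mem 0 r) (count_mem 1 r) (count_mem 2 r) : V -> R.

Lemma mprod_ev r u : mprod (map ev r) u = cmono r u.
Proof.
rewrite /cmono; elim: r => [|i r IH]; first by rewrite /mprod big_nil /mono !expr0 !mulr1.
rewrite /= mprod_cons IH dot_ev /mono.
by elim/ord3_ind: i => /=; rewrite ?add0n ?add1n exprS; ring.
Qed.

Lemma reval_dlist_ev i r u : reval (dlist (ev i) (map ev r)) u =
  (count_mem i r)%:R * mono (count_mem 0 r - (i == 0)) (count_mem 1 r - (i == 1))
     (count_mem 2 r - (i == 2)) u.
Proof.
elim: r => [|j r IH]; first by rewrite /= /reval big_nil mul0r.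
rewrite map_cons dlist_cons mprod_ev IH !dot_ev mxE eqxx andbT.
rewrite /cmono /mono.
elim/ord3_ind: i IH => IH; elim/ord3_ind: j => /=;
  rewrite ?subn0 ?add0n ?add1n ?subn1 /= ?natrS;
  move: (count_mem 0 r) (count_mem 1 r) (count_mem 2 r) => a b c;
  try (rewrite ?exprS; ring).
- by case: a => [|a]; rewrite ?exprS; ring.
- by case: b => [|b]; rewrite ?exprS; ring.
- by case: c => [|c]; rewrite ?exprS; ring.
Qed.

Lemma size_count3 (r : seq 'I_3) :
  size r = (count_mem 0%R r + count_mem 1%R r + count_mem 2%R r)%N.
Proof.
elim: r => [|i r IH] //=; rewrite IH.
by elim/ord3_ind: i => /=; lia.
Qed.

(** The divergence theorem for a homogeneous f of degree k on the ball:
    (k + 2) int (v . u) f = int (derivative of f in the direction v). *)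
Definition gauss (v : V) (s : seq V) :=
  (size s).+2%:R * avg (mprod (v :: s)) = avg (reval (dlist v s)).

Lemma gauss_ev i r : gauss (ev i) (map ev r).
Proof.
rewrite /gauss size_map size_count3.
rewrite (@eq_avg _ _ (cmono (i :: r))); last first.
  by move=> u _; rewrite -mprod_ev.
have -> : avg (reval (dlist (ev i) (map ev r))) = (count_mem i r)%:R *
    avg (mono (count_mem 0 r - (i == 0)) (count_mem 1 r - (i == 1))
     (count_mem 2 r - (i == 2)) : V -> R).
  rewrite -avgZ; first by apply: eq_avg => u _; exact: reval_dlist_ev.
  rewrite /mono; exists [:: (1, nseq (count_mem 0 r - (i == 0)) (ev 0) ++
     nseq (count_mem 1 r - (i == 1)) (ev 1) ++ nseq (count_mem 2 r - (i == 2)) (ev 2))].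
  move=> u _; rewrite /reval big_seq1 mul1r !mprod_cat /mprod !big_nseq.
  by rewrite !iter_mulr_1 !dot_ev mulrA.
rewrite /cmono; elim/ord3_ind: i => /=; rewrite ?subn0 ?subn1 ?add0n ?add1n.
- exact: avg_mono_x.
- exact: avg_mono_y.
- exact: avg_mono_z.
Qed.

Lemma dot_suml (v u : V) : dot v u = \sum_i v i 0 * dot (ev i) u.
Proof. by apply: eq_bigr => i _; rewrite dot_ev. Qed.

Lemma dotC (v u : V) : dot v u = dot u v.
Proof. by apply: eq_bigr => i _; rewrite mulrC. Qed.

Lemma mprod_multilin s w t u :
  mprod (s ++ w :: t) u = \sum_i w i 0 * mprod (s ++ ev i :: t) u.
Proof.
rewrite mprod_cat mprod_cons dot_suml mulr_suml mulr_sumr.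
apply: eq_bigr => i _; rewrite mprod_cat mprod_cons; ring.
Qed.

Lemma dlist_multilin v s w t u :
  reval (dlist v (s ++ w :: t)) u =
  \sum_i w i 0 * reval (dlist v (s ++ ev i :: t)) u.
Proof.
elim: s => [|x s IH].
  rewrite !cat0s dlist_cons (dotC v w) (dot_suml w v) (dot_suml w u) !mulr_suml -big_split.
  by apply: eq_bigr => i _; rewrite /= -/(dlist v (ev i :: t)) dlist_cons (dotC v) ; ring.
rewrite !cat_cons dlist_cons IH mprod_multilin !mulr_sumr -big_split.
by apply: eq_bigr => i _; rewrite /= -/(dlist v (x :: (s ++ ev i :: t))) dlist_cons; ring.
Qed.

Lemma dlist_linl v s u :
  reval (dlist v s) u = \sum_i v i 0 * reval (dlist (ev i) s) u.
Proof.
elim: s => [|w s IH].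
  by rewrite big1 => [|i _]; rewrite /reval big_nil ?mulr0.
rewrite dlist_cons IH (dot_suml v w) mulr_suml [X in _ + X]mulr_sumr -big_split.
by apply: eq_bigr => i _; rewrite dlist_cons /=; ring.
Qed.

Lemma avg_sum n (c : 'I_n -> R) (f : 'I_n -> V -> R) :
  (forall i, polyfun (f i)) ->
  avg (fun u => \sum_i c i * f i u) = \sum_i c i * avg (f i).
Proof.
elim: n c f => [|n IH] c f pf.
  rewrite big_ord0 (@eq_avg _ _ (reval [::])); first by rewrite avg_reval big_nil.
  by move=> u _; rewrite /reval big_nil big_ord0.
rewrite big_ord_recl -IH// -avgZ// -avgD.
- by apply: eq_avg => u _; rewrite big_ord_recl.
- exact: polyfunZ.
- elim: n {IH} c f pf => [|n IH] c f pf.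
    by exists [::] => u _; rewrite big_ord0 /reval big_nil.
  have := polyfunD (polyfunZ (c (lift ord0 ord0)) (pf (lift ord0 ord0)))
     (IH (fun i => c (lift ord0 i)) (fun i => f (lift ord0 i)) (fun i => pf _)).
  by move=> [P hP]; exists P => u Su; rewrite -hP// big_ord_recl.
Qed.

(** Both sides are linear in v and in each factor, so the basis vectors
    suffice; there the claim is the recursion for monomials. *)
Lemma gaussP v s : gauss v s.
Proof.
have gev i r t : gauss (ev i) (map ev r ++ t).
  elim: t r => [|w t IH] r; first by rewrite cats0; exact: gauss_ev.
  rewrite /gauss -cat_cons.
  rewrite (@eq_avg _ _ (fun u => \sum_j w j 0 * mprod ((ev i :: map ev r) ++ ev j :: t) u)); last first.
    by move=> u _; exact: mprod_multilin.
  rewrite (@eq_avg _ (reval _) (fun u => \sum_j w j 0 * reval (dlist (ev i) (map ev r ++ ev j :: t)) u)); last first.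
    by move=> u _; exact: dlist_multilin.
  rewrite !avg_sum; [|by move=> j; exact: polyfun_reval|by move=> j; exact: polyfun_mprod].
  rewrite mulr_sumr; apply: eq_bigr => j _; rewrite mulrCA; congr (_ * _).
  have := IH (rcons r j); rewrite /gauss map_rcons cat_rcons => <-.
  by rewrite !size_cat.
rewrite /gauss.
rewrite (@eq_avg _ _ (fun u => \sum_j v j 0 * mprod (ev j :: s) u)); last first.
  by move=> u _; exact: (mprod_multilin [::]).
rewrite (@eq_avg _ (reval _) (fun u => \sum_j v j 0 * reval (dlist (ev j) s) u)); last first.
  by move=> u _; exact: dlist_linl.
rewrite !avg_sum; [|by move=> j; exact: polyfun_reval|by move=> j; exact: polyfun_mprod].
rewrite mulr_sumr; apply: eq_bigr => j _; rewrite mulrCA; congr (_ * _).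
exact: (gev j [::]).
Qed.

Lemma dlist_size v s p : p \in dlist v s -> (size p.2).+1 = size s.
Proof.
elim: s p => // w s IH p; rewrite inE => /orP[/eqP -> //|/mapP[q qs ->]] /=.
by rewrite (IH q).
Qed.

(** By gaussP a moment is computed from scalar products of the linear forms
    alone.  This replaces the change of variables u |-> A u on the sphere. *)
Lemma avg_isometry (h : V -> V) s : (forall v w, dot (h v) (h w) = dot v w) ->
  avg (mprod (map h s)) = avg (mprod s).
Proof.
move=> hh; have [n] := ubnP (size s); elim: n s => // n IH [//|v s] ns.
have n0 : (size s).+2%:R != 0 :> R by rewrite pnatr_eq0.
apply: (mulfI n0); rewrite [RHS]gaussP /= -{1}(size_map h s) gaussP !avg_reval.
have -> : dlist (h v) (map h s) = [seq (p.1, map h p.2) | p <- dlist v s].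
  elim: s {ns n0} => //= w s IHs; rewrite hh IHs; congr (_ :: _).
  by rewrite -!map_comp.
rewrite big_map big_seq [RHS]big_seq; apply: eq_bigr => p /dlist_size ps /=.
by rewrite IH// -ltnS (leq_trans _ ns)//= -ps.
Qed.

End Recursion.

(** * Integrals of zonal polynomials and Legendre orthogonality *)

Section Legendre.
Variable R : realType.
Local Notation V := 'cV[R]_3.
Local Notation P := {poly R}.

(** The surface integral of a polynomial in the height. *)
Definition zint (q : P) : R := avg (fun u : V => q.[u 2 0]).

Definition zlist (q : P) : rpoly R :=
  [seq (q`_i, nseq i (ev R 2)) | i <- index_iota 0 (size q)].

Lemma zlistE q u : reval (zlist q) u = q.[u 2 0].
Proof.
rewrite /reval big_map horner_coef big_mkord.
apply: eq_bigr => i _ /=.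
by rewrite /mprod big_nseq iter_mulr_1 dot_ev.
Qed.

Lemma polyfun_z q : polyfun (fun u : V => q.[u 2 0]).
Proof. by exists (zlist q) => u _; rewrite zlistE. Qed.

Lemma zintD p q : zint (p + q) = zint p + zint q.
Proof.
rewrite /zint -avgD; try exact: polyfun_z.
by apply: eq_avg => u _; rewrite hornerD.
Qed.

Lemma zintZ c q : zint (c *: q) = c * zint q.
Proof.
rewrite /zint -avgZ; try exact: polyfun_z.
by apply: eq_avg => u _; rewrite hornerZ.
Qed.

Lemma zint0 : zint 0 = 0.
Proof. by rewrite -(scale0r 0) zintZ mul0r. Qed.

(** By Archimedes' theorem the height is uniformly distributed: zint is
    half_area times the integral over [-1, 1]. *)
Definition half_area : R := zint 1 / 2.

Lemma zintXn n : n.+1%:R * zint 'X^n = half_area * (1 - (-1) ^+ n.+1).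
Proof.
have mz k : zint 'X^k = avg (@mono R 0 0 k).
  by apply: eq_avg => u _; rewrite hornerXn /mono !expr0 !mul1r.
elim/ltn_ind: n => -[|[|n]] IH.
- by rewrite !expr0 expr1 opprK mul1r /half_area mulfVK// pnatr_eq0.
- have := @avg_mono_z R 0 0 0; rewrite !mz mul0r => ->.
  by rewrite sqrrN expr1n subrr mulr0.
- have := @avg_mono_z R 0 0 n.+1; rewrite !mz !add0n => ->.
  by rewrite -mz IH//; congr (_ * _); rewrite !exprS; ring.
Qed.

Lemma zint_deriv q : zint q^`() = half_area * (q.[1] - q.[-1]).
Proof.
rewrite -[q]coefK poly_def.
elim/big_ind: _ => [|p r hp hr|i _].
- by rewrite deriv0 zint0 !horner0 subrr mulr0.
- by rewrite derivD zintD hp hr !hornerD; ring.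
- rewrite derivZ zintZ !hornerZ !hornerXn expr1n derivXn.
  case: (i : nat) => [|k]; first by rewrite mulr0n zint0 expr0 subrr !mulr0.
  by rewrite -scaler_nat zintZ zintXn /=; ring.
Qed.

Lemma half_area_gt0 : 0 < half_area.
Proof.
rewrite divr_gt0// /zint (@eq_avg _ _ (@mono R 0 0 0)); last first.
  by move=> u _; rewrite hornerC /mono !expr0 !mul1r.
have b0 : 0 < 2 * pi :> R by rewrite mulr_gt0// pi_gt0.
rewrite avg_mono; apply: mulr_gt0.
- have dF (x : R) : is_derive x (1 : R) (- @cos R) (sincos 1 0 x).
    by apply: is_derive_eq; rewrite /sincos opprK expr1 expr0 mulr1.
  rewrite /trig_int (FTC_everywhere (pi_gt0 R) (@continuous_sincos R 1%N 0%N) dF).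
  by rewrite !fctE cospi cos0 opprK; lra.
- have dF (x : R) : is_derive x (1 : R) id (sincos 0 0 x).
    by apply: is_derive_eq; rewrite /sincos !expr0 mulr1.
  by rewrite /trig_int (FTC_everywhere b0 (@continuous_sincos R 0%N 0%N) dF) subr0.
Qed.

Lemma zint_parts p q : zint (p^`() * q) =
  half_area * ((p * q).[1] - (p * q).[-1]) - zint (p * q^`()).
Proof. by rewrite -zint_deriv derivM zintD addrK. Qed.

Lemma derivn_exp_factor (p q : P) n k :
  exists r, (p ^+ (n + k) * q)^`(k) = p ^+ n * r.
Proof.
elim: k n => [|k IH] n; first by exists q; rewrite addn0.
have [r hr] := IH n.+1; rewrite derivnS -addSnnS hr derivM deriv_exp /=.
exists (p^`() * r *+ n.+1 + p * r^`()).
by rewrite exprS mulrDr !mulrnAr !mulrnAl; congr (_ *+ _ + _); ring.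
Qed.

Lemma derivn_exp_root (p q : P) n k x : (k < n)%N -> p.[x] = 0 ->
  ((p ^+ n * q)^`(k)).[x] = 0.
Proof.
move=> kn px; have [r hr] := derivn_exp_factor p q (n - k) k.
rewrite subnK ?(ltnW kn)// in hr; rewrite hr hornerM horner_exp px.
by rewrite expr0n subn_eq0 leqNgt kn mul0r.
Qed.

(** The hypothesis kills every boundary term. *)
Lemma zint_iter_parts (A B : P) N :
  (forall k j x, (k + j).+1 = N -> x = 1 \/ x = -1 ->
     (A^`(k)).[x] * (B^`(j)).[x] = 0) ->
  forall k j, (k + j)%N = N -> zint (A^`(k) * B^`(j)) = (-1) ^+ k * zint (A * B^`(N)).
Proof.
move=> h; elim=> [|k IH] j kj.
  by rewrite expr0 mul1r -kj add0n.
rewrite derivnS zint_parts !hornerM !h ?subrr ?mulr0 ?sub0r; try tauto; try lia.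
by rewrite -derivnS IH; [rewrite exprS mulN1r mulNr|lia].
Qed.

(** Rodrigues' formula makes (P_l)^(m) a multiple of the (m + l)-th derivative
    of (X^2 - 1)^l.  Integrating by parts m + l times moves all derivatives to
    (1 - X^2)^m q, whose degree is less than m + l; boundary terms vanish
    because 1 and -1 are roots of one of the two factors. *)
Lemma legendre_orth l m (q : P) : (m <= l)%N -> (size q <= l - m)%N ->
  zint ((1 - 'X^2) ^+ m * ((legendre R l)^`(m) * q)) = 0.
Proof.
move=> ml sq.
rewrite /legendre derivnZ -scalerAl -scalerAr zintZ.
set A := ('X^2 - 1) ^+ l.
have -> : (A^`(l))^`(m) = A^`(m + l) by rewrite /derivn iterD.
rewrite mulrCA; set B := (1 - 'X^2) ^+ m * q.
have p1 x : x = 1 \/ x = -1 -> ('X^2 - 1 : P).[x] = 0 /\ (1 - 'X^2 : P).[x] = 0.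
  by rewrite !hornerE => -[->|->]; rewrite ?expr1n ?sqrrN ?expr1n subrr.
have := @zint_iter_parts A B (m + l) _ (m + l)%N 0%N (addn0 _).
rewrite derivn0 => ->; last first.
  move=> k j x kj /p1[px1 px2].
  have [kl|lk] := ltnP k l.
    by rewrite -[A]mulr1 derivn_exp_root// mul0r.
  by rewrite derivn_exp_root ?mulr0//; lia.
rewrite poly.derivn_poly0 ?mulr0 ?zint0 ?mulr0//.
apply: leq_trans (size_polyMleq _ _) _.
have := size_poly_exp_leq (1 - 'X^2 : P) m.
have -> : size (1 - 'X^2 : P) = 3%N.
  by rewrite addrC size_polyDl size_polyN ?size_polyXn ?size_poly1.
by rewrite -[3.-1]/2%N; move: (polyseq (_ ^+ m)) (polyseq q) sq => a b; lia.
Qed.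

Lemma poly_eq0_itv (r : P) : (forall x, -1 <= x <= 1 -> r.[x] = 0) -> r = 0.
Proof.
move=> h; apply/eqP; apply: contraT => r0.
pose s := [seq (i.+1%:R : R)^-1 | i <- iota 0 (size r)].
have us : uniq s.
  rewrite map_inj_uniq ?iota_uniq// => i j /invr_inj/eqP.
  by rewrite eqr_nat eqSS => /eqP.
have rs : all (root r) s.
  apply/allP => x /mapP[i _ ->]; apply/rootP/h.
  have i0 : 0 < i.+1%:R :> R by rewrite ltr0n.
  rewrite (le_trans (lerN10 _)) ?invr_ge0 ?ler0n//=.
  by rewrite invf_le1// ler1n.
by have := max_poly_roots r0 rs us; rewrite size_map size_iota ltnn.
Qed.

Lemma antiderivative (r : P) : exists S : P, S^`() = r.
Proof.
rewrite -[r]coefK poly_def; elim/big_ind: _ => [|p q [S hS] [T hT]|i _].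
- by exists 0; rewrite deriv0.
- by exists (S + T); rewrite derivD hS hT.
- exists ((r`_i / i.+1%:R) *: 'X^(i.+1)).
  rewrite derivZ derivXn /= -scalerMnr scalerMnl -[_ *+ i.+1]mulr_natr.
  by rewrite mulfVK// pnatr_eq0.
Qed.

(** An antiderivative of r is monotone on [-1, 1] with equal end values, so it
    is constant. *)
Lemma zint_eq0 (r : P) : (forall x, -1 <= x <= 1 -> 0 <= r.[x]) -> zint r = 0 -> r = 0.
Proof.
have [S <-] := antiderivative r => r_ge0.
rewrite zint_deriv => /eqP; rewrite mulf_eq0 gt_eqF ?half_area_gt0//= subr_eq0.
move=> /eqP S1.
have mS : {in `[-1, 1] &, {homo horner S : x y / x <= y}}.
  by apply: ler_hornerW => x xI; apply: r_ge0; rewrite !ltW ?(itvP xI).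
have : S - (S.[1])%:P = 0.
  apply: poly_eq0_itv => x xI; rewrite hornerD hornerN hornerC; apply/eqP.
  have /andP[x1 x2] := xI.
  rewrite subr_eq0 eq_le {2}S1 !mS// ?in_itv/= ?x1 ?x2 ?lexx ?lerN10//=; lra.
by move/eqP; rewrite subr_eq0 => /eqP ->; rewrite derivC.
Qed.

End Legendre.

(** * Complex polynomial functions on the sphere *)

Section ComplexPoly.
Variable R : realType.
Local Notation V := 'cV[R]_3.
Local Notation C := R[i].
Local Notation rc := (@real_complex R).
Local Notation Re := (@complex.Re R).
Local Notation Im := (@complex.Im R).
Local Notation cint := (@sphere_integral R).

Lemma cReD (x y : C) : Re (x + y) = Re x + Re y.
Proof. by case: x; case: y. Qed.
Lemma cImD (x y : C) : Im (x + y) = Im x + Im y.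
Proof. by case: x; case: y. Qed.
Lemma cReM (x y : C) : Re (x * y) = Re x * Re y - Im x * Im y.
Proof. by case: x; case: y. Qed.
Lemma cImM (x y : C) : Im (x * y) = Re x * Im y + Im x * Re y.
Proof. by case: x; case: y. Qed.
Lemma cconjE (x : C) : Num.conj x = Complex (Re x) (- Im x).
Proof. by case: x. Qed.
Lemma cconj_rc (x : R) : Num.conj (rc x) = rc x.
Proof. by rewrite cconjE /= oppr0. Qed.
Lemma complex_eq (x y : C) : Re x = Re y -> Im x = Im y -> x = y.
Proof. by case: x => a b; case: y => c d /= -> ->. Qed.
Lemma cRe_sum I (s : seq I) (F : I -> C) : Re (\sum_(i <- s) F i) = \sum_(i <- s) Re (F i).
Proof. by elim: s => [|i s IH]; rewrite ?big_nil// !big_cons cReD IH. Qed.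
Lemma cIm_sum I (s : seq I) (F : I -> C) : Im (\sum_(i <- s) F i) = \sum_(i <- s) Im (F i).
Proof. by elim: s => [|i s IH]; rewrite ?big_nil// !big_cons cImD IH. Qed.
Lemma cconjM (x y : C) : Num.conj (x * y) = Num.conj x * Num.conj y.
Proof. exact: rmorphM. Qed.
Lemma cconjX (x : C) n : Num.conj (x ^+ n) = Num.conj x ^+ n.
Proof. exact: rmorphXn. Qed.

Definition cpoly := seq (C * seq V).
Definition ceval (P : cpoly) (u : V) : C := \sum_(p <- P) p.1 * rc (mprod p.2 u).
(** f agrees on the sphere with a polynomial of degree at most L. *)
Definition cpf (L : nat) (f : V -> C) :=
  exists P : cpoly, all (fun p => size p.2 <= L)%N P /\
    forall u, S2 u -> f u = ceval P u.

Lemma cpf_ext L f g : (forall u, S2 u -> f u = g u) -> cpf L g -> cpf L f.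
Proof. by move=> fg [P [sP h]]; exists P; split=> // u Su; rewrite fg// h. Qed.

Lemma cpf_le L M f : (L <= M)%N -> cpf L f -> cpf M f.
Proof.
move=> LM [P [sP h]]; exists P; split=> //; apply: sub_all sP => p.
by move=> /leq_trans; apply.
Qed.

Lemma cpfD L f g : cpf L f -> cpf L g -> cpf L (fun u => f u + g u).
Proof.
move=> [P [sP h]] [Q [sQ k]]; exists (P ++ Q); split; first by rewrite all_cat sP.
by move=> u Su; rewrite /ceval big_cat h// k.
Qed.

Lemma cpf_cst L c : cpf L (fun=> c).
Proof.
exists [:: (c, [::])]; split=> // u _.
by rewrite /ceval big_seq1 /mprod big_nil mulr1.
Qed.

Lemma cpfM L M f g : cpf L f -> cpf M g -> cpf (L + M) (fun u => f u * g u).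
Proof.
move=> [P [sP h]] [Q [sQ k]].
exists [seq (p.1 * q.1, p.2 ++ q.2) | p <- P, q <- Q]; split.
  apply/allP => _ /allpairsP[[p q] /= [pP qQ ->]] /=.
  by rewrite size_cat leq_add// ?(allP sP)// ?(allP sQ).
move=> u Su; rewrite /ceval big_allpairs_dep /= h// k// /ceval mulr_suml.
apply: eq_bigr => p _; rewrite mulr_sumr; apply: eq_bigr => q _ /=.
by rewrite mprod_cat rmorphM /=; ring.
Qed.

Lemma cpfZ L c f : cpf L f -> cpf L (fun u => c * f u).
Proof. by move=> h; rewrite -[L]add0n; apply: cpfM => //; exact: cpf_cst. Qed.

Lemma cpf_sum I (s : seq I) L (F : I -> V -> C) :
  (forall i, cpf L (F i)) -> cpf L (fun u => \sum_(i <- s) F i u).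
Proof.
move=> h; elim: s => [|i s IH].
  by apply: cpf_ext (cpf_cst L 0) => u _; rewrite big_nil.
by apply: cpf_ext (cpfD (h i) IH) => u _; rewrite big_cons.
Qed.

Lemma cpfX L f n : cpf L f -> cpf (n * L) (fun u => f u ^+ n).
Proof.
move=> h; elim: n => [|n IH]; first exact: cpf_cst.
by rewrite mulSn; apply: cpf_ext (cpfM h IH) => u _; rewrite exprS.
Qed.

Lemma cpf_mprod s : cpf (size s) (fun u => rc (mprod s u)).
Proof.
exists [:: (1, s)]; split; first by rewrite /= leqnn.
by move=> u _; rewrite /ceval big_seq1 mul1r.
Qed.

Lemma cpf_coord i : cpf 1 (fun u => rc (u i 0)).
Proof.
apply: cpf_ext (cpf_mprod [:: ev R i]) => u _.
by rewrite /mprod big_seq1 dot_ev.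
Qed.

Lemma cpf_conj L f : cpf L f -> cpf L (fun u => Num.conj (f u)).
Proof.
move=> [P [sP h]]; exists [seq (Num.conj p.1, p.2) | p <- P]; split.
  by rewrite all_map.
move=> u Su; rewrite h// /ceval big_map rmorph_sum /=; apply: eq_bigr => p _.
by rewrite cconjM cconj_rc.
Qed.

Lemma cpf_re_im L f : cpf L f ->
  polyfun (fun u => Re (f u)) /\ polyfun (fun u => Im (f u)).
Proof.
move=> [P [_ h]]; split.
  exists [seq (Re p.1, p.2) | p <- P] => u Su.
  rewrite h// /ceval cRe_sum /reval big_map; apply: eq_bigr => p _ /=.
  by rewrite cReM /= mulr0 subr0.
exists [seq (Im p.1, p.2) | p <- P] => u Su.
rewrite h// /ceval cIm_sum /reval big_map; apply: eq_bigr => p _ /=.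
by rewrite cImM /= mulr0 add0r.
Qed.

Lemma eq_cint f g : (forall u, S2 u -> f u = g u) -> cint f = cint g.
Proof.
move=> fg; rewrite /sphere_integral; congr (Complex _ _); apply: eq_Rintegral => u;
  by rewrite inE => /fg ->.
Qed.

Lemma cintE f : cint f = Complex (avg (fun u => Re (f u))) (avg (fun u => Im (f u))).
Proof. by []. Qed.

Lemma cintD L f g : cpf L f -> cpf L g -> cint (fun u => f u + g u) = cint f + cint g.
Proof.
move=> /cpf_re_im[f1 f2] /cpf_re_im[g1 g2]; rewrite !cintE.
apply: complex_eq => /=; rewrite -avgD//; apply: eq_avg => u _.
  by rewrite cReD.
by rewrite cImD.
Qed.

Lemma cintZ L c f : cpf L f -> cint (fun u => c * f u) = c * cint f.
Proof.
move=> /cpf_re_im[f1 f2]; rewrite !cintE.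
have h a b : avg (fun u => a * Re (f u) + b * Im (f u)) =
    a * avg (fun u => Re (f u)) + b * avg (fun u => Im (f u)).
  by rewrite avgD ?avgZ//; exact: polyfunZ.
apply: complex_eq; rewrite ?cReM ?cImM /=.
  by rewrite -mulNr -h; apply: eq_avg => u _; rewrite cReM mulNr.
by rewrite [RHS]addrC -h; apply: eq_avg => u _; rewrite cImM addrC.
Qed.

Lemma cint0 : cint (fun=> 0) = 0.
Proof. by rewrite (@eq_cint _ (fun u => 0 * 0)) ?(cintZ 0 (cpf_cst 0 0)) ?mul0r// => u; rewrite mul0r. Qed.

Lemma cint_sum I (s : seq I) L (F : I -> V -> C) : (forall i, cpf L (F i)) ->
  cint (fun u => \sum_(i <- s) F i u) = \sum_(i <- s) cint (F i).
Proof.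
move=> h; elim: s => [|i s IH].
  by rewrite big_nil -[RHS]cint0; apply: eq_cint => u _; rewrite big_nil.
rewrite big_cons -IH -(cintD (h i) (cpf_sum s h)).
by apply: eq_cint => u _; rewrite big_cons.
Qed.

Lemma cint_conj L f : cpf L f -> cint (fun u => Num.conj (f u)) = Num.conj (cint f).
Proof.
move=> /cpf_re_im[f1 f2]; rewrite !cintE cconjE /=; congr (Complex _ _).
  by apply: eq_avg => u _; rewrite cconjE.
by rewrite -mulN1r -avgZ//; apply: eq_avg => u _; rewrite cconjE mulN1r.
Qed.

Lemma cint_rc f : cint (fun u => rc (f u)) = rc (avg f).
Proof.
rewrite cintE /=; congr (Complex _ _).
rewrite (@eq_avg _ _ (fun u => 0 * mprod [::] u)).
  by rewrite avgZ ?mul0r//; exact: polyfun_mprod.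
by move=> u _; rewrite mul0r.
Qed.

Lemma dot_mulmx (A : 'M[R]_3) v u : dot v (A *m u) = dot (A^T *m v) u.
Proof.
rewrite /dot; under eq_bigr do rewrite !mxE mulr_sumr.
rewrite exchange_big; apply: eq_bigr => i _; rewrite mxE mulr_suml.
by apply: eq_bigr => j _; rewrite mxE; ring.
Qed.

Lemma mprod_mulmx (A : 'M[R]_3) s u :
  mprod s (A *m u) = mprod [seq A^T *m v | v <- s] u.
Proof. by rewrite /mprod big_map; apply: eq_bigr => v _; rewrite dot_mulmx. Qed.

Definition orth (A : 'M[R]_3) := A *m A^T = 1%:M.

Lemma orth_tr A : orth A -> orth A^T.
Proof. by rewrite /orth trmxK => /mulmx1C. Qed.

Lemma orth_S2 A u : orth A -> S2 u -> S2 (A *m u).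
Proof.
move=> /orth_tr; rewrite /orth trmxK /S2 /= => oA Su.
by rewrite trmx_mul mulmxA -(mulmxA _ _ A) oA mulmx1.
Qed.

Lemma cpf_rot L f A : orth A -> cpf L f -> cpf L (fun u => f (A *m u)).
Proof.
move=> oA [P [sP h]]; exists [seq (p.1, [seq A^T *m v | v <- p.2]) | p <- P]; split.
  by rewrite all_map; apply: sub_all sP => p /=; rewrite size_map.
move=> u Su; rewrite h; last exact: orth_S2.
by rewrite /ceval big_map; apply: eq_bigr => p _; rewrite mprod_mulmx.
Qed.

(** Transposing A moves it to the linear forms, where avg_isometry applies. *)
Lemma cint_rot L f A : orth A -> cpf L f -> cint (fun u => f (A *m u)) = cint f.
Proof.
move=> oA [P [sP h]].
rewrite (@eq_cint _ (ceval [seq (p.1, [seq A^T *m v | v <- p.2]) | p <- P])); last first.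
  move=> u Su; rewrite h; last exact: orth_S2.
  by rewrite /ceval big_map; apply: eq_bigr => p _; rewrite mprod_mulmx.
rewrite (eq_cint h) /ceval.
have cp s (c : C) : cpf (size s) (fun u => c * rc (mprod s u)).
  by apply: cpfZ; exact: cpf_mprod.
elim: P {sP h} => [|p P IH]; first by apply: eq_cint => u _; rewrite !big_nil.
have hc (Q : cpoly) : exists L, cpf L (ceval Q).
  elim: Q => [|q Q [M hM]]; first by exists 0%N, [::].
  exists (maxn (size q.2) M).
  have := cpfD (cpf_le (leq_maxl _ M) (cp q.2 q.1)) (cpf_le (leq_maxr (size q.2) M) hM).
  by apply: cpf_ext => u _; rewrite /ceval big_cons.
have step q Q : cint (fun u => \sum_(p <- q :: Q) p.1 * rc (mprod p.2 u)) =
    q.1 * rc (avg (mprod q.2)) + cint (ceval Q).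
  have [M hM] := hc Q.
  rewrite -cint_rc -(cintZ _ (cpf_mprod q.2)).
  rewrite -(cintD (cpf_le (leq_maxl _ M) (cp q.2 q.1)) (cpf_le (leq_maxr (size q.2) M) hM)).
  by apply: eq_cint => u _; rewrite /ceval big_cons.
rewrite map_cons !step /= IH; congr (_ * rc _ + _).
apply: avg_isometry => v w.
rewrite -dot_mulmx mulmxA.
by move: oA; rewrite /orth => ->; rewrite mul1mx.
Qed.

End ComplexPoly.

(** * Orthogonality of the spherical harmonics *)

Section Harmonics.
Variable R : realType.
Local Notation V := 'cV[R]_3.
Local Notation C := R[i].
Local Notation rc := (@real_complex R).
Local Notation Re := (@complex.Re R).
Local Notation Im := (@complex.Im R).
Local Notation cint := (@sphere_integral R).

(** x + i y, or x - i y when b holds. *)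
Definition wp (b : bool) (u : V) : C := Complex (u 0 0) ((-1) ^+ b * u 1 0).

Lemma conj_wp b u : Num.conj (wp b u) = wp (~~ b) u.
Proof. by rewrite cconjE; congr (Complex _ _) => /=; case: b; rewrite /= ?expr0 ?expr1; ring. Qed.

Lemma cpf_wp b : cpf 1 (wp b).
Proof.
have := cpfD (cpf_coord R 0) (cpfZ (Complex 0 ((-1) ^+ b)) (cpf_coord R 1)).
apply: cpf_ext => u _; apply: complex_eq; rewrite ?cReD ?cImD ?cReM ?cImM /=; ring.
Qed.

Lemma wp_norm b u : S2 u -> wp b u * wp (~~ b) u = rc (1 - u 2 0 ^+ 2).
Proof.
move=> /S2E; rewrite !big_ord_recr big_ord0 /= add0r => h.
have e0 : widen_ord (leqnSn 2) (widen_ord (leqnSn 1) ord_max) = 0 :> 'I_3 by exact/val_inj.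
have e1 : widen_ord (leqnSn 2) ord_max = 1 :> 'I_3 by exact/val_inj.
have e2 : ord_max = 2 :> 'I_3 by exact/val_inj.
rewrite e0 e1 e2 in h.
have -> : 1 - u 2 0 ^+ 2 = u 0 0 ^+ 2 + u 1 0 ^+ 2 by rewrite -h; ring.
by apply: complex_eq; rewrite ?cReM ?cImM /=; case: b; rewrite ?expr0 ?expr1; ring.
Qed.

Definition zfun (q : {poly R}) (u : V) : C := rc q.[u 2 0].

Lemma cpf_zfun (q : {poly R}) : cpf (size q).-1 (zfun q).
Proof.
have h (i : 'I_(size q)) : cpf (size q).-1 (fun u => rc q`_i * rc (u 2 0) ^+ i).
  apply: cpfZ; apply: cpf_le (cpfX i (cpf_coord R 2)).
  by rewrite muln1; case: i => /= i; case: (size q).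
apply: cpf_ext (cpf_sum _ h) => u _.
rewrite /zfun horner_coef rmorph_sum; apply: eq_bigr => i _.
by rewrite rmorphM rmorphXn.
Qed.

(** The common shape of all spherical harmonics (lemma sphE). *)
Definition wz b m (q : {poly R}) (u : V) : C := wp b u ^+ m * zfun q u.

Lemma cpf_wz b m (q : {poly R}) : cpf (m + (size q).-1) (wz b m q).
Proof.
apply: cpfM; last exact: cpf_zfun.
by apply: cpf_le (cpfX m (cpf_wp b)); rewrite muln1.
Qed.

Lemma de_moivre (t : R) n :
  Complex (cos t) (sin t) ^+ n = Complex (cos (t *+ n)) (sin (t *+ n)).
Proof.
elim: n => [|n IH]; first by rewrite expr0 mulr0n cos0 sin0.
rewrite exprS IH mulrS cosD sinD; apply: complex_eq; rewrite ?cReM ?cImM /=; ring.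
Qed.

Definition rotz (t : R) : 'M[R]_3 := \matrix_(i, j)
  nth 0 (nth [::] [:: [:: cos t; - sin t; 0]; [:: sin t; cos t; 0]; [:: 0; 0; 1]] i) j.

Lemma sum3 (A : zmodType) (F : 'I_3 -> A) : \sum_i F i = F 0 + F 1 + F 2.
Proof.
rewrite !big_ord_recr big_ord0 /= add0r.
by congr (F _ + F _ + F _); exact/val_inj.
Qed.

Lemma rotz_orth t : orth (rotz t).
Proof.
have cs := cos2Dsin2 t.
apply/matrixP => i j; rewrite mxE sum3 !mxE.
elim/ord3_ind: i; elim/ord3_ind: j; rewrite /= ?mulr1n ?mulr0n;
  first [ring|by rewrite -[RHS]cs; ring].
Qed.

Lemma wp_rotz b t u : wp b (rotz t *m u) = Complex (cos t) ((-1) ^+ b * sin t) * wp b u.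
Proof.
apply: complex_eq; rewrite ?cReM ?cImM /= !mxE !sum3 !mxE /=;
  case: b; rewrite ?expr0 ?expr1; ring.
Qed.

Lemma z_rotz t (u : V) : (rotz t *m u) 2 0 = u 2 0.
Proof. by rewrite mxE sum3 !mxE /= !mul0r mul1r !add0r. Qed.

(** The rotation by pi / m about the axis changes the sign of (x + i y)^m. *)
Lemma cint_wz0 b m (q : {poly R}) : (0 < m)%N -> cint (wz b m q) = 0.
Proof.
move=> m0.
have key b' : b' = false -> cint (wz b' m q) = 0.
  move=> b'E; pose t : R := pi / m%:R.
  have tm : t *+ m = pi by rewrite -mulr_natr mulfVK// pnatr_eq0 -lt0n.
  have h := cint_rot (rotz_orth t) (cpf_wz b' m q).
  rewrite (@eq_cint _ _ (fun u => -1 * wz b' m q u)) in h.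
    rewrite (cintZ _ (cpf_wz b' m q)) mulN1r in h.
    have : cint (wz b' m q) *+ 2 = 0 by rewrite mulr2n -{1}h addNr.
    by move/eqP; rewrite mulrn_eq0 => /eqP.
  move=> u _; rewrite /wz /zfun z_rotz wp_rotz b'E expr0 mul1r exprMn.
  rewrite de_moivre tm cospi sinpi -!mulrA; congr (_ * _).
  by apply: complex_eq; rewrite /= ?oppr0.
case: b; last exact: key.
have := cint_conj (cpf_wz false m q); rewrite key// conjC0 => <-.
by apply: eq_cint => u _; rewrite /wz cconjM cconjX conj_wp /zfun cconj_rc.
Qed.

Lemma onemX2E (x : R) : (1 - 'X^2 : {poly R}).[x] = 1 - x ^+ 2.
Proof. by rewrite !hornerE. Qed.

(** On the sphere (x + i y) (x - i y) = 1 - z^2, so the smaller of the two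
    powers is absorbed into the factor depending on z; what is left is killed
    by rotations about the axis unless the exponents match. *)
Lemma cint_ww b b' m m' (q : {poly R}) :
  cint (fun u => wp b u ^+ m * (wp b' u ^+ m' * zfun q u)) =
  if (m + m' == 0)%N || (b != b') && (m == m') then rc (zint ((1 - 'X^2) ^+ m * q)) else 0.
Proof.
have rz r : cint (zfun r) = rc (zint r) by rewrite /zfun cint_rc.
have dif b1 n k : (0 < k)%N ->
    cint (fun u => wp b1 u ^+ (n + k) * (wp (~~ b1) u ^+ n * zfun q u)) = 0.
  move=> k0; rewrite -(@cint_wz0 b1 k ((1 - 'X^2) ^+ n * q) k0).
  apply: eq_cint => u Su; rewrite /wz /zfun exprD hornerM rmorphM/= horner_exp onemX2E.
  rewrite rmorphXn /=; move: (rc q.[_]) => Z; rewrite -(wp_norm b1 Su) exprMn.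
  by move: (_ ^+ n) (_ ^+ k) (_ ^+ n) => *; ring.
have [<-{b'}|nb] := eqVneq b b'; rewrite ?orbF.
  have [/eqP|mm] := eqVneq (m + m')%N 0%N.
    rewrite addn_eq0 => /andP[/eqP -> /eqP ->]; rewrite -rz.
    by apply: eq_cint => u _; rewrite !expr0 !mul1r.
  rewrite -(@cint_wz0 b (m + m') q) ?lt0n//.
  by apply: eq_cint => u _; rewrite /wz exprD mulrA.
have eb' : b' = ~~ b by case: b b' nb => -[].
rewrite {b' nb}eb' /=.
have [->|mm] := eqVneq m m'.
  rewrite orbT -rz; apply: eq_cint => u Su.
  rewrite /zfun hornerM rmorphM/= horner_exp onemX2E rmorphXn /=.
  by move: (rc q.[_]) => Z; rewrite -(wp_norm b Su) exprMn mulrA.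
rewrite orbF; case: ifP => [/eqP mm0|_]; first lia.
have [lt|lt|e] := ltngtP m m'; last by rewrite e eqxx in mm.
  rewrite -(@dif (~~ b) m (m' - m)%N) ?subn_gt0// subnKC ?(ltnW lt)// negbK.
  by apply: eq_cint => u _; ring.
by rewrite -(@dif b m' (m - m')%N) ?subn_gt0// subnKC ?(ltnW lt).
Qed.

Definition legd l m : {poly R} := (legendre R l)^`(m).

Lemma size_legendre l : size (legendre R l) = l.+1.
Proof.
rewrite /legendre size_scale; last first.
  by rewrite invr_eq0 mulf_neq0 ?expf_neq0 ?pnatr_eq0// -lt0n fact_gt0.
have s3 : size ('X^2 - 1 : {poly R}) = 3%N.
  by rewrite size_polyDl size_polyXn ?size_polyN ?size_poly1.
have p0 : ('X^2 - 1 : {poly R}) != 0 by rewrite -size_poly_eq0 s3.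
have := size_exp ('X^2 - 1 : {poly R}) l.
have : (0 < size (('X^2 - 1 : {poly R}) ^+ l))%N by rewrite size_poly_gt0 expf_neq0.
by move=> h1 h2; rewrite size_derivn -(prednK h1) h2 s3 -[3.-1]/2%N; lia.
Qed.

Lemma size_legd l m : size (legd l m) = (l.+1 - m)%N.
Proof. by rewrite /legd size_derivn size_legendre. Qed.

Definition mneg (m : int) := if m is Negz _ then true else false.

Lemma sphE l m : (`|m| <= l)%N -> exists2 c : C, c != 0 &
  forall u, sph_harmonic l m u = c * wz (mneg m) `|m| (legd l `|m|) u.
Proof.
have pi0 := pi_gt0 R.
have nat_case k : (k <= l)%N -> exists2 c : C, c != 0 &
    forall u : V, sph_harmonic_nat l k u = c * wz false k (legd l k) u.
  move=> kl; exists (rc (Num.sqrt ((2 * l + 1)%:R / (4 * pi) * ((l - k)`!%:R / (l + k)`!%:R)))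
    * rc ((-1) ^+ k)); last first.
    move=> u; rewrite /sph_harmonic_nat /wz /zfun /wp expr0 mul1r rmorphM /=.
    by rewrite -!mulrA; congr (_ * (_ * _)); rewrite mulrC.
  rewrite mulf_neq0//; last first.
    by rewrite fmorph_eq0 expf_neq0// oppr_eq0 oner_eq0.
  rewrite fmorph_eq0 gt_eqF// sqrtr_gt0 mulr_gt0//.
    by rewrite divr_gt0// ?ltr0n ?addn1// mulr_gt0.
case: m => k kl; first exact: nat_case.
have [c c0 hc] := nat_case k.+1 kl.
exists ((-1) ^+ k.+1 * Num.conj c).
  by rewrite mulf_neq0 ?expf_neq0 ?oppr_eq0 ?oner_eq0 ?conjC_eq0.
move=> u; rewrite /= hc cconjM -mulrA; congr (_ * (_ * _)).
by rewrite /wz cconjM cconjX conj_wp /zfun cconj_rc.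
Qed.

Lemma cpf_sph l m : (`|m| <= l)%N -> cpf l (sph_harmonic l m : V -> C).
Proof.
move=> ml; have [c _ hc] := sphE ml.
apply: cpf_ext (fun u _ => hc u) _; apply: cpfZ.
by apply: cpf_le (cpf_wz _ _ _); rewrite size_legd; lia.
Qed.

Lemma zint_ge0 (q : {poly R}) : (forall x, -1 <= x <= 1 -> 0 <= q.[x]) -> 0 <= zint q.
Proof.
move=> h; apply: Rintegral_ge0 => u Su; apply: h.
by have := S2_coord 2 Su; rewrite ler_norml.
Qed.

Lemma zint_weight_gt0 m (q : {poly R}) : q != 0 -> 0 < zint ((1 - 'X^2) ^+ m * (q * q)).
Proof.
move=> q0.
have pos (x : R) : -1 <= x <= 1 -> 0 <= ((1 - 'X^2) ^+ m * (q * q)).[x].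
  move=> /andP[x1 x2]; rewrite !hornerM horner_exp onemX2E.
  rewrite mulr_ge0//; last by rewrite -expr2 sqr_ge0.
  by rewrite exprn_ge0// subr_ge0; nra.
rewrite lt_def zint_ge0// andbT; apply/eqP => /(zint_eq0 pos)/eqP.
rewrite !mulf_eq0 (negbTE q0) !orbF expf_eq0 => /andP[_].
rewrite subr_eq0 => /eqP/(congr1 (fun p : {poly R} => p.[0])).
by rewrite !hornerE expr0n /= => /eqP; rewrite oner_eq0.
Qed.

(** Different orders m are separated by rotations about the axis, different
    degrees of the same order by the orthogonality of Legendre polynomials
    with the weight (1 - z^2)^|m|. *)
Lemma sph_orth l m l' m' : (`|m| <= l)%N -> (`|m'| <= l')%N -> (l, m) != (l', m') ->
  cint (fun u => Num.conj (sph_harmonic l m u) * sph_harmonic l' m' u) = 0.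
Proof.
move=> ml ml' ne.
have [c _ hc] := sphE ml; have [c' _ hc'] := sphE ml'.
pose F u := wp (~~ mneg m) u ^+ `|m| *
    (wp (mneg m') u ^+ `|m'| * zfun (legd l `|m| * legd l' `|m'|) u).
have cF : exists L, cpf L F.
  eexists; apply: cpfM; first exact: cpfX (cpf_wp _).
  by apply: cpfM; [exact: cpfX (cpf_wp _)|exact: cpf_zfun].
have [L hL] := cF.
rewrite (@eq_cint _ _ (fun u => (Num.conj c * c') * F u)); last first.
  move=> u _; rewrite hc hc' /wz !cconjM cconjX conj_wp /zfun cconj_rc /F /zfun.
  by rewrite hornerM rmorphM /=; ring.
rewrite (cintZ _ hL) cint_ww; case: ifP; last by rewrite mulr0.
move=> cond.
have em : m = m'.
  case/orP: cond => [|/andP[]].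
    rewrite addn_eq0 !absz_eq0 => /andP[/eqP -> /eqP ->] //.
  move: ml ml' {ne hc hc' F cF hL}; case: m => k; case: m' => k' //= _ _ _ /eqP.
    by move=> ->.
  by move=> [->].
move: ne; rewrite -em xpair_eqE eqxx andbT => ll.
suff -> : zint ((1 - 'X^2) ^+ `|m| * (legd l `|m| * legd l' `|m|)) = 0 by rewrite mulr0.
rewrite -em in ml'.
have [lt|lt|e] := ltngtP l l'; last by rewrite e eqxx in ll.
  by rewrite [legd l _ * _]mulrC legendre_orth// size_legd; lia.
by rewrite legendre_orth// size_legd; lia.
Qed.

Lemma sph_norm l m : (`|m| <= l)%N -> exists2 N : R, 0 < N &
  cint (fun u => Num.conj (sph_harmonic l m u) * sph_harmonic l m u) = rc N.
Proof.
move=> ml; have [c c0 hc] := sphE ml.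
exists ((Re c ^+ 2 + Im c ^+ 2) * zint ((1 - 'X^2) ^+ `|m| * (legd l `|m| * legd l `|m|))).
  apply: mulr_gt0; last first.
    by apply: zint_weight_gt0; rewrite -size_poly_eq0 size_legd; lia.
  rewrite lt_def addr_ge0 ?sqr_ge0// andbT paddr_eq0 ?sqr_ge0// !sqrf_eq0.
  by apply: contraNN c0 => /andP[/eqP h1 /eqP h2]; apply/eqP/complex_eq.
pose F u := wp (~~ mneg m) u ^+ `|m| *
    (wp (mneg m) u ^+ `|m| * zfun (legd l `|m| * legd l `|m|) u).
have cF : exists L, cpf L F.
  eexists; apply: cpfM; first exact: cpfX (cpf_wp _).
  by apply: cpfM; [exact: cpfX (cpf_wp _)|exact: cpf_zfun].
have [L hL] := cF.
rewrite (@eq_cint _ _ (fun u => (Num.conj c * c) * F u)); last first.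
  move=> u _; rewrite hc /wz !cconjM cconjX conj_wp /zfun cconj_rc /F /zfun.
  by rewrite hornerM rmorphM /=; ring.
rewrite (cintZ _ hL) cint_ww eqxx andbT.
have -> : (~~ mneg m != mneg m) by case: (mneg m).
rewrite orbT rmorphM /=; congr (_ * _).
by rewrite cconjE; apply: complex_eq; rewrite ?cReM ?cImM /=; ring.
Qed.

End Harmonics.

(** * Harmonic decomposition of polynomials *)

Section HarmonicSpaces.
Variable R : realType.
Local Notation V := 'cV[R]_3.
Local Notation C := R[i].
Local Notation rc := (@real_complex R).
Local Notation Re := (@complex.Re R).
Local Notation Im := (@complex.Im R).
Local Notation cint := (@sphere_integral R).

Definition ip (f g : V -> C) : C := cint (fun u => Num.conj (f u) * g u).

Lemma eq_ip f f' g g' : (forall u, S2 u -> f u = f' u) -> (forall u, S2 u -> g u = g' u) ->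
  ip f g = ip f' g'.
Proof. by move=> h k; apply: eq_cint => u Su; rewrite h// k. Qed.

Lemma cpf_ip L M (f g : V -> C) : cpf L f -> cpf M g -> cpf (L + M) (fun u => Num.conj (f u) * g u).
Proof. by move=> hf hg; apply: cpfM => //; exact: cpf_conj. Qed.

Lemma ip_sumr I (s : seq I) L M f (d : I -> C) (G : I -> V -> C) :
  cpf L f -> (forall i, cpf M (G i)) ->
  ip f (fun u => \sum_(i <- s) d i * G i u) = \sum_(i <- s) d i * ip f (G i).
Proof.
move=> hf hG; transitivity (cint (fun u => \sum_(i <- s) d i * (Num.conj (f u) * G i u))).
  by apply: eq_cint => u _; rewrite mulr_sumr; apply: eq_bigr => i _; rewrite mulrCA.
rewrite (@cint_sum _ _ _ (L + M)).
  by apply: eq_bigr => i _; rewrite (cintZ _ (cpf_ip hf (hG i))).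
by move=> i; apply: cpfZ; exact: cpf_ip.
Qed.

Lemma ipC L M f g : cpf L f -> cpf M g -> ip g f = Num.conj (ip f g).
Proof.
move=> hf hg; rewrite -(cint_conj (cpf_ip hf hg)); apply: eq_cint => u _.
by rewrite cconjM conjCK mulrC.
Qed.

Lemma ip_suml I (s : seq I) L M f (d : I -> C) (G : I -> V -> C) :
  cpf L f -> (forall i, cpf M (G i)) ->
  ip (fun u => \sum_(i <- s) d i * G i u) f = \sum_(i <- s) Num.conj (d i) * ip (G i) f.
Proof.
move=> hf hG.
have hs : cpf M (fun u => \sum_(i <- s) d i * G i u).
  by apply: cpf_sum => i; exact: cpfZ.
rewrite (ipC hf hs) (ip_sumr _ _ hf hG) rmorph_sum; apply: eq_bigr => i _.
by rewrite rmorphM (ipC hf (hG i)).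
Qed.

Lemma ip_rot L M f g A : orth A -> cpf L f -> cpf M g ->
  ip (fun u => f (A *m u)) (fun u => g (A *m u)) = ip f g.
Proof. by move=> oA hf hg; apply: (cint_rot oA (cpf_ip hf hg)). Qed.

Lemma ip_ge0 L f : cpf L f -> 0 <= ip f f.
Proof.
move=> hf; rewrite /ip cintE.
have -> : avg (fun u => Im (Num.conj (f u) * f u)) = 0.
  rewrite (@eq_avg _ _ (fun u => 0 * mprod [::] u)).
    by rewrite avgZ ?mul0r//; exact: polyfun_mprod.
  by move=> u _; rewrite cImM cconjE /=; ring.
rewrite lecE /= eqxx /=; apply: Rintegral_ge0 => u _.
by rewrite cReM cconjE /= mulNr opprK addr_ge0// -expr2 sqr_ge0.
Qed.

(** The span of the Y_{l,m} of degree l, up to equality on the sphere. *)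
Definition Vl (l : nat) (f : V -> C) := exists c : 'I_(2 * l).+1 -> C,
  forall u, S2 u -> f u = \sum_(k < (2 * l).+1) c k * sph_harmonic l (k%:Z - l%:Z) u.

Lemma index_bound l (k : 'I_(2 * l).+1) : (`|k%:Z - l%:Z| <= l)%N.
Proof. by case: k => k /= kl; lia. Qed.

Lemma Vl_cpf l f : Vl l f -> cpf l f.
Proof.
move=> [c hc]; apply: cpf_ext hc _; apply: cpf_sum => k.
by apply: cpfZ; apply: cpf_sph; exact: index_bound.
Qed.

Lemma Vl_ext l f g : (forall u, S2 u -> f u = g u) -> Vl l g -> Vl l f.
Proof. by move=> fg [c hc]; exists c => u Su; rewrite fg// hc. Qed.

Lemma VlD l f g : Vl l f -> Vl l g -> Vl l (fun u => f u + g u).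
Proof.
move=> [c hc] [d hd]; exists (fun k => c k + d k) => u Su.
by rewrite hc// hd// -big_split; apply: eq_bigr => k _; rewrite mulrDl.
Qed.

Lemma VlZ l a f : Vl l f -> Vl l (fun u => a * f u).
Proof.
move=> [c hc]; exists (fun k => a * c k) => u Su.
by rewrite hc// mulr_sumr; apply: eq_bigr => k _; rewrite mulrA.
Qed.

Lemma Vl0 l : Vl l (fun=> 0).
Proof. by exists (fun=> 0) => u _; rewrite big1// => k _; rewrite mul0r. Qed.

Lemma Vl_sum I (s : seq I) l (F : I -> V -> C) :
  (forall i, Vl l (F i)) -> Vl l (fun u => \sum_(i <- s) F i u).
Proof.
move=> h; elim: s => [|i s IH].
  by apply: Vl_ext (Vl0 l) => u _; rewrite big_nil.
by apply: Vl_ext (VlD (h i) IH) => u _; rewrite big_cons.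
Qed.

Lemma Vl_sph l m : (`|m| <= l)%N -> Vl l (sph_harmonic l m : V -> C).
Proof.
move=> ml; have kl : (`|(m + l%:Z)%R| < (2 * l).+1)%N by lia.
exists (fun k => (k == Ordinal kl)%:R) => u _.
rewrite (bigD1 (Ordinal kl))//= eqxx mul1r big1 ?addr0.
  by congr (sph_harmonic _ _ _); lia.
by move=> k /negbTE ->; rewrite mul0r.
Qed.

Lemma Vl_orth l l' f g : l != l' -> Vl l f -> Vl l' g -> ip f g = 0.
Proof.
move=> ll hf [d hd].
rewrite (eq_ip (fun u _ => erefl (f u)) hd) (ip_sumr _ _ (Vl_cpf hf) (M := l')); last first.
  by move=> k; apply: cpf_sph; exact: index_bound.
rewrite big1// => k _; have [c hc] := hf.
rewrite (eq_ip hc (fun u _ => erefl _)) (ip_suml _ _ (cpf_sph _ (index_bound k)) (M := l)).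
  rewrite big1 ?mulr0// => k' _; rewrite /ip sph_orth ?mulr0//; try exact: index_bound.
  by rewrite xpair_eqE (negbTE ll).
by move=> k'; apply: cpf_sph; exact: index_bound.
Qed.

Lemma Vl_definite l f : Vl l f -> ip f f = 0 -> forall u, S2 u -> f u = 0.
Proof.
move=> hf; have [c hc] := hf.
rewrite (eq_ip hc (fun u _ => erefl _)) (ip_suml _ _ (Vl_cpf hf) (M := l)); last first.
  by move=> k'; apply: cpf_sph; exact: index_bound.
have coef (k : 'I_(2 * l).+1) : exists2 N : R, 0 < N & ip (sph_harmonic l (k%:Z - l%:Z) : V -> C) f = c k * rc N.
  have [N N0 hN] := @sph_norm R _ _ (index_bound k).
  exists N => //; rewrite (eq_ip (fun u _ => erefl _) hc).
  rewrite (ip_sumr _ _ (cpf_sph _ (index_bound k)) (M := l)); last first.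
    by move=> k'; apply: cpf_sph; exact: index_bound.
  rewrite (bigD1 k)//= /ip hN big1 ?addr0// => k' kk'.
  rewrite sph_orth ?mulr0//; try exact: index_bound.
  rewrite xpair_eqE eqxx /=; apply: contraNneq kk' => /(congr1 (fun x => x + l%:Z)).
  by rewrite !subrK => -[/val_inj ->].
move/eqP; rewrite psumr_eq0; last first.
  move=> k _; have [N N0 ->] := coef k; rewrite mulrA mulr_ge0//.
    by rewrite mulrC mul_conjC_ge0.
  by rewrite lecR ltW.
move=> /allP h u Su; rewrite hc// big1// => k _.
have := h k (mem_index_enum _); have [N N0 ->] := coef k => /=.
rewrite mulrA mulf_eq0 fmorph_eq0 (gt_eqF N0) orbF mulrC mul_conjC_eq0.
by move=> /eqP ->; rewrite mul0r.
Qed.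

(** Sums of spherical harmonics of degree at most L. *)
Definition Ysp (L : nat) (f : V -> C) := exists h : nat -> V -> C,
  (forall l, Vl l (h l)) /\ forall u, S2 u -> f u = \sum_(l < L.+1) h l u.

Lemma Ysp_ext L f g : (forall u, S2 u -> f u = g u) -> Ysp L g -> Ysp L f.
Proof. by move=> fg [h [hV hh]]; exists h; split=> // u Su; rewrite fg// hh. Qed.

Lemma Ysp_le L M f : (L <= M)%N -> Ysp L f -> Ysp M f.
Proof.
move=> LM [h [hV hh]]; exists (fun l => if (l <= L)%N then h l else fun=> 0).
split=> [l|u Su]; first by case: ifP => _ //; exact: Vl0.
rewrite hh// (big_ord_widen M.+1 (fun l => h l u)) ?ltnS//.
rewrite big_mkcond; apply: eq_bigr => i _.
by rewrite ltnS; case: ifP.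
Qed.

Lemma YspD L f g : Ysp L f -> Ysp L g -> Ysp L (fun u => f u + g u).
Proof.
move=> [h [hV hh]] [k [kV hk]]; exists (fun l u => h l u + k l u).
split=> [l|u Su]; first exact: VlD.
by rewrite hh// hk// -big_split.
Qed.

Lemma YspZ L c f : Ysp L f -> Ysp L (fun u => c * f u).
Proof.
move=> [h [hV hh]]; exists (fun l u => c * h l u).
split=> [l|u Su]; first exact: VlZ.
by rewrite hh// mulr_sumr.
Qed.

Lemma Ysp_Vl l f : Vl l f -> Ysp l f.
Proof.
move=> hf; exists (fun k => if k == l then f else fun=> 0).
split=> [k|u Su]; first by case: eqP => [->|_] //; exact: Vl0.
rewrite (bigD1 (ord_max : 'I_l.+1))//= eqxx big1 ?addr0// => i.
by rewrite -val_eqE /= => /negbTE ->.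
Qed.

Lemma Ysp0 L : Ysp L (fun=> 0).
Proof. by apply: Ysp_le (leq0n L) _; apply: Ysp_Vl; exact: Vl0. Qed.

(** A multiple of the harmonic of degree m + k and order m removes the leading
    term of q. *)
Lemma Ysp_wz b m k (q : {poly R}) : (size q <= k.+1)%N -> Ysp (m + k) (wz b m q : V -> C).
Proof.
elim/ltn_ind: k q => k IH q sq.
have Yr (r : {poly R}) : (size r <= k)%N -> Ysp (m + k) (wz b m r : V -> C).
  case: k {sq} IH => [|k] IH sr.
    apply: Ysp_ext (Ysp0 _) => u _; move: sr; rewrite leqn0 size_poly_eq0 => /eqP r0.
    by rewrite /wz /zfun r0 horner0 rmorph0 mulr0.
  by apply: (@Ysp_le (m + k)); [lia|apply: IH].
set P := legd R (m + k) m.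
have sP : size P = k.+1 by rewrite size_legd; lia.
have lP : P`_k != 0.
  have := lead_coef_eq0 P; rewrite lead_coefE sP /= => ->.
  by rewrite -size_poly_eq0 sP.
pose r := q - (q`_k / P`_k) *: P.
have sr : (size r <= k)%N.
  apply/leq_sizeP => j; rewrite leq_eqVlt => /orP[/eqP <-|kj].
    by rewrite coefB coefZ mulfVK// subrr.
  have qj : q`_j = 0 by apply: nth_default; apply: leq_trans sq kj.
  have Pj : P`_j = 0 by apply: nth_default; rewrite sP.
  by rewrite coefB coefZ qj Pj mulr0 subrr.
have {}Yr := Yr _ sr.
have YP : Ysp (m + k) (wz b m P : V -> C).
  pose mm := if b then - m%:Z else m%:Z.
  have mml : (`|mm| <= m + k)%N by rewrite /mm; case: (b); lia.
  have amm : `|mm|%N = m by rewrite /mm; case: (b); lia.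
  have [c c0 hc] := @sphE R _ _ mml.
  apply: Ysp_ext (YspZ c^-1 (Ysp_Vl (Vl_sph mml))) => u Su.
  rewrite hc amm mulrA mulVf// mul1r.
  rewrite /wz -/P; congr (_ * _).
  have [m0|m0] := posnP m; first by rewrite m0 !expr0.
  by congr (wp _ _ ^+ _); rewrite /mm; case: (b) => //; case: (m) m0.
apply: Ysp_ext (YspD Yr (YspZ (rc (q`_k / P`_k)) YP)) => u _.
rewrite /wz /zfun /r hornerD hornerN hornerZ rmorphB [rc (_ * _)]rmorphM /=.
by rewrite mulrBr; ring.
Qed.

Lemma dot_wz v u : rc (dot v u) = Complex (v 0 0 / 2) (- (v 1 0 / 2)) * wp false u +
  Complex (v 0 0 / 2) (v 1 0 / 2) * wp true u + rc (v 2 0) * rc (u 2 0).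
Proof.
rewrite /dot sum3; apply: complex_eq; rewrite !(cReD, cImD, cReM, cImM) /= ?expr0 ?expr1;
  by field.
Qed.

(** Each linear form is a combination of x + i y, x - i y and z; once none is
    left, (x + i y) (x - i y) = 1 - z^2 leaves a function treated by Ysp_wz. *)
Lemma Ysp_mprod s a b k : Ysp (a + b + k + size s) (fun u : V =>
  wp false u ^+ a * wp true u ^+ b * rc (u 2 0) ^+ k * rc (mprod s u)).
Proof.
elim: s a b k => [|v s IH] a b k.
  rewrite /= addn0.
  have base c m n (q : {poly R}) : (size q <= k.+1)%N -> Ysp (m + 2 * n + k) (fun u : V =>
     wp c u ^+ (m + n) * wp (~~ c) u ^+ n * zfun q u).
    move=> sq; have : (size ((1 - 'X^2) ^+ n * q)%R <= (2 * n + k).+1)%N.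
      apply: leq_trans (size_polyMleq _ _) _.
      have := size_poly_exp_leq (1 - 'X^2 : {poly R}) n.
      have -> : size (1 - 'X^2 : {poly R}) = 3%N.
        by rewrite addrC size_polyDl size_polyN ?size_polyXn ?size_poly1.
      move=> hs; apply: (@leq_trans ((2 * n).+1 + k.+1).-1); last by lia.
      by rewrite -!subn1 leq_sub2r// leq_add.
    move=> /(@Ysp_wz c m); rewrite addnA; apply: Ysp_ext => u Su.
    rewrite /wz /zfun hornerM rmorphM/= horner_exp onemX2E rmorphXn /=.
    move: (rc q.[_]) => Z; rewrite -(wp_norm c Su) exprMn exprD.
    by move: (_ ^+ m) (_ ^+ n) (_ ^+ n) => *; ring.
  have zk (u : V) : rc (u 2 0) ^+ k * rc (mprod [::] u) = zfun 'X^k u.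
    by rewrite /mprod big_nil mulr1 /zfun hornerXn rmorphXn.
  have sX : (size ('X^k : {poly R}) <= k.+1)%N by rewrite size_polyXn.
  have [ab|ba] := leqP a b.
    have := base true (b - a)%N a _ sX; rewrite subnK//.
    have -> : (b - a + 2 * a + k = a + b + k)%N by lia.
    by apply: Ysp_ext => u _; rewrite -mulrA zk [wp false u ^+ a * _]mulrC.
  have := base false (a - b)%N b _ sX; rewrite subnK ?(ltnW ba)//.
  have -> : (a - b + 2 * b + k = a + b + k)%N by lia.
  by apply: Ysp_ext => u _; rewrite -mulrA zk.
have Y1 := YspZ (Complex (v 0 0 / 2) (- (v 1 0 / 2))) (IH a.+1 b k).
have Y2 := YspZ (Complex (v 0 0 / 2) (v 1 0 / 2)) (IH a b.+1 k).
have Y3 := YspZ (rc (v 2 0)) (IH a b k.+1).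
have le1 : (a.+1 + b + k + size s <= a + b + k + size (v :: s))%N by rewrite /=; lia.
have le2 : (a + b.+1 + k + size s <= a + b + k + size (v :: s))%N by rewrite /=; lia.
have le3 : (a + b + k.+1 + size s <= a + b + k + size (v :: s))%N by rewrite /=; lia.
apply: Ysp_ext (YspD (YspD (Ysp_le le1 Y1) (Ysp_le le2 Y2)) (Ysp_le le3 Y3)).
move=> u _; rewrite mprod_cons rmorphM /= dot_wz !exprS.
by move: (Complex _ _) (Complex _ _) (_ ^+ a) (_ ^+ b) (_ ^+ k) (rc (mprod _ _)) => *; ring.
Qed.

Lemma cpf_Ysp L f : cpf L f -> Ysp L f.
Proof.
move=> [P [sP hP]]; apply: Ysp_ext hP _.
elim: P sP => [|p P IH] /=.
  by move=> _; apply: Ysp_ext (Ysp0 L) => u _; rewrite /ceval big_nil.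
move=> /andP[sp /IH YP].
have Yp := YspZ p.1 (Ysp_mprod p.2 0 0 0).
have := YspD (Ysp_le _ Yp) YP; rewrite !add0n => /(_ sp).
by apply: Ysp_ext => u _; rewrite /ceval big_cons !expr0 !mul1r.
Qed.

(** The components of f of different degrees are orthogonal, so each of them
    has norm 0. *)
Lemma Ysp_definite L f : cpf L f -> ip f f = 0 -> forall u, S2 u -> f u = 0.
Proof.
move=> hf; have [h [hV hh]] := cpf_Ysp hf.
have hVL (l : 'I_L.+1) : cpf L (h l).
  by apply: cpf_le (Vl_cpf (hV l)); rewrite -ltnS.
have fE u : S2 u -> f u = \sum_(l < L.+1) 1 * h l u.
  by move=> Su; rewrite hh//; apply: eq_bigr => l _; rewrite mul1r.
rewrite (eq_ip fE (fun u _ => erefl _)) (ip_suml _ _ hf hVL).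
have E (l : 'I_L.+1) : ip (h l) f = ip (h l) (h l).
  rewrite (eq_ip (fun u _ => erefl _) fE) (ip_sumr _ _ (hVL l) hVL).
  rewrite (bigD1 l)//= mul1r big1 ?addr0// => k kl.
  by rewrite mul1r (@Vl_orth l k)// eq_sym.
move/eqP; rewrite psumr_eq0; last first.
  by move=> l _; rewrite conjC1 mul1r E; exact: ip_ge0 (hVL l).
move=> /allP h0 u Su; rewrite hh// big1// => l _.
apply: (Vl_definite (hV l)) => //; apply/eqP.
by have := h0 l (mem_index_enum _); rewrite /= conjC1 mul1r E.
Qed.

(** A rotated harmonic of degree l is a sum of components of degrees k <= l.
    For k < l the squared norm of the component is its product with the
    rotated function; rotating back, it is a product of a polynomial of degree
    at most k with a harmonic of degree l, hence 0. *)
Lemma Vl_rot l f A : orth A -> Vl l f -> Vl l (fun u => f (A *m u)).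
Proof.
move=> oA hf; have cf := Vl_cpf hf; have crf := cpf_rot oA cf.
have [h [hV hh]] := cpf_Ysp crf.
apply: Vl_ext (hV l) => u Su; rewrite hh// (bigD1 (ord_max : 'I_l.+1))//= big1 ?addr0//.
move=> k kl; apply: (Vl_definite (hV k)) => //.
have kl' : (k : nat) != l by [].
have <- : ip (h k) (fun u => f (A *m u)) = ip (h k) (h k).
  have fE v : S2 v -> f (A *m v) = \sum_(l0 < l.+1) 1 * h l0 v.
    by move=> Sv; rewrite hh//; apply: eq_bigr => i _; rewrite mul1r.
  rewrite (eq_ip (fun u _ => erefl _) fE) (ip_sumr _ _ (Vl_cpf (hV k)) (M := l)); last first.
    by move=> i; apply: cpf_le (Vl_cpf (hV i)); rewrite -ltnS.
  rewrite (bigD1 k)//= mul1r big1 ?addr0// => i ik.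
  by rewrite mul1r (@Vl_orth k i)// eq_sym.
have oA' := orth_tr oA.
rewrite -(ip_rot oA' (Vl_cpf (hV k)) crf).
have [g [gV hg]] := cpf_Ysp (cpf_rot oA' (Vl_cpf (hV k))).
have gE v : S2 v -> h k (A^T *m v) = \sum_(i < k.+1) 1 * g i v.
  by move=> Sv; rewrite hg//; apply: eq_bigr => i _; rewrite mul1r.
have fE v : S2 v -> f (A *m (A^T *m v)) = f v.
  by move=> Sv; rewrite mulmxA oA mul1mx.
rewrite (eq_ip gE fE) (ip_suml _ _ cf (M := k)); last first.
  by move=> i; apply: cpf_le (Vl_cpf (gV i)); rewrite -ltnS.
rewrite big1// => i _; rewrite (@Vl_orth i l) ?mulr0//.
by have := ltn_ord i; have := ltn_ord k; rewrite neq_ltn !ltnS; move: kl'; case: ltngtP => //=; lia.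
Qed.

Lemma Vl_conj l f : Vl l f -> Vl l (fun u => Num.conj (f u)).
Proof.
move=> [c hc].
have h (k : 'I_(2 * l).+1) : Vl l (fun u => Num.conj (c k) * Num.conj (sph_harmonic l (k%:Z - l%:Z) (u : V))).
  have [d _ hd] := @sphE R _ _ (index_bound k).
  have b' : (`|- (k%:Z - l%:Z)%R| <= l)%N by rewrite abszN index_bound.
  have [e e0 he] := @sphE R _ _ b'.
  apply: Vl_ext (VlZ (Num.conj (c k) * (Num.conj d * e^-1)) (Vl_sph b')) => u _.
  rewrite hd he abszN cconjM -!mulrA; congr (_ * (_ * _)).
  rewrite mulrA mulVf// mul1r /wz cconjM cconjX conj_wp /zfun cconj_rc.
  move: (k%:Z - l%:Z) => x; case: (eqVneq x 0) => [->|x0]; first by rewrite /= !expr0.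
  congr (wp _ _ ^+ _ * _).
  by case: x x0 => [[|n]|n].
apply: Vl_ext (Vl_sum (index_enum _) h) => u Su.
by rewrite hc// rmorph_sum; apply: eq_bigr => k _; rewrite rmorphM.
Qed.

End HarmonicSpaces.

(** * Density of polynomials in L2 of the sphere *)

Section Density.
Variable R : realType.
Local Notation V := 'cV[R]_3.
Local Notation sigma := (@surface_measure R).

Lemma bernoulli_ineq (a : R) n : -1 <= a -> 1 + n%:R * a <= (1 + a) ^+ n.
Proof.
move=> a1; elim: n => [|n IH]; first by rewrite mul0r addr0 expr0.
have a0 : 0 <= 1 + a by lra.
rewrite exprS; apply: le_trans (ler_wpM2l a0 IH).
rewrite -natr1; have : 0 <= n%:R * (a * a) by rewrite mulr_ge0 // -expr2 sqr_ge0.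
by move: (n%:R : R) => m; nra.
Qed.

Lemma cvg_nexpr (r : R) : 0 <= r < 1 -> (fun n => n%:R * r ^+ n) @ \oo --> 0.
Proof.
move=> /andP[]; rewrite le_eqVlt => /orP[/eqP <- _|r0 r1].
  rewrite (_ : (fun _ => _) = cst 0); first exact: cvg_cst.
  by apply/funext => -[|n]; rewrite ?mul0r// expr0n mulr0.
pose s := Num.sqrt r.
have s0 : 0 < s by rewrite sqrtr_gt0.
have s1 : s < 1 by rewrite -sqrtr1 ltr_sqrt.
pose c := s^-1 - 1.
have c0 : 0 < c by rewrite subr_gt0 invf_gt1.
have bound n : n%:R * r ^+ n <= c^-1 * s ^+ n.
  have : n%:R * c <= (s^-1) ^+ n.
    have := @bernoulli_ineq c n; rewrite [1 + c]addrC subrK => h.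
    by apply: le_trans (h _); lra.
  rewrite exprVn -ler_pdivlMr// => h.
  have -> : r ^+ n = s ^+ n * s ^+ n.
    by rewrite -exprMn -expr2 sqr_sqrtr// ltW.
  rewrite mulrA; apply: ler_wpM2r; first by rewrite exprn_ge0// ltW.
  by rewrite -ler_pdivlMr ?exprn_gt0// mulrC.
apply: (@squeeze_cvgr _ _ _ _ (cst 0) (fun n => c^-1 * s ^+ n)).
- by near=> n; rewrite bound andbT mulr_ge0// exprn_ge0// ltW.
- exact: cvg_cst.
- rewrite -[X in _ --> X](mulr0 c^-1); apply: cvgMr; apply: cvg_expr.
  by rewrite ger0_norm// ltW.
Unshelve. all: by end_near. Qed.

(** Polynomials in t tending to the indicator of t < 1/2 on [0, 1]. *)
Definition cutoff n (t : R) : R := (1 - t ^+ n) ^+ (n * 2 ^ n).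

Lemma cutoff_itv n t : 0 <= t <= 1 -> 0 <= cutoff n t <= 1.
Proof.
move=> /andP[t0 t1].
have h0 : 0 <= t ^+ n by rewrite exprn_ge0.
have h1 : t ^+ n <= 1 by rewrite exprn_ile1.
by rewrite exprn_ge0 ?subr_ge0// exprn_ile1// ?subr_ge0// gerBl.
Qed.

(** By Bernoulli's inequality the value is at least 1 - n (2 t)^n, and for
    t >= 1/2 at most 1 / (n + 1). *)
Lemma cvg_cutoff t : 0 <= t <= 1 -> cutoff ^~ t @ \oo --> (((t < 1 / 2)%R)%:R : R).
Proof.
move=> /andP[t0 t1]; case: ltP => t2.
  apply: (@squeeze_cvgr _ _ _ _ (fun n => 1 - n%:R * (2 * t) ^+ n) (cst 1)).
  - near=> n; have /andP[_ ->] := @cutoff_itv n t (introT andP (conj t0 t1)).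
    rewrite andbT.
    have := @bernoulli_ineq (- t ^+ n) (n * 2 ^ n).
    rewrite lerN2 exprn_ile1// => /(_ isT); apply: le_trans.
    by rewrite natrM natrX mulrN exprMn mulrA.
  - rewrite -[X in _ --> X]subr0; apply: cvgB; first exact: cvg_cst.
    by apply: cvg_nexpr; apply/andP; split; lra.
  - exact: cvg_cst.
apply: (@squeeze_cvgr _ _ _ _ (cst 0) (@harmonic R)).
- near=> n; have /andP[-> _] /= := @cutoff_itv n t (introT andP (conj t0 t1)).
  pose x : R := 2^-1 ^+ n; pose N := (n * 2 ^ n)%N.
  have x0 : 0 <= x by rewrite exprn_ge0// invr_ge0.
  have x1 : x <= 1 by rewrite exprn_ile1// ?invr_ge0// invf_le1// ler1n.
  have xt : x <= t ^+ n by rewrite lerXn2r// ?nnegrE ?invr_ge0// -[2^-1]mul1r.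
  have hx : (1 - x) ^+ N * (1 + x) ^+ N <= 1.
    rewrite -exprMn exprn_ile1//; nra.
  have hN : n.+1%:R <= (1 + x) ^+ N.
    have := @bernoulli_ineq x N; rewrite (le_trans _ x0)// => /(_ isT).
    apply: le_trans; rewrite /N natrM natrX -mulrA /x -exprMn divff// expr1n mulr1.
    by rewrite -natr1 addrC.
  have n0 : 0 < n.+1%:R :> R by rewrite ltr0n.
  have hc : cutoff n t <= (1 - x) ^+ N.
    have tn1 : t ^+ n <= 1 by rewrite exprn_ile1.
    by rewrite /cutoff lerXn2r// ?nnegrE ?subr_ge0// lerD2l lerN2.
  apply: le_trans hc _; rewrite /harmonic /= -[leRHS]mul1r ler_pdivlMr//.
  apply: le_trans hx; apply: ler_wpM2l => //.
  by rewrite exprn_ge0// subr_ge0.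
- exact: cvg_cst.
- exact: cvg_harmonic.
Unshelve. all: by end_near. Qed.

Definition sqdist (f g : V -> R) : \bar R :=
  (\int[sigma]_(u in @S2 R) ((f u - g u) ^+ 2)%:E)%E.

Definition smeas (f : V -> R) := measurable_fun (@S2 R) (f : borel3 R -> R).

(** Limits in L2 of the sphere of real polynomial functions. *)
Definition approx (f : V -> R) := smeas f /\
  forall e : R, 0 < e -> exists P, (sqdist f (reval P) < e%:E)%E.

Lemma smeas_reval P : smeas (reval P).
Proof. by apply: measurable_funTS; exact: reval_measurable. Qed.

Lemma smeas_sq f g : smeas f -> smeas g ->
  measurable_fun (@S2 R) (fun u : borel3 R => ((f u - g u) ^+ 2)%:E : \bar R).
Proof.
move=> mf mg; apply/measurable_EFinP.
by apply: measurable_funX; exact: measurable_funB.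
Qed.

Lemma sqdist_ge0 f g : (0 <= sqdist f g)%E.
Proof. by apply: integral_ge0 => u _; rewrite lee_fin sqr_ge0. Qed.

(** From (a - c)^2 <= 2 ((a - b)^2 + (b - c)^2). *)
Lemma sqdist_triangle f g h : smeas f -> smeas g -> smeas h ->
  (sqdist f h <= 2%:E * (sqdist f g + sqdist g h))%E.
Proof.
move=> mf mg mh; have mS := @measurable_S2 R.
rewrite /sqdist -ge0_integralD//; try exact: smeas_sq;
  try by move=> u _; rewrite lee_fin sqr_ge0.
rewrite -ge0_integralZl_EFin//; last first.
- by apply: emeasurable_funD; exact: smeas_sq.
- by move=> u _; rewrite adde_ge0// lee_fin sqr_ge0.
apply: ge0_le_integral => //.
- by move=> u _; rewrite lee_fin sqr_ge0.
- exact: smeas_sq.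
- by apply: measurable_funeM; apply: emeasurable_funD; exact: smeas_sq.
- move=> u _; rewrite -EFinD -EFinM lee_fin.
  by move: (f u) (g u) (h u) => a b c; have := sqr_ge0 (a - 2 * b + c); nra.
Qed.

Lemma approx_closed f : smeas f ->
  (forall e : R, 0 < e -> exists2 g, approx g & (sqdist f g < e%:E)%E) -> approx f.
Proof.
move=> mf h; split=> // e e0.
have e4 : 0 < e / 4 by lra.
have [g [mg ag] fg] := h _ e4; have [P gP] := ag _ e4.
exists P; apply: le_lt_trans (sqdist_triangle mf mg (smeas_reval P)) _.
apply: (@lt_le_trans _ _ (2%:E * ((e / 4)%:E + (e / 4)%:E))%E).
  by rewrite lte_pmul2l// lteD.
by rewrite -EFinD -EFinM lee_fin; lra.
Qed.

Lemma approx_bounded_lim (f : V -> R) (f_ : nat -> V -> R) (M : R) :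
  (forall n, approx (f_ n)) -> (forall n u, S2 u -> `|f_ n u| <= M) ->
  (forall u, S2 u -> f_ ^~ u @ \oo --> f u) -> approx f.
Proof.
move=> af bf cf.
have mf : smeas f.
  apply: (@measurable_fun_cvg _ (borel3 R) R (@S2 R) (fun n => f_ n)) => // n.
  by case: (af n).
apply: approx_closed => // e e0.
have bM u : S2 u -> `|f u| <= M.
  move=> Su; have cn : `|f_ n u| @[n --> \oo] --> `|f u| by apply: cvg_norm; exact: cf.
  by rewrite -(cvg_lim _ cn)//; apply: limr_le; [exact: cvgP cn|near=> n; exact: bf].
have M0 : (@S2 R = set0) \/ 0 <= M.
  case: (pselect (exists u : V, S2 u)) => [[u Su]|nS]; first by right; exact: le_trans (bM u Su).
  by left; apply/seteqP; split => // u Su; case: nS; exists u.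
have lim0 : (fun n => sqdist f (f_ n)) @ \oo --> 0%E.
  rewrite -(@integral0 _ _ _ sigma (@S2 R)).
  apply: (@dominated_cvg _ _ _ sigma (@S2 R) (@measurable_S2 R)
    (fun n u => ((f u - f_ n u) ^+ 2)%:E) (cst 0%E) (cst ((2 * M) ^+ 2)%:E)).
  - by move=> n; apply: smeas_sq => //; case: (af n).
  - move=> u Su; apply: cvg_EFin; first exact: nearW.
    have -> : fine \o (fun n => ((f u - f_ n u) ^+ 2)%:E) = (fun n => (f u - f_ n u) ^+ 2) by [].
    have h0 : f u - f_ n u @[n --> \oo] --> 0.
      by rewrite -[X in _ --> X](subrr (f u)); apply: cvgB; [exact: cvg_cst|exact: cf].
    have -> : (fun n => (f u - f_ n u) ^+ 2) =
        (fun n => f u - f_ n u) \* (fun n => f u - f_ n u).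
      by apply/funext => n; rewrite expr2.
    by rewrite -(mulr0 0); apply: cvgM.
  - by [].
  - apply: (@surface_integrable R (cst ((2 * M) ^+ 2)) ((2 * M) ^+ 2)).
      exact: measurable_cst.
    by move=> u _; rewrite ger0_norm// sqr_ge0.
  - move=> n u Su; rewrite gee0_abs ?lee_fin ?sqr_ge0//.
    rewrite -real_normK ?num_real// lerXn2r// ?nnegrE//.
      by rewrite mulr_ge0//; case: M0 => // S0; move: Su; rewrite S0.
    by apply: le_trans (ler_normB _ _) _; rewrite mulr_natl mulr2n lerD// ?bM// bf.
have [n _ hn] : \forall n \near \oo, (sqdist f (f_ n) < e%:E)%E.
  apply: (lim0 [set x | (x < e%:E)%E]); apply: open_nbhs_nbhs; split; first exact: open_ereal_lt_ereal.
  by rewrite /= lte_fin.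
by exists (f_ n); [exact: af|apply: hn => /=].
Unshelve. all: by end_near. Qed.

Lemma approx_polyfun (f g : V -> R) : polyfun g -> (forall u, S2 u -> f u = g u) -> approx f.
Proof.
move=> [P hP] fg; split.
  apply: (eq_measurable_fun (reval P : borel3 R -> R)); last exact: smeas_reval.
  by move=> u; rewrite inE => Su; rewrite fg// hP.
move=> e e0; exists P; rewrite /sqdist (eq_integral (cst 0%E)) ?integral0 ?lte_fin//.
by move=> u; rewrite inE => Su; rewrite fg// hP// subrr expr0n.
Qed.

Lemma approxD f g : approx f -> approx g -> approx (fun u => f u + g u).
Proof.
move=> [mf af] [mg ag].
have mfg : smeas (fun u => f u + g u) by exact: measurable_funD.
split=> // e e0; have e4 : 0 < e / 4 by lra.
have [P hP] := af _ e4; have [Q hQ] := ag _ e4.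
exists (P ++ Q).
have mS := @measurable_S2 R.
apply: (@le_lt_trans _ _ (2%:E * (sqdist f (reval P) + sqdist g (reval Q)))%E).
  rewrite /sqdist -ge0_integralD//; try (by apply: smeas_sq => //; exact: smeas_reval);
    try by move=> u _; rewrite lee_fin sqr_ge0.
  have mPQ : measurable_fun (@S2 R) (fun x : borel3 R =>
    (((f x - reval P x) ^+ 2)%:E + ((g x - reval Q x) ^+ 2)%:E)%E).
    by apply: emeasurable_funD; apply: smeas_sq => //; exact: smeas_reval.
  rewrite -ge0_integralZl_EFin//; last first.
  - by move=> u _; rewrite adde_ge0// lee_fin sqr_ge0.
  apply: ge0_le_integral => //.
  - by move=> u _; rewrite lee_fin sqr_ge0.
  - by apply: smeas_sq => //; exact: smeas_reval.
  - exact: measurable_funeM.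
  - move=> u _; rewrite -EFinD -EFinM lee_fin reval_cat.
    move: (f u) (g u) (reval P u) (reval Q u) => a b c d.
    by have := sqr_ge0 (a - b - c + d); nra.
apply: (@lt_le_trans _ _ (2%:E * ((e / 4)%:E + (e / 4)%:E))%E).
  by rewrite lte_pmul2l// lteD.
by rewrite -EFinD -EFinM lee_fin; lra.
Qed.

Lemma approxZ c f : approx f -> approx (fun u => c * f u).
Proof.
move=> [mf af].
have mcf : smeas (fun u => c * f u) by apply: measurable_funM => //; exact: measurable_cst.
split=> // e e0; have c0 : 0 < c ^+ 2 + 1 by rewrite ltr_pwDr// sqr_ge0.
have ec : 0 < e / (c ^+ 2 + 1) by rewrite divr_gt0.
have [P hP] := af _ ec; exists (rscale c P).
have -> : sqdist (fun u => c * f u) (reval (rscale c P)) =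
    ((c ^+ 2)%:E * sqdist f (reval P))%E.
  rewrite /sqdist -ge0_integralZl_EFin ?sqr_ge0//.
  - by apply: eq_integral => u _; rewrite reval_scale -mulrBr exprMn EFinM.
  - exact: measurable_S2.
  - by move=> u _; rewrite lee_fin sqr_ge0.
  - by apply: smeas_sq => //; exact: smeas_reval.
apply: (@le_lt_trans _ _ ((c ^+ 2 + 1)%:E * sqdist f (reval P))%E).
  by rewrite lee_wpmul2r ?sqdist_ge0// lee_fin lerDl.
by rewrite muleC -lte_pdivlMr.
Qed.

Lemma polyfunM (f g : V -> R) : polyfun f -> polyfun g -> polyfun (fun u => f u * g u).
Proof.
move=> [P hP] [Q hQ].
exists [seq (p.1 * q.1, p.2 ++ q.2) | p <- P, q <- Q] => u Su.
rewrite /reval big_allpairs_dep /= hP// hQ// /reval mulr_suml.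
apply: eq_bigr => p _; rewrite mulr_sumr; apply: eq_bigr => q _ /=.
by rewrite mprod_cat; ring.
Qed.

Lemma polyfun_cst (c : R) : polyfun (fun _ : V => c).
Proof. by exists [:: (c, [::])] => u _; rewrite /reval big_seq1 /mprod big_nil mulr1. Qed.

Lemma polyfunX (f : V -> R) n : polyfun f -> polyfun (fun u => f u ^+ n).
Proof.
move=> hf; elim: n => [|n IH]; first exact: polyfun_cst.
have := polyfunM hf IH; congr polyfun.
by apply/funext => u; rewrite exprS.
Qed.

Lemma polyfun_coord i : polyfun (fun u : V => u i 0).
Proof.
by exists [:: (1, [:: ev R i])] => u _; rewrite /reval big_seq1 mul1r /mprod big_seq1 dot_ev.
Qed.

Lemma polyfun_prod I (s : seq I) (F : I -> V -> R) :
  (forall i, polyfun (F i)) -> polyfun (fun u => \prod_(i <- s) F i u).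
Proof.
move=> h; elim: s => [|i s IH].
  have := polyfun_cst 1; congr polyfun.
  by apply/funext => u; rewrite big_nil.
have := polyfunM (h i) IH; congr polyfun.
by apply/funext => u; rewrite big_cons.
Qed.

(** An affine function with value 1/2 at u_i = b and values in [0, 1] on the
    sphere; the sign e selects a side of the plane u_i = b. *)
Definition tilt (e b : R) (i : 'I_3) (u : V) : R :=
  1 / 2 + e * (u i 0 - b) / (2 * (1 + `|b|)).

Lemma tilt_itv e b i u : `|e| = 1 -> S2 u -> 0 <= tilt e b i u <= 1.
Proof.
move=> e1 Su; have b0 : 0 < 2 * (1 + `|b|) by rewrite mulr_gt0// ltr_pwDl.
have : `|e * (u i 0 - b)| <= 1 + `|b|.
  rewrite normrM e1 mul1r; apply: le_trans (ler_normB _ _) _.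
  by rewrite lerD2r S2_coord.
rewrite ler_norml => /andP[h1 h2]; apply/andP; split.
  have : - (1 / 2) <= e * (u i 0 - b) / (2 * (1 + `|b|)); last by rewrite /tilt; lra.
  by rewrite ler_pdivlMr//; lra.
have : e * (u i 0 - b) / (2 * (1 + `|b|)) <= 1 / 2; last by rewrite /tilt; lra.
by rewrite ler_pdivrMr//; lra.
Qed.

Lemma tilt_lt e b i u : (tilt e b i u < 1 / 2) = (e * (u i 0 - b) < 0).
Proof.
have b0 : 0 < 2 * (1 + `|b|) by rewrite mulr_gt0// ltr_pwDl.
by rewrite /tilt gtrDl pmulr_llt0 ?invr_gt0.
Qed.

Lemma polyfun_cutoff e b i n : polyfun (fun u => cutoff n (tilt e b i u)).
Proof.
have ht : polyfun (tilt e b i).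
  have := polyfunD (polyfun_cst (1 / 2 - e * b / (2 * (1 + `|b|))))
    (polyfunZ (e / (2 * (1 + `|b|))) (polyfun_coord i)).
  by congr polyfun; apply/funext => u; rewrite /tilt; ring.
apply: polyfunX; have := polyfunD (polyfun_cst 1) (polyfunZ (-1) (polyfunX n ht)).
by congr polyfun; apply/funext => u; rewrite mulN1r.
Qed.

Definition box (a b : V) : set (borel3 R) := [set u | forall i, a i 0 < (u : V) i 0 < b i 0].

Definition boxes : set (set (borel3 R)) := [set A | exists a b, A = box a b].

Lemma cvg_prod I (s : seq I) (F : I -> nat -> R) (l : I -> R) :
  (forall i, F i @ \oo --> l i) ->
  (fun n => \prod_(i <- s) F i n) @ \oo --> \prod_(i <- s) l i.
Proof.
move=> h; elim: s => [|i s IH].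
  rewrite big_nil (_ : (fun _ => _) = cst 1); first exact: cvg_cst.
  by apply/funext => n; rewrite big_nil.
rewrite big_cons (_ : (fun _ => _) = (F i \* (fun n => \prod_(j <- s) F j n))).
  by apply: cvgM; [exact: h|exact: IH].
by apply/funext => n; rewrite big_cons.
Qed.

(** A box is cut out by six half-spaces, whose indicators are pointwise limits
    of cutoff composed with affine functions. *)
Lemma approx_box a b : approx (\1_(box a b) : V -> R).
Proof.
pose f n (u : V) := \prod_i (cutoff n (tilt 1 (b i 0) i u) * cutoff n (tilt (-1) (a i 0) i u)).
have b01 n u i e c : `|e| = 1 -> S2 u -> 0 <= cutoff n (tilt e c i u) <= 1.
  by move=> e1 Su; apply: cutoff_itv; exact: tilt_itv.
apply: (@approx_bounded_lim _ f 1).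
- move=> n; apply: (@approx_polyfun _ (f n)) => //.
  by apply: polyfun_prod => i; apply: polyfunM; exact: polyfun_cutoff.
- move=> n u Su; rewrite /f normr_prod.
  apply: prodr_ile1 => i _; rewrite normr_ge0 /= normrM.
  have /andP[p0 p1] := b01 n u i 1 (b i 0) (normr1 _) Su.
  have /andP[q0 q1] := b01 n u i (-1) (a i 0) (normrN1 _) Su.
  by rewrite !ger0_norm// mulr_ile1.
- move=> u Su.
  have -> : \1_(box a b) u =
      \prod_i (((tilt 1 (b i 0) i u < 1 / 2)%R)%:R * ((tilt (-1) (a i 0) i u < 1 / 2)%R)%:R) :> R.
    rewrite indicE; case: (boolP (u \in box a b)) => [|].
      rewrite inE => ub; rewrite big1// => i _; rewrite !tilt_lt.
      have /andP[h1 h2] := ub i.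
      have -> : 1 * (u i 0 - b i 0) < 0 by lra.
      have -> : -1 * (u i 0 - a i 0) < 0 by lra.
      by rewrite mulr1.
    rewrite notin_setE => ub; apply/esym/eqP; apply/prodf_eq0.
    have /existsNP[i hi] : ~ (forall i, a i 0 < u i 0 < b i 0) by [].
    exists i => //; rewrite !tilt_lt mulf_eq0 !pnatr_eq0 !eqb0.
    move/negP: hi; rewrite negb_and -!leNgt => /orP[h|h].
      by apply/orP; right; lra.
    by apply/orP; left; lra.
  apply: cvg_prod => i.
  apply: (@cvgM _ _ _ _ (fun n => cutoff n (tilt 1 (b i 0) i u))
     (fun n => cutoff n (tilt (-1) (a i 0) i u))).
    by apply: cvg_cutoff; apply: tilt_itv => //; exact: normr1.
  by apply: cvg_cutoff; apply: tilt_itv => //; exact: normrN1.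
Qed.

(** Balls for the sup norm with rational centres are boxes, and countably many
    of them cover an open set. *)
Lemma measurable_boxes : @measurable _ (borel3 R) = <<s boxes>>.
Proof.
apply/seteqP; split.
  apply: smallest_sub; first exact: smallest_sigma_algebra.
  move=> U oU.
  pose q2v (q : 'cV[rat]_3) : V := map_mx ratr q.
  have -> : U = \bigcup_(p in [set p : 'cV[rat]_3 * nat |
      ball (q2v p.1) p.2.+1%:R^-1 `<=` U]) ball (q2v p.1) p.2.+1%:R^-1.
    apply/seteqP; split => [a Ua|a [p /= pU /pU //]].
    have /nbhs_ballP[e /= e0 eU] : nbhs (a : V) U by exact: open_nbhs_nbhs.
    have [n ne] : exists n : nat, (n.+1%:R^-1 : R) < e / 2.
      have e20 : 0 < (e / 2)^-1 by rewrite invr_gt0 divr_gt0.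
      exists (Num.truncn (e / 2)^-1).
      by rewrite invf_plt ?posrE ?divr_gt0// truncnS_gt.
    have n0 : 0 < n.+1%:R^-1 :> R by rewrite invr_gt0.
    have /choice[q qP] (i : 'I_3) :
        exists q : rat, `|(a : V) i 0 - ratr q| < n.+1%:R^-1.
      have : (a : V) i 0 - n.+1%:R^-1 < (a : V) i 0 + n.+1%:R^-1.
        by rewrite ltrBlDr -addrA ltrDl addr_gt0.
      move=> /rat_in_itvoo[q]; rewrite in_itv/= => /andP[q1 q2].
      by exists q; rewrite distrC ltr_distl q1.
    have aq : ball (q2v (\col_i q i)) n.+1%:R^-1 (a : V).
      split=> // i j; rewrite ord1 /ball /= distrC.
      by have := qP i; rewrite !mxE.
    exists (\col_i q i, n) => //= v vq; apply: eU.
    apply: (@le_ball _ _ _ (n.+1%:R^-1 + n.+1%:R^-1)).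
      by rewrite [leRHS]splitr lerD// ltW.
    by apply: ball_triangle vq; exact: ball_sym.
  rewrite bigcup_mkcond.
  have sig := @smallest_sigma_algebra (borel3 R) setT boxes.
  have h (q : 'cV[rat]_3 * nat) : <<s boxes>>
     (if q \in [set p : 'cV[rat]_3 * nat | ball (q2v p.1) p.2.+1%:R^-1 `<=` U]
       then ball (q2v q.1) q.2.+1%:R^-1 else set0 : set (borel3 R)).
    case: ifP => _; last by case: sig.
    apply: sub_sigma_algebra.
    exists (\col_i (q2v q.1 i 0 - q.2.+1%:R^-1)), (\col_i (q2v q.1 i 0 + q.2.+1%:R^-1)).
    apply/seteqP; split => u /=.
      by move=> [_ bu] i; rewrite !mxE -ltr_distl distrC; have := bu i 0; rewrite /ball /= !mxE.
    move=> bu; split; first by rewrite invr_gt0.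
    by move=> i j; rewrite ord1 /ball /= distrC ltr_distl; have := bu i; rewrite !mxE.
  apply: (@countable_bigcupT_measurable _ (g_sigma_algebraType boxes)) => //.
apply: smallest_sub; first exact: smallest_sigma_algebra.
move=> _ [a [b ->]].
rewrite (_ : box a b = \bigcap_(i in [set: 'I_3])
    (fun u : borel3 R => (u : V) i 0) @^-1` `]a i 0, b i 0[).
  apply: fin_bigcap_measurable => // i _; rewrite -[X in measurable X]setTI.
  exact: measurable_coord.
apply/seteqP; split => u /= h i; last by have := h i I; rewrite ?in_itv.
by move=> _; have := h i; rewrite /= ?in_itv.
Qed.

(** Boxes are stable under intersection, and the sets with approximable
    indicator form a Dynkin system. *)
Lemma approx_indic (A : set (borel3 R)) : measurable A -> approx (\1_A : V -> R).
Proof.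
move=> mA.
have sA : <<s boxes>> A by rewrite -measurable_boxes.
apply: (@dynkin_induction _ (borel3 R) boxes (fun A => approx (\1_A : V -> R))) sA.
- exact: measurable_boxes.
- move=> _ _ [a [b ->]] [c [d ->]].
  exists (\col_i Num.max (a i 0) (c i 0)), (\col_i Num.min (b i 0) (d i 0)).
  apply/seteqP; split => u /=.
    move=> [h1 h2] i; have /andP[x1 x2] := h1 i; have /andP[y1 y2] := h2 i.
    by rewrite !mxE gt_max lt_min x1 x2 y1 y2.
  by move=> h; split => i; have := h i; rewrite !mxE gt_max lt_min => /andP[/andP[h1 h2] /andP[h3 h4]]; apply/andP; split.
- apply: (@approx_polyfun _ (fun=> 1)); first exact: polyfun_cst.
  by move=> u _; rewrite indicT.
- by move=> _ [a [b ->]]; exact: approx_box.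
- move=> B mB aB.
  have := approxD (approx_polyfun (polyfun_cst 1) (fun u _ => erefl _)) (approxZ (-1) aB).
  congr approx; apply/funext => u; rewrite !indicE in_setC mulN1r.
  by case: (u \in B); rewrite ?subrr ?subr0.
- move=> F mF tF aF.
  pose S n (u : V) : R := \sum_(k < n) \1_(F k) u.
  have SE n u : S n u = ([exists k : 'I_n, u \in F k])%:R.
    rewrite /S; case: existsP => [[k uk]|nk].
      rewrite (bigD1 k)//= indicE uk big1 ?addr0// => j jk.
      rewrite indicE memNset// => uj; move: jk; apply/negP; rewrite negbK.
      apply/eqP/val_inj/(tF j k I I); exists u; split => //.
      by move: uk; rewrite inE.
    rewrite big1// => k _; rewrite indicE memNset// => uk.
    by case: nk; exists k; rewrite inE.
  apply: (@approx_bounded_lim _ S 1).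
  + elim => [|n IH].
      apply: (@approx_polyfun _ (fun=> 0)); first exact: polyfun_cst.
      by move=> u _; rewrite /S big_ord0.
    have := approxD IH (aF n); congr approx; apply/funext => u.
    by rewrite /S big_ord_recr.
  + by move=> n u _; rewrite SE; case: [exists _, _]; rewrite ?normr1 ?normr0.
  + move=> u _; case: (pselect ((\bigcup_k F k) u)) => [|nu].
      move=> [k _ uk]; rewrite indicE mem_set; last by exists k.
      apply: cvg_near_cst; exists k.+1 => //= n kn; rewrite SE.
      have -> // : [exists k : 'I_n, u \in F k].
      by apply/existsP; exists (Ordinal kn); rewrite inE.
    rewrite indicE memNset//; apply: cvg_near_cst; near=> n; rewrite SE.
    have -> // : [exists k : 'I_n, u \in F k] = false.
    by apply/existsP => -[k]; rewrite inE => uk; apply: nu; exists k.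
Unshelve. all: by end_near. Qed.

Import HBNNSimple.

Lemma approx_nnsfun (h : {nnsfun borel3 R >-> R}) : approx (h : V -> R).
Proof.
have -> : (h : V -> R) = (fun u => \sum_(y <- finmap.enum_fset (fset_set (range h))) y * \1_(h @^-1` [set y]) u).
  apply/funext => u; rewrite [LHS](fimfunE h u) fsbig_finite//.
elim: (finmap.enum_fset _) => [|y s IH].
  apply: (@approx_polyfun _ (fun=> 0)); first exact: polyfun_cst.
  by move=> u _; rewrite big_nil.
have my : measurable (h @^-1` [set y]) by exact: measurable_sfunP.
have := approxD (approxZ y (approx_indic my)) IH; congr approx.
by apply/funext => u; rewrite big_cons.
Qed.

(** Simple functions increase to f, with f^2 as dominating function. *)
Lemma approx_ge0 (f : V -> R) : smeas f -> (forall u, 0 <= f u) ->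
  (\int[sigma]_(u in @S2 R) ((f u) ^+ 2)%:E < +oo)%E -> approx f.
Proof.
move=> mf f0 fi.
have mfE : measurable_fun (@S2 R) (EFin \o (f : borel3 R -> R)) by apply/measurable_EFinP.
pose h n := nnsfun_approx (@measurable_S2 R) mfE n.
have cvh u : S2 u -> (fun n => h n u) @ \oo --> f u.
  move=> Su.
  have f0' (x : borel3 R) : S2 x -> (0 <= (EFin \o (f : borel3 R -> R)) x)%E by move=> _; rewrite lee_fin.
  exact: (fine_cvg (@cvg_nnsfun_approx _ _ _ _ (@measurable_S2 R) _ mfE f0' u Su)).
have hle n u : S2 u -> h n u <= f u.
  move=> Su; rewrite -lee_fin /h nnsfun_approxE.
  by apply: le_approx => // x _; rewrite lee_fin.
apply: approx_closed => // e e0.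
have lim0 : (fun n => sqdist f (h n)) @ \oo --> 0%E.
  rewrite -(@integral0 _ _ _ sigma (@S2 R)).
  apply: (@dominated_cvg _ _ _ sigma (@S2 R) (@measurable_S2 R)
    (fun n u => ((f u - h n u) ^+ 2)%:E) (cst 0%E) (fun u => ((f u) ^+ 2)%:E)).
  - by move=> n; apply: smeas_sq => //; case: (approx_nnsfun (h n)).
  - move=> u Su; apply: cvg_EFin; first exact: nearW.
    have h0 : f u - h n u @[n --> \oo] --> 0.
      by rewrite -[X in _ --> X](subrr (f u)); apply: cvgB; [exact: cvg_cst|exact: cvh].
    have -> : fine \o (fun n => ((f u - h n u) ^+ 2)%:E) =
        (fun n => f u - h n u) \* (fun n => f u - h n u).
      by apply/funext => n; rewrite /= expr2.
    by rewrite -(mulr0 0); apply: cvgM.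
  - by [].
  - apply/integrableP; split.
      by apply/measurable_EFinP; apply: measurable_funX.
    under eq_integral do rewrite gee0_abs ?lee_fin ?sqr_ge0//.
    exact: fi.
  - move=> n u Su; rewrite gee0_abs ?lee_fin ?sqr_ge0//.
    have h0 : 0 <= h n u by [].
    have := hle n u Su; have := f0 u; rewrite !expr2; nra.
have [n _ hn] : \forall n \near \oo, (sqdist f (h n) < e%:E)%E.
  apply: (lim0 [set x | (x < e%:E)%E]); apply: open_nbhs_nbhs; split; first exact: open_ereal_lt_ereal.
  by rewrite /= lte_fin.
by exists (h n); [exact: approx_nnsfun|apply: hn => /=].
Qed.

Lemma approx_sqr_integrable (f : V -> R) : smeas f ->
  (\int[sigma]_(u in @S2 R) ((f u) ^+ 2)%:E < +oo)%E -> approx f.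
Proof.
move=> mf fi.
have part (g : V -> R) : smeas g -> (forall u, 0 <= g u) ->
    (forall u, g u ^+ 2 <= f u ^+ 2) -> approx g.
  move=> mg g0 gf; apply: approx_ge0 => //; apply: le_lt_trans fi.
  apply: ge0_le_integral => //.
  - exact: measurable_S2.
  - by move=> u _; rewrite lee_fin sqr_ge0.
  - by apply/measurable_EFinP; apply: measurable_funX.
  - by apply/measurable_EFinP; apply: measurable_funX.
  - by move=> u _; rewrite lee_fin.
have m0 : smeas (fun=> 0) by exact: measurable_cst.
have p1 : approx (fun u => Num.max (f u) 0).
  apply: part.
  - exact: measurable_maxr.
  - by move=> u; rewrite le_max lexx orbT.
  - by move=> u; case: (leP 0 (f u)) => // _; rewrite expr0n sqr_ge0.
have p2 : approx (fun u => Num.max (- f u) 0).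
  apply: part.
  - by apply: measurable_maxr => //; exact: measurableT_comp.
  - by move=> u; rewrite le_max lexx orbT.
  - move=> u; case: (leP 0 (- f u)) => // _; rewrite ?sqrrN//.
    by rewrite expr0n sqr_ge0.
have := approxD p1 (approxZ (-1) p2); congr approx; apply/funext => u.
rewrite mulN1r; have [h|h] := leP 0 (f u).
  by rewrite max_r ?oppr_le0// subr0.
by rewrite max_l ?oppr_ge0 ?ltW// opprK add0r.
Qed.

Lemma cpf_dense (f : V -> R[i]) : in_L2 f -> forall e : R, 0 < e ->
  exists L (g : V -> R[i]), cpf L g /\ (L2normsq (fun u => f u - g u)%R < e%:E)%E.
Proof.
move=> [mRe mIm fin] e e0.
have normE (x : R[i]) : ComplexField.Normc.normc x ^+ 2 = complex.Re x ^+ 2 + complex.Im x ^+ 2.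
  by case: x => a b /=; rewrite sqr_sqrtr// addr_ge0 ?sqr_ge0.
have mn : measurable_fun (@S2 R) (fun u : borel3 R => (ComplexField.Normc.normc (f u) ^+ 2)%:E : \bar R).
  apply/measurable_EFinP.
  rewrite (_ : (fun _ => _) = (fun u => complex.Re (f u) ^+ 2 + complex.Im (f u) ^+ 2)).
    by apply: measurable_funD; apply: measurable_funX.
  by apply/funext => u; rewrite normE.
have part (g : V -> R) : smeas g ->
    (forall u, g u ^+ 2 <= ComplexField.Normc.normc (f u) ^+ 2) -> approx g.
  move=> mg gf; apply: approx_sqr_integrable => //; apply: le_lt_trans fin.
  apply: ge0_le_integral => //.
  - exact: measurable_S2.
  - by move=> u _; rewrite lee_fin sqr_ge0.
  - by apply/measurable_EFinP; apply: measurable_funX.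
  - by move=> u _; rewrite lee_fin.
have [_ a1] : approx (fun u => complex.Re (f u)).
  by apply: part => // u; rewrite normE lerDl sqr_ge0.
have [_ a2] : approx (fun u => complex.Im (f u)).
  by apply: part => // u; rewrite normE lerDr sqr_ge0.
have e2 : 0 < e / 2 by lra.
have [P hP] := a1 _ e2; have [Q hQ] := a2 _ e2.
pose PQ : cpoly R := [seq (Complex p.1 0, p.2) | p <- P] ++ [seq (Complex 0 p.1, p.2) | p <- Q].
have PQE u : ceval PQ u = Complex (reval P u) (reval Q u).
  rewrite /ceval big_cat !big_map /=; apply: complex_eq.
    rewrite cReD !cRe_sum [X in _ + X]big1 ?addr0; last first.
      by move=> p _; rewrite cReM /= mul0r mulr0 subr0.
    by apply: eq_bigr => p _; rewrite cReM /= mulr0 subr0.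
  rewrite cImD !cIm_sum [X in X + _]big1 ?add0r; last first.
    by move=> p _; rewrite cImM /= mul0r mulr0 addr0.
  by apply: eq_bigr => p _; rewrite cImM /= mul0r add0r.
exists (\max_(p <- PQ) size p.2)%N, (ceval PQ); split.
  exists PQ; split=> //; apply/allP => p pPQ.
  by rewrite (big_rem p)//= leq_maxl.
have -> : L2normsq (fun u => f u - ceval PQ u) =
   (sqdist (fun u => complex.Re (f u)) (reval P) +
    sqdist (fun u => complex.Im (f u)) (reval Q))%E.
  rewrite /sqdist -ge0_integralD//.
  - apply: eq_integral => u _; rewrite normE PQE -EFinD.
    by case: (f u) => a b.
  - exact: measurable_S2.
  - by move=> u _; rewrite lee_fin sqr_ge0.
  - by apply: smeas_sq => //; exact: smeas_reval.
  - by move=> u _; rewrite lee_fin sqr_ge0.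
  - by apply: smeas_sq => //; exact: smeas_reval.
by rewrite [e]splitr EFinD; apply: lteD.
Qed.

End Density.

(** * Irreducible representations that are real *)

Section Intertwiner.
Variables (F : fieldType) (gT : finGroupType) (G : {group gT}).

(** Schur's lemma: kernel and image of B are submodules. *)
Lemma intertwiner_rsim n m (r1 : mx_representation F G n) (r2 : mx_representation F G m)
    (B : 'M[F]_(n, m)) : mx_irreducible r1 -> mx_irreducible r2 -> B != 0 ->
  {in G, forall x, r1 x *m B = B *m r2 x} -> mx_rsim r1 r2.
Proof.
move=> [_ _ s1] [_ _ s2] B0 hB.
have freeB : row_free B.
  rewrite -kermx_eq0; apply: contraNT B0 => k0.
  have : (1%:M <= kermx B)%MS.
    apply: s1 => //; last exact: submx1.
    apply/mxmoduleP => x Gx; apply/sub_kermxP.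
    by rewrite -mulmxA hB// mulmxA mulmx_ker mul0mx.
  by move/sub_kermxP; rewrite mul1mx => ->.
have fullB : row_full B.
  rewrite -sub1mx -(genmxE B); apply: s2; last by rewrite (eqmx_eq0 (genmxE B)).
    apply/mxmoduleP => x Gx.
    by rewrite (eqmxMr _ (genmxE B)) genmxE -hB// submxMl.
  exact: submx1.
by exists B => //; rewrite -(eqP freeB) (eqP fullB).
Qed.

End Intertwiner.

Section RealIrreps.
Variables (R : realType) (gT : finGroupType) (G : {group gT}).
Local Notation C := R[i].
Local Notation rc := (@real_complex R).

(** Real orthogonal representations satisfying the two identities which the
    regular representation imposes on a full set of irreducibles.  These
    identities imply that the family is such a set, over C. *)
Record real_irreps := RealIrreps {
  ri_n : nat;
  ri_d : 'I_ri_n -> nat;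
  ri_rep : forall k, mx_representation R G (ri_d k);
  ri_d_gt0 : forall k, (0 < ri_d k)%N;
  ri_orth : forall k g, g \in G -> ri_rep k g *m (ri_rep k g)^T = 1%:M;
  ri_char : forall g, g \in G ->
    \sum_k (ri_d k)%:R * \tr (ri_rep k g) = (g == 1%g)%:R * #|G|%:R;
  ri_card : (\sum_k ri_d k ^ 2)%N = #|G| }.

Variable I : real_irreps.
Local Notation n := (ri_n I).
Local Notation d := (@ri_d I).
Local Notation Gamma := (@ri_rep I).

Lemma ri_trV k g : g \in G -> Gamma k g^-1%g = (Gamma k g)^T.
Proof.
move=> Gg; have h : Gamma k g *m (Gamma k g)^T = 1%:M := ri_orth k Gg.
by rewrite repr_mxV// -[LHS]mulmx1 -h mulKmx// repr_mx_unit.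
Qed.

Definition entry := {k : 'I_n & ('I_(d k) * 'I_(d k))%type}.
Definition ent (t : entry) (g : gT) : R := Gamma (tag t) g (tagged t).1 (tagged t).2.

Lemma card_entry : #|{: entry}| = #|G|.
Proof.
rewrite card_tagged -(ri_card I) sumnE big_map big_enum; apply: eq_bigr => k _.
by rewrite card_prod card_ord.
Qed.

(** By ri_card the matrix of all entries of all representations, indexed by G
    and by entry, is square.  The character identity says that its suitably
    weighted transpose is a right inverse; being also a left inverse gives the
    orthogonality relations. *)
Lemma schur_relations (s t : entry) :
  \sum_(g in G) ent s g * ent t g = (s == t)%:R * (#|G|%:R / (d (tag s))%:R).
Proof.
have N0 : #|G|%:R != 0 :> R by rewrite pnatr_eq0 -lt0n cardG_gt0.
have d0 k : (d k)%:R != 0 :> R by rewrite pnatr_eq0 -lt0n ri_d_gt0.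
pose e (b : 'I_#|G|) : entry := enum_val (cast_ord (esym card_entry) b).
pose e' (t : entry) : 'I_#|G| := cast_ord card_entry (enum_rank t).
have e'K t' : e (e' t') = t'.
  by rewrite /e /e' cast_ordK enum_rankK.
have eK b : e' (e b) = b.
  by rewrite /e /e' enum_valK cast_ordKV.
pose U : 'M[R]_#|G| := \matrix_(a, b) ent (e b) (enum_val a).
pose W : 'M[R]_#|G| := \matrix_(b, a) ((d (tag (e b)))%:R / #|G|%:R * ent (e b) (enum_val a)).
have UW : U *m W = 1%:M.
  apply/matrixP => a a'; rewrite !mxE.
  set g := enum_val a; set h := enum_val a'.
  have Gg : g \in G by exact: enum_valP.
  have Gh : h \in G by exact: enum_valP.
  transitivity (\sum_t (d (tag t))%:R / #|G|%:R * (ent t g * ent t h)).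
    rewrite (reindex e) /=; last by exists e' => t' _; [exact: eK|exact: e'K].
    by apply: eq_bigr => b _; rewrite !mxE -/g -/h; ring.
  transitivity (\sum_k ((d k)%:R * \tr (Gamma k (g * h^-1)%g)) / #|G|%:R).
    transitivity (\sum_k \sum_(ij : 'I_(d k) * 'I_(d k))
       (d k)%:R / #|G|%:R * (Gamma k g ij.1 ij.2 * Gamma k h ij.1 ij.2)).
      by rewrite sig_big_dep /=; apply: eq_bigr => -[k ij].
    apply: eq_bigr => k _; rewrite repr_mxM ?groupV// ri_trV// mulrAC.
    rewrite -mulr_sumr; congr (_ * _).
    rewrite -(pair_bigA _ (fun i j => Gamma k g i j * Gamma k h i j)).
    by apply: eq_bigr => i _; rewrite mxE; apply: eq_bigr => j _; rewrite mxE.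
  rewrite -mulr_suml ri_char ?groupM ?groupV// mulfK//.
  by rewrite -eq_mulgV1 /g /h (inj_eq enum_val_inj).
have := mulmx1C UW; move/matrixP => /(_ (e' s) (e' t)); rewrite !mxE => h.
have -> : (s == t) = (e' s == e' t).
  by apply/eqP/eqP => [->|] //; move/(congr1 e); rewrite !e'K.
transitivity (#|G|%:R / (d (tag s))%:R * \sum_j W (e' s) j * U j (e' t)); last first.
  by rewrite h mulrC.
rewrite mulr_sumr (reindex_onto (enum_val : 'I_#|G| -> gT) (enum_rank_in (group1 G))) /=; last first.
  by move=> g Gg; rewrite enum_rankK_in.
rewrite (eq_bigl xpredT) => [|a]; last by rewrite enum_valP enum_valK_in eqxx.
apply: eq_bigr => a _; rewrite !mxE !e'K; set x := ent s _; set y := ent t _.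
by field; rewrite N0 d0.
Qed.

Lemma schur_entries k i j k' i' j' :
  \sum_(g in G) Gamma k g i j * Gamma k' g i' j' =
  (existT (fun k => ('I_(d k) * 'I_(d k))%type) k (i, j) ==
   existT (fun k => ('I_(d k) * 'I_(d k))%type) k' (i', j') :> entry)%:R
     * (#|G|%:R / (d k)%:R).
Proof. exact: (schur_relations (existT _ k (i, j)) (existT _ k' (i', j'))). Qed.

Lemma schur_same k i j i' j' :
  \sum_(g in G) Gamma k g i j * Gamma k g i' j' =
  ((i == i') && (j == j'))%:R * (#|G|%:R / (d k)%:R).
Proof. by rewrite schur_entries eq_Tagged. Qed.

Lemma schur_diff k i j k' i' j' : k != k' ->
  \sum_(g in G) Gamma k g i j * Gamma k' g i' j' = 0.
Proof.
move=> kk; rewrite schur_entries; case: eqP => [/(congr1 tag)/= e|_]; last by rewrite mul0r.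
by rewrite e eqxx in kk.
Qed.

Definition CGamma k : mx_representation C G (d k) := map_repr rc (Gamma k).

Lemma CGammaE k g i j : CGamma k g i j = rc (Gamma k g i j).
Proof. by rewrite map_reprE mxE. Qed.

Let N0 : #|G|%:R != 0 :> R. Proof. by rewrite pnatr_eq0 -lt0n cardG_gt0. Qed.
Let d0 k : (d k)%:R != 0 :> R. Proof. by rewrite pnatr_eq0 -lt0n ri_d_gt0. Qed.

(** The matrices of the group span the full matrix algebra, which forces
    irreducibility. *)
Lemma unit_in_span k i j : delta_mx i j =
  \sum_(g in G) rc ((d k)%:R / #|G|%:R * Gamma k g i j) *: CGamma k g.
Proof.
apply/matrixP => a b; rewrite summxE mxE.
transitivity (rc ((d k)%:R / #|G|%:R * \sum_(g in G) Gamma k g i j * Gamma k g a b)).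
  rewrite schur_same mulrCA.
  have -> : (d k)%:R / #|G|%:R * (#|G|%:R / (d k)%:R) = 1 :> R.
    by field; rewrite N0 d0.
  by rewrite mulr1 rmorph_nat !(eq_sym i) !(eq_sym j).
rewrite mulr_sumr rmorph_sum; apply: eq_bigr => g _.
by rewrite mxE CGammaE !rmorphM /= !mulrA.
Qed.

Lemma CGamma_irr k : mx_irreducible (CGamma k).
Proof.
split; first exact: mxmodule1.
  by rewrite -mxrank_eq0 mxrank1 -lt0n ri_d_gt0.
move=> U /mxmoduleP modU _ U0.
have /matrix0Pn[r [i Uri]] := U0.
have subU j : (U *m delta_mx i j <= U)%MS.
  rewrite unit_in_span mulmx_sumr; apply: summx_sub => g Gg.
  by rewrite -scalemxAr scalemx_sub// modU.
apply/row_subP => j.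
have -> : row j 1%:M = (U r i)^-1 *: row r (U *m delta_mx i j).
  apply/rowP => a; rewrite !mxE (bigD1 i)//= mxE eqxx big1 ?addr0.
    by rewrite /= eq_sym; case: eqP => _; rewrite ?mulr1 ?mulVf ?mulr0.
  by move=> b bi; rewrite mxE (negbTE bi) mulr0.
by apply: scalemx_sub; exact: submx_trans (row_sub _ _) (subU j).
Qed.

Lemma CGamma_inequiv p q : mx_rsim (CGamma p) (CGamma q) -> p = q.
Proof.
move=> [B e freeB hB]; apply/eqP; apply: contraT => pq.
have i0 : 'I_(d p) by case: (d p) (ri_d_gt0 p) => // m _; exact: ord0.
have : row i0 B = 0.
  have -> : row i0 B = row i0 (delta_mx i0 i0 *m B).
    apply/rowP => a; rewrite !mxE (bigD1 i0)//= mxE !eqxx mul1r big1 ?addr0//.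
    by move=> b bi; rewrite mxE (negbTE bi) andbF mul0r.
  rewrite unit_in_span mulmx_suml.
  rewrite (_ : \sum_(g in G) _ = B *m \sum_(g in G) rc ((d p)%:R / #|G|%:R * Gamma p g i0 i0) *: CGamma q g).
    rewrite (_ : \sum_(g in G) _ = 0) ?mulmx0 ?row0//.
    apply/matrixP => a b; rewrite summxE mxE.
    transitivity (rc ((d p)%:R / #|G|%:R * \sum_(g in G) Gamma p g i0 i0 * Gamma q g a b)).
      rewrite mulr_sumr rmorph_sum; apply: eq_bigr => g _.
      by rewrite mxE CGammaE !rmorphM /= !mulrA.
    by rewrite schur_diff// mulr0 rmorph0.
  rewrite mulmx_sumr; apply: eq_bigr => g Gg.
  by rewrite -scalemxAl hB// scalemxAr.
move/eqP; rewrite rowE => /eqP/(congr1 (fun M => M *m pinvmx B)).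
rewrite -mulmxA mulmxVp// mulmx1 mul0mx => /rowP/(_ i0).
by rewrite !mxE !eqxx => /eqP; rewrite oner_eq0.
Qed.

(** If the averages of Gamma_k(g)_ii rG(g) were all zero, the character
    identity would give #|G| rG(1) = 0.  A nonzero average provides an
    intertwiner with Gamma_k. *)
Lemma CGamma_exhaust m (rG : mx_representation C G m) :
  mx_irreducible rG -> exists p, mx_rsim rG (CGamma p).
Proof.
move=> irr; have [_ n0 _] := irr.
pose X k i j : 'M[C]_m := \sum_(g in G) rc (Gamma k g i j) *: rG g.
have [k [i Xki]] : exists k i, X k i i != 0.
  apply: contrapT => nX.
  have X0 k i : X k i i = 0.
    by apply/eqP; apply: contrapT => /negP h; apply: nX; exists k, i.
  have : rc (#|G|%:R) *: (1%:M : 'M[C]_m) = \sum_k \sum_i rc (d k)%:R *: X k i i.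
    transitivity (\sum_(g in G) rc (\sum_k (d k)%:R * \tr (Gamma k g)) *: rG g).
      rewrite (bigD1 1%g)//= ri_char// eqxx mul1r repr_mx1 big1 ?addr0// => g.
      by move=> /andP[Gg /negbTE g1]; rewrite ri_char// g1 mul0r rmorph0 scale0r.
    under [RHS]eq_bigr => k _.
      under eq_bigr => i _.
        rewrite scaler_sumr; over.
      rewrite exchange_big; over.
    rewrite exchange_big; apply: eq_bigr => g _.
    rewrite rmorph_sum scaler_suml; apply: eq_bigr => k _.
    rewrite /mxtrace mulr_sumr rmorph_sum scaler_suml; apply: eq_bigr => i _.
    by rewrite scalerA rmorphM.
  rewrite big1 => [|k _]; last by rewrite big1 // => i _; rewrite X0 scaler0.
  move/eqP; rewrite scaler_eq0 fmorph_eq0 (negbTE N0)/=.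
  by rewrite (negbTE n0).
have /matrix0Pn[r [c Xrc]] := Xki.
pose B : 'M[C]_(d k, m) := \matrix_(l, b) X k i l r b.
have B0 : B != 0 by apply/matrix0Pn; exists i, c; rewrite mxE.
exists k; apply: mx_rsim_sym; apply: intertwiner_rsim (CGamma_irr k) irr B0 _ => h Gh.
apply/matrixP => j b; rewrite !mxE.
have XE l : \sum_s X k i l r s * rG h s b =
    \sum_(g in G) rc (Gamma k (g * h^-1)%g i l) * rG g r b.
  transitivity ((X k i l *m rG h) r b); first by rewrite mxE.
  rewrite mulmx_suml summxE (reindex_inj (mulIg h^-1%g)) /=.
  apply: eq_big => g; first by rewrite groupMr ?groupV.
  by move=> Gg; rewrite -scalemxAl -repr_mxM// mulgKV mxE.
transitivity (\sum_s X k i j r s * rG h s b); last first.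
  by apply: eq_bigr => s _; rewrite mxE.
rewrite XE.
under [RHS]eq_bigr => g Gg.
  rewrite repr_mxM ?groupV// ri_trV// mxE rmorph_sum mulr_suml.
  under eq_bigr => s _ do rewrite mxE rmorphM /= mulrAC [_ * rc (Gamma k h _ _)]mulrC.
  over.
rewrite /= exchange_big; apply: eq_bigr => s _.
rewrite CGammaE mxE summxE mulr_sumr; apply: eq_bigr => g Gg.
by rewrite mxE.
Qed.

Lemma CGamma_unitary k g : g \in G -> CGamma k g \is unitarymx.
Proof.
move=> Gg; apply/unitarymxP.
have -> : (CGamma k g ^t*)%sesqui = map_mx rc (Gamma k g)^T.
  by apply/matrixP => i j; rewrite !mxE cconj_rc.
by rewrite map_reprE -map_mxM ri_orth// map_mx1.
Qed.

End RealIrreps.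

(** * Real bases adapted to real irreducible representations *)

Section RealHarmonics.
Variable R : realType.
Local Notation V := 'cV[R]_3.
Local Notation C := R[i].
Local Notation rc := (@real_complex R).
Local Notation Re := (@complex.Re R).
Local Notation Im := (@complex.Im R).
Local Notation cint := (@sphere_integral R).

(** The real-valued members of the harmonic space of degree l. *)
Definition RV l (f : V -> R) := Vl l (fun u => rc (f u)).

Lemma RV_ext l f g : (forall u, S2 u -> f u = g u) -> RV l g -> RV l f.
Proof. by move=> fg; apply: Vl_ext => u Su; rewrite fg. Qed.

Lemma RV0 l : RV l (fun=> 0).
Proof. by apply: Vl_ext (Vl0 R l) => u _; rewrite rmorph0. Qed.

Lemma RV_lin l a f b g : RV l f -> RV l g -> RV l (fun u => a * f u + b * g u).
Proof.
move=> hf hg; apply: Vl_ext (VlD (VlZ (rc a) hf) (VlZ (rc b) hg)) => u _.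
by rewrite rmorphD !rmorphM.
Qed.

Lemma RV_sum I (s : seq I) l (c : I -> R) (F : I -> V -> R) :
  (forall i, RV l (F i)) -> RV l (fun u => \sum_(i <- s) c i * F i u).
Proof.
move=> h; elim: s => [|i s IH].
  by apply: RV_ext (RV0 l) => u _; rewrite big_nil.
apply: RV_ext (RV_lin (c i) 1 (h i) IH) => u _.
by rewrite big_cons mul1r.
Qed.

Lemma Vl_Re l f : Vl l f -> RV l (fun u => Re (f u)).
Proof.
move=> hf; apply: Vl_ext (VlZ (rc 2^-1) (VlD hf (Vl_conj hf))) => u _.
by apply: complex_eq; rewrite ?cReM ?cImM ?cReD ?cImD cconjE /=; field.
Qed.

Lemma Vl_Im l f : Vl l f -> RV l (fun u => Im (f u)).
Proof.
move=> hf.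
apply: Vl_ext (VlZ (Complex 0 2^-1) (VlD (VlZ (-1) hf) (Vl_conj hf))) => u _.
by apply: complex_eq; rewrite ?(cReM, cImM, cReD, cImD) cconjE /=; field.
Qed.

Definition rip (f g : V -> R) : R := avg (fun u => f u * g u).

Lemma rc_rip f g : rc (rip f g) = ip (fun u => rc (f u)) (fun u => rc (g u)).
Proof.
rewrite -cint_rc; apply: eq_cint => u _.
by rewrite cconj_rc rmorphM.
Qed.

Lemma rc_inj : injective rc.
Proof. by move=> x y []. Qed.

Lemma eq_rip f f' g g' : (forall u, S2 u -> f u = f' u) -> (forall u, S2 u -> g u = g' u) ->
  rip f g = rip f' g'.
Proof. by move=> h k; apply: eq_avg => u Su; rewrite h// k. Qed.

Lemma ripC f g : rip f g = rip g f.
Proof. by apply: eq_avg => u _; rewrite mulrC. Qed.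

Lemma rip_sumr I (s : seq I) l l' f (c : I -> R) (F : I -> V -> R) :
  RV l f -> (forall i, RV l' (F i)) ->
  rip f (fun u => \sum_(i <- s) c i * F i u) = \sum_(i <- s) c i * rip f (F i).
Proof.
move=> hf hF; apply: rc_inj; rewrite rc_rip rmorph_sum /=.
rewrite (eq_ip (fun u _ => erefl _) (g' := fun u => \sum_(i <- s) rc (c i) * rc (F i u))).
  rewrite (ip_sumr _ _ (Vl_cpf hf) (fun i => Vl_cpf (hF i))).
  by apply: eq_bigr => i _; rewrite -rc_rip rmorphM.
by move=> u _; rewrite rmorph_sum; apply: eq_bigr => i _; rewrite rmorphM.
Qed.

Lemma rip_suml I (s : seq I) l l' f (c : I -> R) (F : I -> V -> R) :
  RV l f -> (forall i, RV l' (F i)) ->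
  rip (fun u => \sum_(i <- s) c i * F i u) f = \sum_(i <- s) c i * rip (F i) f.
Proof.
move=> hf hF; rewrite ripC (rip_sumr _ _ hf hF).
by apply: eq_bigr => i _; rewrite ripC.
Qed.

Lemma rip_lin l a f b g h : RV l f -> RV l g -> RV l h ->
  rip (fun u => a * f u + b * g u) h = a * rip f h + b * rip g h.
Proof.
move=> hf hg hh.
have := @rip_suml _ [:: true; false] l l h (fun x => if x then a else b)
  (fun x => if x then f else g) hh.
rewrite !big_cons !big_nil !addr0 => <-; last by case.
by apply: eq_avg => u _; rewrite !big_cons big_nil addr0.
Qed.

Lemma rip_ge0 f : 0 <= rip f f.
Proof. by apply: Rintegral_ge0 => u _; rewrite -expr2 sqr_ge0. Qed.

Lemma RV_definite l f : RV l f -> rip f f = 0 -> forall u, S2 u -> f u = 0.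
Proof.
move=> hf ff u Su; apply: rc_inj; rewrite rmorph0.
by apply: (Vl_definite hf) => //; rewrite -rc_rip ff rmorph0.
Qed.

Lemma RV_orth l l' f g : l != l' -> RV l f -> RV l' g -> rip f g = 0.
Proof. by move=> ll hf hg; apply: rc_inj; rewrite rc_rip (Vl_orth ll hf hg) rmorph0. Qed.

Lemma RV_rot l f A : orth A -> RV l f -> RV l (fun u => f (A *m u)).
Proof. by move=> oA hf; exact: (Vl_rot oA hf). Qed.

Lemma rip_rot l l' f g A : orth A -> RV l f -> RV l' g ->
  rip (fun u => f (A *m u)) (fun u => g (A *m u)) = rip f g.
Proof.
move=> oA hf hg; apply: rc_inj; rewrite !rc_rip.
exact: (ip_rot oA (Vl_cpf hf) (Vl_cpf hg)).
Qed.

(** Gram-Schmidt inside a subspace Q; vectors of norm 0 are dropped. *)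
Lemma gram_schmidt l (Q : (V -> R) -> Prop) m (F : nat -> V -> R) :
  (forall f, Q f -> RV l f) ->
  (forall a f b g, Q f -> Q g -> Q (fun u => a * f u + b * g u)) ->
  Q (fun=> 0) ->
  (forall i, (i < m)%N -> Q (F i)) ->
  exists n (T : nat -> V -> R), [/\ forall i, Q (T i),
    forall i j, (i < n)%N -> (j < n)%N -> rip (T i) (T j) = (i == j)%:R &
    forall k, (k < m)%N -> exists c : nat -> R, forall u, S2 u ->
      F k u = \sum_(i < n) c i * T i u].
Proof.
move=> QV Qlin Q0; elim: m => [|m IH] hF.
  by exists 0%N, (fun _ _ => 0).
have [n [T [QT oT sT]]] := IH (fun i im => hF i (ltnW im)).
have Qsum (c : nat -> R) p : Q (fun u => \sum_(i < p) c i * T i u).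
  elim: p => [|p IHp].
    rewrite (_ : (fun _ => _) = fun=> 0)//.
    by apply/funext => u; rewrite big_ord0.
  rewrite (_ : (fun _ => _) = fun u => 1 * (\sum_(i < p) c i * T i u) + c p * T p u).
    exact: Qlin.
  by apply/funext => u; rewrite big_ord_recr mul1r.
pose c0 i := rip (F m) (T i).
pose r u := 1 * F m u + (-1) * \sum_(i < n) c0 i * T i u.
have Qr : Q r by apply: Qlin => //; exact: hF.
have Vm : RV l (F m) by apply: QV; exact: hF.
have VT i : RV l (T i) by exact: QV.
have FE u : F m u = r u + \sum_(i < n) c0 i * T i u by rewrite /r; ring.
have [r0|r0] := eqVneq (rip r r) 0.
  exists n, T; split=> // k; rewrite ltnS leq_eqVlt => /orP[/eqP ->|/sT //].
  exists c0 => u Su; rewrite FE (RV_definite (QV _ Qr))// add0r//.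
have rr : 0 < rip r r by rewrite lt_def r0 rip_ge0.
pose q := (Num.sqrt (rip r r))^-1.
have q0 : q != 0 by rewrite invr_eq0 sqrtr_eq0 -ltNge.
pose t u := q * r u + 0 * r u.
have Qt : Q t by exact: Qlin.
pose T' i := if (i < n)%N then T i else t.
have rT i : (i < n)%N -> rip r (T i) = 0.
  move=> ni; rewrite /r (rip_lin _ _ Vm (QV _ (Qsum c0 n)) (VT i)).
  rewrite (rip_suml _ _ (VT i) (fun j : 'I_n => VT j)).
  rewrite (bigD1 (Ordinal ni))//= oT// eqxx big1 ?addr0; last first.
    by move=> j ji; rewrite oT// (_ : (j == i :> nat) = false) ?mulr0//; exact/negbTE.
  by rewrite /c0 mulr1; ring.
have tT i : (i < n)%N -> rip t (T i) = 0.
  by move=> ni; rewrite /t (rip_lin _ _ (QV _ Qr) (QV _ Qr) (VT i)) rT// !mulr0 addr0.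
have tt : rip t t = 1.
  rewrite /t (rip_lin _ _ (QV _ Qr) (QV _ Qr) (QV _ Qt)) mul0r addr0 ripC.
  rewrite /t (rip_lin _ _ (QV _ Qr) (QV _ Qr) (QV _ Qr)) mul0r addr0 mulrA -expr2.
  by rewrite exprVn sqr_sqrtr ?rip_ge0// mulVf.
exists n.+1, T'; split.
- by move=> i; rewrite /T'; case: ifP.
- move=> i j; rewrite !ltnS => hi hj; rewrite /T'.
  case: ltnP => i1; case: ltnP => j1.
  + exact: oT.
  + by rewrite ripC tT// ltn_eqF// (leq_trans i1 j1).
  + by rewrite tT// gtn_eqF// (leq_trans j1 i1).
  + by rewrite tt (@anti_leq i n) ?hi// (@anti_leq j n) ?hj// eqxx.
- have ext (c : nat -> R) x u : \sum_(i < n.+1) (if (i < n)%N then c i else x) * T' i u =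
      \sum_(i < n) c i * T i u + x * t u.
    rewrite big_ord_recr /= /T' ltnn; congr (_ + _).
    by apply: eq_bigr => i _ /=; rewrite ltn_ord.
  move=> k; rewrite ltnS leq_eqVlt => /orP[/eqP ->|km].
    exists (fun i => if (i < n)%N then c0 i else q^-1) => u Su.
    by rewrite ext FE addrC; congr (_ + _); rewrite /t mul0r addr0 mulrA mulVf// mul1r.
  have [c hc] := sT _ km.
  exists (fun i => if (i < n)%N then c i else 0) => u Su.
  by rewrite ext mul0r addr0 hc.
Qed.

End RealHarmonics.

Section Projections.
Variables (R : realType) (gT : finGroupType) (G : {group gT}).
Variables (rot : mx_representation R G 3) (I : real_irreps R G).
Hypothesis rot_orth : forall g, g \in G -> orth (rot g).
Local Notation V := 'cV[R]_3.
Local Notation C := R[i].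
Local Notation rc := (@real_complex R).
Local Notation n := (ri_n I).
Local Notation d := (@ri_d _ _ _ I).
Local Notation Gamma := (@ri_rep _ _ _ I).

(** The identity outside G, so that orthogonality holds for every g. *)
Definition rinv g : 'M[R]_3 := if g \in G then rot g^-1%g else 1%:M.

Lemma rinv_orth g : orth (rinv g).
Proof.
rewrite /rinv; case: ifP => Gg; first by apply: rot_orth; rewrite groupV.
by rewrite /orth trmx1 mulmx1.
Qed.

Lemma rinvM g h (u : V) : g \in G -> h \in G -> rinv h *m (rinv g *m u) = rinv (g * h)%g *m u.
Proof.
by move=> Gg Gh; rewrite /rinv groupM// Gg Gh mulmxA invMg repr_mxM ?groupV.
Qed.

Definition wgt k (i j : 'I_(d k)) g : R := (d k)%:R / #|G|%:R * Gamma k g i j.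
Arguments wgt k i j g : clear implicits.

(** The operators (d_k / #|G|) sum_g Gamma_k(g)_ij g, which multiply like
    matrix units. *)
Definition proj k (i j : 'I_(d k)) (f : V -> R) (u : V) : R :=
  \sum_(g <- enum G) wgt k i j g * f (rinv g *m u).

Arguments proj k i j f u : clear implicits.

Lemma projE k i j f u : proj k i j f u = \sum_(g in G) wgt k i j g * f (rinv g *m u).
Proof. by rewrite /proj big_enum. Qed.

Let N0 : #|G|%:R != 0 :> R. Proof. by rewrite pnatr_eq0 -lt0n cardG_gt0. Qed.
Let d0 k : (d k)%:R != 0 :> R. Proof. by rewrite pnatr_eq0 -lt0n ri_d_gt0. Qed.

Lemma Gamma_divE k g x i j : g \in G -> x \in G ->
  Gamma k (g^-1 * x)%g i j = \sum_m Gamma k g m i * Gamma k x m j.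
Proof.
move=> Gg Gx; rewrite repr_mxM ?groupV// ri_trV// mxE.
by apply: eq_bigr => m _; rewrite mxE.
Qed.

(** The relations between the operators proj follow from the multiplication
    of functions on the group; schur_same and schur_diff evaluate the inner
    sum. *)
Lemma proj_comp k i j k' i' j' f u : proj k i j (proj k' i' j' f) u =
  \sum_(x in G) (\sum_m ((d k)%:R / #|G|%:R * ((d k')%:R / #|G|%:R) *
      (\sum_(g in G) Gamma k g i j * Gamma k' g m i')) * Gamma k' x m j') * f (rinv x *m u).
Proof.
rewrite projE.
transitivity (\sum_(g in G) \sum_(x in G)
    (wgt k i j g * wgt k' i' j' (g^-1 * x)%g) * f (rinv x *m u)).
  apply: eq_bigr => g Gg; rewrite projE mulr_sumr.
  rewrite (reindex_inj (mulgI g^-1%g)) /=.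
  apply: eq_big => x; first by rewrite groupMl ?groupV.
  by move=> Gx; rewrite rinvM// ?groupM ?groupV// mulKVg mulrA.
rewrite exchange_big; apply: eq_bigr => x Gx.
rewrite -mulr_suml; congr (_ * _).
under eq_bigr => g Gg.
  rewrite /wgt Gamma_divE// !mulr_sumr; over.
rewrite exchange_big; apply: eq_bigr => m _.
rewrite mulr_sumr mulr_suml; apply: eq_bigr => g _; ring.
Qed.

Lemma proj_same k i j i' j' f u :
  proj k i j (proj k i' j' f) u = (j == i')%:R * proj k i j' f u.
Proof.
rewrite proj_comp projE mulr_sumr; apply: eq_bigr => x Gx.
rewrite [RHS]mulrA; congr (_ * _); rewrite (bigD1 i)//= [X in _ + X]big1 ?addr0; last first.
  by move=> m mi; rewrite schur_same eq_sym (negbTE mi) /= !(mul0r, mulr0).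
rewrite schur_same eqxx /= /wgt.
by case: (j == i'); rewrite ?(mul0r, mulr0, mul1r, mulr1)//; field; rewrite N0 d0.
Qed.

Lemma proj_diff k i j k' i' j' f u : k != k' -> proj k i j (proj k' i' j' f) u = 0.
Proof.
move=> kk; rewrite proj_comp big1// => x Gx; rewrite big1 ?mul0r// => m _.
by rewrite schur_diff// !(mul0r, mulr0).
Qed.

Lemma proj_sum f u : \sum_k \sum_i proj k i i f u = f u.
Proof.
transitivity (\sum_(g in G) (\sum_k (d k)%:R * \tr (Gamma k g)) / #|G|%:R * f (rinv g *m u)).
  under eq_bigr => k _.
    under eq_bigr do rewrite projE.
    rewrite exchange_big; over.
  rewrite exchange_big; apply: eq_bigr => g _.
  rewrite mulr_suml mulr_suml; apply: eq_bigr => k _.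
  rewrite /mxtrace mulr_sumr !mulr_suml; apply: eq_bigr => i _.
  by rewrite /wgt; ring.
rewrite (bigD1 1%g)//= ri_char// eqxx mul1r divff// mul1r big1 ?addr0.
  by rewrite /rinv group1 invg1 repr_mx1 mul1mx.
by move=> g /andP[Gg /negbTE g1]; rewrite ri_char// g1 !mul0r.
Qed.

Lemma proj_RV l k i j f : RV l f -> RV l (proj k i j f).
Proof. by move=> hf; apply: RV_sum => g; apply: RV_rot => //; exact: rinv_orth. Qed.

Lemma proj_ext k i j f f' : (forall u, S2 u -> f u = f' u) ->
  forall u, S2 u -> proj k i j f u = proj k i j f' u.
Proof.
move=> h u Su; apply: eq_bigr => g _; congr (_ * _); apply: h.
by apply: orth_S2 => //; exact: rinv_orth.
Qed.

Lemma proj_suml J (s : seq J) k i j (c : J -> R) (F : J -> V -> R) u :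
  proj k i j (fun u => \sum_(a <- s) c a * F a u) u = \sum_(a <- s) c a * proj k i j (F a) u.
Proof.
rewrite /proj; under eq_bigr do rewrite mulr_sumr.
rewrite exchange_big; apply: eq_bigr => a _; rewrite mulr_sumr.
by apply: eq_bigr => g _; rewrite mulrCA.
Qed.

Lemma proj_equiv k i j f h u : h \in G ->
  proj k j i f (rinv h *m u) = \sum_m Gamma k h m j * proj k m i f u.
Proof.
move=> Gh; rewrite projE (reindex_inj (mulgI h^-1%g)) /=.
under [RHS]eq_bigr do rewrite projE mulr_sumr.
rewrite [RHS]exchange_big; apply: eq_big => x; first by rewrite groupMl ?groupV.
move=> Gx'; have Gx : x \in G by move: Gx'; rewrite groupMl ?groupV.
rewrite rinvM// mulKVg /wgt Gamma_divE// mulr_sumr mulr_suml.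
by apply: eq_bigr => m _; ring.
Qed.

Lemma proj_adj l l' k i j f f' : RV l f -> RV l' f' ->
  rip (proj k i j f) f' = rip f (proj k j i f').
Proof.
move=> hf hf'.
have hr g : RV l (fun u => f (rinv g *m u)) by apply: RV_rot => //; exact: rinv_orth.
have hr' g : RV l' (fun u => f' (rinv g *m u)) by apply: RV_rot => //; exact: rinv_orth.
rewrite (rip_suml _ _ hf' hr) (rip_sumr _ _ hf hr') !big_enum /=.
rewrite (reindex_inj invg_inj) /=.
apply: eq_big => g; first by rewrite groupV.
rewrite groupV => Gg; rewrite /wgt ri_trV// mxE; congr (_ * _).
rewrite -(rip_rot (rinv_orth g) (hr _) hf').
apply: eq_rip => u Su //.
by rewrite rinvM ?groupV// mulgV /rinv group1 invg1 repr_mx1 mul1mx.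
Qed.

Lemma proj_lin k i j a f b g u : proj k i j (fun u => a * f u + b * g u) u =
  a * proj k i j f u + b * proj k i j g u.
Proof. by rewrite !projE !mulr_sumr -big_split; apply: eq_bigr => x _ /=; ring. Qed.

Definition idx0 k : 'I_(d k) := Ordinal (ri_d_gt0 k).

(** The functions from which the other rows of type k are obtained by proj. *)
Definition isotypic k l (f : V -> R) :=
  RV l f /\ forall u, S2 u -> proj k (idx0 k) (idx0 k) f u = f u.

(** The real and imaginary parts of the Y_{l,m} span the real harmonics of
    degree l; their projections are orthonormalized. *)
Lemma isotypic_basis k l : exists n (T : nat -> V -> R), [/\
  forall i, isotypic k l (T i),
  forall i j, (i < n)%N -> (j < n)%N -> rip (T i) (T j) = (i == j)%:R &
  forall h, RV l h -> exists c : nat -> R, forall u, S2 u ->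
    proj k (idx0 k) (idx0 k) h u = \sum_(i < n) c i * T i u].
Proof.
pose Y (a : nat) : V -> C := sph_harmonic l (a%:Z - l%:Z).
have YV (a : 'I_(2 * l).+1) : Vl l (Y a) by apply: Vl_sph; exact: index_bound.
pose m := (2 * l).+1.
pose E (a : nat) (u : V) : R := if (a < m)%N then complex.Re (Y a u)
  else if (a - m < m)%N then complex.Im (Y (a - m)%N u) else 0.
have EV a : RV l (E a).
  rewrite /E; case: ltnP => am; first exact: (Vl_Re (YV (Ordinal am))).
  by case: ltnP => am'; [exact: (Vl_Im (YV (Ordinal am')))|exact: RV0].
pose P f := proj k (idx0 k) (idx0 k) f.
have [||||n [T [QT oT sT]]] := @gram_schmidt R l (isotypic k l) (m + m) (fun a => P (E a)).
- by move=> f [].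
- move=> a f b g [hf pf] [hg pg]; split; first exact: RV_lin.
  by move=> u Su; rewrite proj_lin pf// pg.
- split; first exact: RV0.
  by move=> u _; rewrite projE big1// => g _; rewrite mulr0.
- move=> a _; split; first by apply: proj_RV; exact: EV.
  by move=> u Su; rewrite /P proj_same eqxx mul1r.
exists n, T; split=> // h [c hc].
pose co (x : 'I_m + 'I_m) : R :=
  match x with inl a => complex.Re (c a) | inr a => - complex.Im (c a) end.
have hE u : S2 u -> h u = \sum_(a < m + m) co (fintype.split a) * E a u.
  move=> Su; rewrite big_split_ord /= -big_split /=.
  transitivity (complex.Re (rc (h u))); first by [].
  rewrite hc// cRe_sum; apply: eq_bigr => a _.
  have -> : fintype.split (lshift m a) = inl a := unsplitK (inl a).
  have -> : fintype.split (rshift m a) = inr a := unsplitK (inr a).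
  rewrite cReM /co /E /= ltn_ord -[X in (X < m)%N]/(m + a)%N ltnNge leq_addr /=.
  by rewrite addKn ltn_ord mulNr.
have ch (a : 'I_(m + m)) : exists c : nat -> R, forall u, S2 u ->
    P (E a) u = \sum_(i < n) c i * T i u by apply: sT.
have /choice[cc hcc] := ch.
exists (fun i => \sum_(a < m + m) co (fintype.split a) * cc a i) => u Su.
rewrite (proj_ext _ _ hE)// proj_suml.
under [RHS]eq_bigr do rewrite mulr_suml.
rewrite exchange_big; apply: eq_bigr => a _.
rewrite -[proj _ _ _ _ _]/(P (E a) u) hcc// mulr_sumr.
by apply: eq_bigr => j _; rewrite mulrA.
Qed.

End Projections.

Arguments proj {R gT G} rot {I} k i j f u.
Arguments idx0 {R gT G I} k.
Arguments isotypic {R gT G} rot {I} k l f.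

Section Existence.
Variables (R : realType) (gT : finGroupType) (G : {group gT}).
Variables (rot : mx_representation R G 3) (I : real_irreps R G).
Hypothesis rot_orth : forall g, g \in G -> orth (rot g).
Local Notation V := 'cV[R]_3.
Local Notation C := R[i].
Local Notation rc := (@real_complex R).
Local Notation cint := (@sphere_integral R).
Local Notation n := (ri_n I).
Local Notation d := (@ri_d _ _ _ I).
Local Notation Gamma := (@ri_rep _ _ _ I).

Lemma isotypic_choice : exists (N : 'I_n * nat -> nat) (T : 'I_n * nat -> nat -> V -> R),
  forall k l, [/\
  forall i, isotypic rot k l (T (k, l) i),
  forall i j, (i < N (k, l))%N -> (j < N (k, l))%N -> rip (T (k, l) i) (T (k, l) j) = (i == j)%:R &
  forall h, RV l h -> exists c : nat -> R, forall u, S2 u ->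
    proj rot k (idx0 k) (idx0 k) h u = \sum_(i < N (k, l)) c i * T (k, l) i u].
Proof.
have /choice[NT hNT] (kl : 'I_n * nat) : exists NT : nat * (nat -> V -> R), [/\
  forall i, isotypic rot kl.1 kl.2 (NT.2 i),
  forall i j, (i < NT.1)%N -> (j < NT.1)%N -> rip (NT.2 i) (NT.2 j) = (i == j)%:R &
  forall h, RV kl.2 h -> exists c : nat -> R, forall u, S2 u ->
    proj rot kl.1 (idx0 kl.1) (idx0 kl.1) h u = \sum_(i < NT.1) c i * NT.2 i u].
  have [m [T h]] := isotypic_basis rot_orth kl.1 kl.2.
  by exists (m, T).
exists (fun kl => (NT kl).1), (fun kl => (NT kl).2) => k l.
exact: (hNT (k, l)).
Qed.

(** With T_n an orthonormal basis of the image of proj p 0 0 in degree l, the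
    functions F_{p,l,n,j} = proj p j 0 T_n are real because Gamma_p is, and
    they transform as rows.  Since proj p j 0 is isometric on that image, they
    are orthonormal; since the sum of all proj p i i is the identity, they
    span the harmonics of degree l. *)
Lemma real_irreps_basis : inhabited (admissible_real_basis rot).
Proof.
have [N [T hT]] := isotypic_choice.
pose mult (p : 'I_n) l := N (p, l).
pose FR (p : 'I_n) l (m : 'I_(mult p l)) (j : 'I_(d p)) : V -> R :=
  proj rot p j (idx0 p) (T (p, l) m).
pose F p l m j : V -> C := fun u => rc (@FR p l m j u).
have TV p l i : RV l (T (p, l) i) by case: (hT p l) => h _ _; case: (h i).
have FV p l m j : RV l (@FR p l m j) by apply: proj_RV.
pose bi := {pl : 'I_n * nat & ('I_(mult pl.1 pl.2) * 'I_(d pl.1))%type}.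
pose Fb (b : bi) := F _ _ (tagged b).1 (tagged b).2.
have rinvE g : g \in G -> invmx (rot g) = rinv rot g.
  by move=> Gg; rewrite /rinv Gg repr_mxV.
(* the linear span of the basis functions; coefficients of equal indices are
   added up at the end *)
pose Rep (f : V -> C) := exists r : seq (C * bi), forall u, S2 u ->
  f u = \sum_(x <- r) x.1 * Fb x.2 u.
have Rep_ext f f' : (forall u, S2 u -> f u = f' u) -> Rep f' -> Rep f.
  by move=> ff [r hr]; exists r => u Su; rewrite ff// hr.
have Rep0 : Rep (fun=> 0) by exists [::] => u _; rewrite big_nil.
have RepD f f' : Rep f -> Rep f' -> Rep (fun u => f u + f' u).
  move=> [r hr] [r' hr']; exists (r ++ r') => u Su.
  by rewrite big_cat hr// hr'.
have RepZ c f : Rep f -> Rep (fun u => c * f u).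
  move=> [r hr]; exists [seq (c * x.1, x.2) | x <- r] => u Su.
  by rewrite big_map hr// mulr_sumr; apply: eq_bigr => x _; rewrite mulrA.
have Rep_sum J (s : seq J) (c : J -> C) (f : J -> V -> C) :
    (forall j, Rep (f j)) -> Rep (fun u => \sum_(j <- s) c j * f j u).
  move=> h; elim: s => [|j s IH].
    by apply: Rep_ext Rep0 => u _; rewrite big_nil.
  by apply: Rep_ext (RepD _ _ (RepZ (c j) _ (h j)) IH) => u _; rewrite big_cons.
have RepF p l m j : Rep (@F p l m j).
  exists [:: (1, existT (fun pl : 'I_n * nat => ('I_(mult pl.1 pl.2) * 'I_(d pl.1))%type) (p, l) (m, j))].
  by move=> u _; rewrite big_seq1 mul1r.
have RepR l h : RV l h -> Rep (fun u => rc (h u)).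
  move=> hV.
  apply: (Rep_ext _ (fun u => \sum_(k : 'I_n) 1 * (\sum_(i : 'I_(d k)) 1 * rc (proj rot k i i h u)))).
    move=> u _; rewrite -[in LHS](proj_sum rot I h u) rmorph_sum; apply: eq_bigr => k _.
    by rewrite mul1r rmorph_sum; apply: eq_bigr => i _; rewrite mul1r.
  apply: (Rep_sum _ _ _ _ _) => k; apply: (Rep_sum _ _ _ _ _) => i.
  have [_ _ /(_ (proj rot k (idx0 k) i h))] := hT k l.
  case; first exact: proj_RV.
  move=> c hc.
  apply: (Rep_ext _ (fun u => \sum_(a < mult k l) rc (c a) * @F k l a i u)).
    move=> u Su; transitivity (rc (proj rot k i (idx0 k) (proj rot k (idx0 k) (idx0 k)
        (proj rot k (idx0 k) i h)) u)).
      rewrite proj_same eqxx mul1r; congr rc.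
      by rewrite proj_same eqxx mul1r.
    rewrite (proj_ext rot_orth _ _ hc)// proj_suml rmorph_sum; apply: eq_bigr => a _.
    by rewrite rmorphM.
  by apply: (Rep_sum _ _ _ _ _) => a.
have RepV l h : Vl l h -> Rep h.
  move=> hV.
  have h1 := RepR _ _ (Vl_Re hV); have h2 := RepZ (Complex 0 1) _ (RepR _ _ (Vl_Im hV)).
  apply: Rep_ext (RepD _ _ h1 h2) => u _.
  by apply: complex_eq; rewrite ?(cReD, cImD, cReM, cImM) /=; ring.
apply: (inhabits (@AdmissibleRealBasis R gT G rot n d (@CGamma R gT G I) _ _ _ _ mult F _ _ _ _ _)).
- exact: CGamma_irr.
- exact: CGamma_inequiv.
- exact: CGamma_exhaust.
- exact: CGamma_unitary.
- by move=> p l m j; exact: FV.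
- by move=> p l m j u _; rewrite realE lecR; case: (leP 0 (FR _ _ _ _ _)) => //= h; rewrite -(rmorph0 rc) lecR ltW// orbT.
- move=> [[p l] [m j]] [[p' l'] [m' j']] /=.
  rewrite (_ : sphere_integral _ = rc (rip (@FR p l m j) (@FR p' l' m' j'))); last first.
    rewrite -cint_rc; apply: eq_cint => u _.
    by rewrite rmorphM.
  have [E|ne] := eqVneq (p, l) (p', l'); last first.
    have -> : (existT _ (p, l) (m, j) == existT _ (p', l') (m', j') :> bi) = false.
      by apply/eqP => /(congr1 tag)/= E; rewrite E eqxx in ne.
    have [ll|ll] := eqVneq l l'; last first.
      by rewrite (RV_orth ll (FV _ _ _ _) (FV _ _ _ _)).
    have pp : p != p' by apply: contraNneq ne => ->; rewrite ll.
    rewrite /FR (proj_adj rot_orth _ _ (TV _ _ _) (proj_RV rot_orth _ _ (TV _ _ _))).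
    rewrite (eq_rip (fun u _ => erefl _) (fun u _ => proj_diff rot _ _ _ _ _ u pp)).
    by rewrite /rip (@eq_avg _ _ (fun u => 0 * mprod [::] u)) ?avgZ ?mul0r//;
      [exact: polyfun_mprod|move=> u _; rewrite mulr0 mul0r].
  case: E => pp ll; subst p' l'; rewrite eq_Tagged /= xpair_eqE.
  rewrite /FR (proj_adj rot_orth _ _ (TV _ _ _) (proj_RV rot_orth _ _ (TV _ _ _))).
  have [QT oT _] := hT p l.
  have E u : S2 u -> proj rot p (idx0 p) j (proj rot p j' (idx0 p) (T (p, l) m')) u =
      (j == j')%:R * T (p, l) m' u + 0 * T (p, l) m' u.
    move=> Su; rewrite proj_same mul0r addr0; congr (_ * _).
    by case: (QT m') => _; apply.
  rewrite ripC (eq_rip E (fun u _ => erefl _)) (rip_lin _ _ (TV p l m') (TV p l m') (TV p l m)).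
  rewrite oT// mul0r addr0 -natrM mulnb rmorph_nat andbC.
  by congr ((_ && _)%:R); rewrite eq_sym.
- move=> p l m g u Gg Su; apply/matrixP => j z; rewrite ord1 rinvE// mxE [RHS]mxE.
  rewrite /F /FR proj_equiv// rmorph_sum; apply: eq_bigr => a _.
  by rewrite !mxE rmorphM.
- move=> f fL2 e e0.
  have [L [g [gL hg]]] := cpf_dense fL2 e0.
  have [h [hV hh]] := cpf_Ysp gL.
  have [r hr] : Rep g.
    apply: (Rep_ext _ (fun u => \sum_(l < L.+1) 1 * h l u)).
      by move=> u Su; rewrite hh//; apply: eq_bigr => l _; rewrite mul1r.
    by apply: (Rep_sum _ _ _ _ _) => l; exact: RepV (hV l).
  exists (undup [seq x.2 | x <- r]), (fun b => \sum_(x <- r | x.2 == b) x.1).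
  apply: le_lt_trans hg; rewrite le_eqVlt; apply/orP; left; apply/eqP.
  apply: eq_integral => u; rewrite inE => Su; congr (_%:E); congr (ComplexField.Normc.normc _ ^+ 2).
  congr (_ - _); rewrite hr//.
  under eq_bigr do rewrite mulr_suml.
  rewrite (exchange_big_dep xpredT)//= big_seq [RHS]big_seq; apply: eq_bigr => x xr.
  rewrite (eq_bigr (fun=> x.1 * Fb x.2 u)); last by move=> b /eqP <-.
  rewrite big_const_seq (eq_count (a2 := pred1 x.2)); last by move=> b /=; rewrite eq_sym.
  by rewrite count_uniq_mem ?undup_uniq// mem_undup map_f //= addr0.
Qed.

End Existence.

(** * Exact arithmetic and tables of rotations *)

(** Z[phi] with phi ^ 2 = phi + 1; (a, b) stands for a + b phi. *)
Definition gold := (Z * Z)%type.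
Definition gadd (x y : gold) : gold := (Z.add x.1 y.1, Z.add x.2 y.2).
Definition gopp (x : gold) : gold := (Z.opp x.1, Z.opp x.2).
Definition gmul (x y : gold) : gold :=
  let: p := Z.mul x.2 y.2 in
  (Z.add (Z.mul x.1 y.1) p, Z.add (Z.add (Z.mul x.1 y.2) (Z.mul x.2 y.1)) p).
Definition gnat (n : nat) : gold := (Z.of_nat n, Z0).
(** The Galois conjugation phi |-> 1 - phi. *)
Definition gconj (x : gold) : gold := (Z.add x.1 x.2, Z.opp x.2).

Definition gsum3 (f : nat -> gold) : gold := gadd (gadd (f 0) (f 1)) (f 2).
Definition gvec := seq gold.
Definition gmat := seq gvec.
Definition gv (w : gvec) i : gold := nth (gnat 0) w i.
Definition ge (A : gmat) i j : gold := gv (nth [::] A i) j.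
Definition vec3 (f : nat -> gold) : gvec := [:: f 0; f 1; f 2].
Definition mat3 (f : nat -> nat -> gold) : gmat := [:: vec3 (f 0); vec3 (f 1); vec3 (f 2)].
Definition gtr (A : gmat) : gmat := mat3 (fun i j => ge A j i).
Definition gmm (A B : gmat) : gmat := mat3 (fun i j => gsum3 (fun k => gmul (ge A i k) (ge B k j))).
Definition gmv (A : gmat) (w : gvec) : gvec := vec3 (fun i => gsum3 (fun k => gmul (ge A i k) (gv w k))).
Definition gip (v w : gvec) : gold := gsum3 (fun k => gmul (gv v k) (gv w k)).
Definition gscale (c : gold) (A : gmat) : gmat := mat3 (fun i j => gmul c (ge A i j)).
Definition gvscale (c : gold) (w : gvec) : gvec := vec3 (fun i => gmul c (gv w i)).
Definition gplus (A B : gmat) : gmat := mat3 (fun i j => gadd (ge A i j) (ge B i j)).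
Definition gscal (c : gold) : gmat := mat3 (fun i j => if i == j then c else gnat 0).
Definition gfrob (A B : gmat) : gold := gsum3 (fun i => gsum3 (fun j => gmul (ge A i j) (ge B i j))).
Definition gcross (v w : gvec) : gvec :=
  let c i j := gadd (gmul (gv v i) (gv w j)) (gopp (gmul (gv v j) (gv w i))) in
  [:: c 1%N 2%N; c 2%N 0%N; c 0%N 1%N].
(** The triple product of the rows. *)
Definition gdet (A : gmat) : gold := gip (nth [::] A 0) (gcross (nth [::] A 1) (nth [::] A 2)).
Definition gmapm (f : gold -> gold) (A : gmat) : gmat := mat3 (fun i j => f (ge A i j)).

Section Evaluation.
Variable R : realType.

Definition phi : R := (1 + Num.sqrt 5) / 2.

Lemma phi2 : phi * phi = phi + 1.
Proof.
have h : Num.sqrt 5 * Num.sqrt 5 = 5 :> R by rewrite -expr2 sqr_sqrtr.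
rewrite /phi; move: h; move: (Num.sqrt (5 : R)) => s h.
have -> : (1 + s) / 2 * ((1 + s) / 2) = (1 + 2 * s + s * s) / 4 by field.
by rewrite h; field.
Qed.

Definition zev (z : Z) : R := (int_of_Z z)%:~R.

Lemma zevD x y : zev (Z.add x y) = zev x + zev y.
Proof. by rewrite /zev (rmorphD int_of_Z) intrD. Qed.
Lemma zevM x y : zev (Z.mul x y) = zev x * zev y.
Proof. by rewrite /zev (rmorphM int_of_Z) intrM. Qed.
Lemma zevN x : zev (Z.opp x) = - zev x.
Proof. by rewrite /zev (rmorphN int_of_Z) mulrNz. Qed.
Lemma zev_nat n : zev (Z.of_nat n) = n%:R.
Proof. by rewrite /zev -[Z.of_nat n]/(Z_of_int (Posz n)) Z_of_intK. Qed.

Definition gev (x : gold) : R := zev x.1 + zev x.2 * phi.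

Lemma gevD x y : gev (gadd x y) = gev x + gev y.
Proof. by rewrite /gev !zevD; ring. Qed.
Lemma gevN x : gev (gopp x) = - gev x.
Proof. by rewrite /gev !zevN; ring. Qed.
Lemma gevM x y : gev (gmul x y) = gev x * gev y.
Proof.
rewrite /gev /= !(zevD, zevM).
have -> : (zev x.1 + zev x.2 * phi) * (zev y.1 + zev y.2 * phi) =
  zev x.1 * zev y.1 + (zev x.1 * zev y.2 + zev x.2 * zev y.1) * phi +
  zev x.2 * zev y.2 * (phi * phi) by ring.
by rewrite phi2; ring.
Qed.
Lemma gev_nat n : gev (gnat n) = n%:R.
Proof. by rewrite /gev zev_nat (_ : zev Z0 = 0)// mul0r addr0. Qed.

(** The irrationality of sqrt 5, by counting factors 5. *)
Lemma sqr_eq_5sqr (a b : int) : a * a = 5 * (b * b) -> b = 0.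
Proof.
move=> h; apply/eqP; rewrite -absz_eq0; apply: contraT => b0.
have hn : (absz a * absz a = 5 * (absz b * absz b))%N.
  by rewrite -!abszM h !abszM.
have bp : (0 < absz b)%N by rewrite lt0n.
have a0 : (0 < absz a)%N.
  by move: hn bp; case: (absz a) (absz b) => // -[].
have := congr1 (logn 5) hn; rewrite !lognM ?muln_gt0 ?bp//.
have -> : logn 5 5 = 1%N by [].
by lia.
Qed.

(** Otherwise sqrt 5 would be rational. *)
Lemma gev_eq0 x : gev x = 0 -> x = (Z0, Z0).
Proof.
case: x => a b; rewrite /gev /= => h.
have h5 : (Num.sqrt 5 : R) * Num.sqrt 5 = 5 by rewrite -expr2 sqr_sqrtr.
pose A := int_of_Z a; pose B := int_of_Z b.
have hs : B%:~R * Num.sqrt 5 = - (2 * A + B)%:~R :> R.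
  rewrite intrD intrM; move: h; rewrite /zev /phi -/A -/B.
  move: (A%:~R) (B%:~R) (Num.sqrt (5 : R)) => x y s h.
  have -> : y * s = 2 * (x + y * ((1 + s) / 2)) - 2 * x - y by field.
  by rewrite h; ring.
have e : ((2 * A + B) * (2 * A + B))%:~R = (5 * (B * B))%:~R :> R.
  rewrite !intrM -mulrNN -hs.
  have -> : (B%:~R * Num.sqrt 5) * (B%:~R * Num.sqrt 5) = (Num.sqrt 5 * Num.sqrt 5) * (B%:~R * B%:~R) :> R by ring.
  by rewrite h5.
have B0 := sqr_eq_5sqr (@intr_inj R _ _ e).
have b0 : b = Z0 by rewrite -(int_of_ZK b) -/B B0.
have A0 : A = 0.
  apply: (@intr_inj R); move: h; rewrite /zev -/A -/B B0 mul0r addr0.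
  by [].
by rewrite b0 -(int_of_ZK a) -/A A0.
Qed.

Lemma gev_inj : injective gev.
Proof.
move=> x y h; have : gev (gadd x (gopp y)) = 0 by rewrite gevD gevN h subrr.
move/gev_eq0; case: x {h} => a b; case: y => c d [] /=.
by move=> h1 h2; congr (_, _); lia.
Qed.

Definition evv (w : gvec) : 'cV[R]_3 := \col_i gev (gv w i).
Definition evm (A : gmat) : 'M[R]_3 := \matrix_(i, j) gev (ge A i j).

Lemma gev_sum3 f : gev (gsum3 f) = \sum_(k < 3) gev (f k).
Proof. by rewrite /gsum3 !gevD sum3. Qed.

Lemma ge_mat3 f (i j : 'I_3) : ge (mat3 f) i j = f i j.
Proof. by elim/ord3_ind: i; elim/ord3_ind: j. Qed.
Lemma gv_vec3 f (i : 'I_3) : gv (vec3 f) i = f i.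
Proof. by elim/ord3_ind: i. Qed.

Lemma evm_mm A B : evm (gmm A B) = evm A *m evm B.
Proof.
apply/matrixP => i j; rewrite !mxE ge_mat3 gev_sum3; apply: eq_bigr => k _.
by rewrite gevM !mxE.
Qed.
Lemma evm_tr A : evm (gtr A) = (evm A)^T.
Proof. by apply/matrixP => i j; rewrite !mxE ge_mat3. Qed.
Lemma evm_scale c A : evm (gscale c A) = gev c *: evm A.
Proof. by apply/matrixP => i j; rewrite !mxE ge_mat3 gevM. Qed.
Lemma evm_plus A B : evm (gplus A B) = evm A + evm B.
Proof. by apply/matrixP => i j; rewrite !mxE ge_mat3 gevD. Qed.
Lemma evm_scal c : evm (gscal c) = (gev c)%:M.
Proof.
apply/matrixP => i j; rewrite !mxE ge_mat3 -val_eqE.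
by case: eqP => _; rewrite ?mulr1n// gev_nat mulr0n.
Qed.
Lemma evv_mv A w : evv (gmv A w) = evm A *m evv w.
Proof.
apply/matrixP => i j; rewrite !mxE gv_vec3 gev_sum3; apply: eq_bigr => k _.
by rewrite gevM !mxE.
Qed.
Lemma evv_scale c w : evv (gvscale c w) = gev c *: evv w.
Proof. by apply/matrixP => i j; rewrite !mxE gv_vec3 gevM. Qed.
Lemma gev_ip v w : gev (gip v w) = dot (evv v) (evv w).
Proof. by rewrite /gip gev_sum3; apply: eq_bigr => i _; rewrite gevM !mxE. Qed.

Lemma det2 (A : 'M[R]_2) : \det A = A 0 0 * A 1 1 - A 0 1 * A 1 0.
Proof.
rewrite (expand_det_row _ 0) !big_ord_recl big_ord0 addr0 /cofactor !det_mx11 !mxE /=.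
rewrite expr0 expr1 mul1r mulN1r mulrN.
by congr (A _ _ * A _ _ - A _ _ * A _ _); apply: val_inj.
Qed.

Lemma det3 (A : 'M[R]_3) : \det A =
  A 0 0 * (A 1 1 * A 2 2 - A 1 2 * A 2 1) + A 0 1 * (A 1 2 * A 2 0 - A 1 0 * A 2 2)
  + A 0 2 * (A 1 0 * A 2 1 - A 1 1 * A 2 0).
Proof.
rewrite (expand_det_row _ 0) sum3 /cofactor !det2 !mxE /=.
have l00 : lift 0 (0 : 'I_2) = 1 :> 'I_3 by exact: val_inj.
have l01 : lift 0 (1 : 'I_2) = 2 :> 'I_3 by exact: val_inj.
have l10 : lift 1 (0 : 'I_2) = 0 :> 'I_3 by exact: val_inj.
have l11 : lift 1 (1 : 'I_2) = 2 :> 'I_3 by exact: val_inj.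
have l20 : lift 2 (0 : 'I_2) = 0 :> 'I_3 by exact: val_inj.
have l21 : lift 2 (1 : 'I_2) = 1 :> 'I_3 by exact: val_inj.
rewrite !l00 !l01 !l10 !l11 !l20 !l21 /=.
by rewrite expr0 expr1 -signr_odd /= expr0; ring.
Qed.

Lemma gev_det A : gev (gdet A) = \det (evm A).
Proof.
rewrite /gdet gev_ip /dot sum3 !mxE /gv /= -!/(gv _ _) !(gevD, gevN, gevM) det3 !mxE /ge.
by ring.
Qed.

(** Lists obtained by mat3; on these, equality is equality of entries. *)
Definition gwf (A : gmat) := gmapm id A == A.

Lemma evm_inj A B : gwf A -> gwf B -> evm A = evm B -> A = B.
Proof.
move=> /eqP<- /eqP<- /matrixP h.
have e (i j : 'I_3) : ge A i j = ge B i j.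
  by have := h i j; rewrite !mxE !ge_mat3; exact: gev_inj.
by rewrite /gmapm /mat3 /vec3 (e 0 0) (e 0 1) (e 0 2) (e 1 0) (e 1 1) (e 1 2)
  (e 2 0) (e 2 1) (e 2 2).
Qed.

Lemma gwf_mat3 f : gwf (mat3 f).
Proof. exact: eqxx. Qed.

Definition cross (v w : 'cV[R]_3) : 'cV[R]_3 :=
  \col_i (v (i + 1) 0 * w (i + 2) 0 - v (i + 2) 0 * w (i + 1) 0).

Let add3 : (0 + 1 = 1 :> 'I_3) * (1 + 1 = 2 :> 'I_3) * (2 + 1 = 0 :> 'I_3) *
  (0 + 2 = 2 :> 'I_3) * (1 + 2 = 0 :> 'I_3) * (2 + 2 = 1 :> 'I_3).
Proof. by do !split; exact: val_inj. Qed.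

Lemma evv_cross v w : evv (gcross v w) = cross (evv v) (evv w).
Proof.
apply/matrixP => i j; rewrite !mxE; elim/ord3_ind: i;
  by rewrite ?add3 /gv /= -!/(gv _ _) !(gevD, gevN, gevM).
Qed.

Definition rows3 (u v w : 'cV[R]_3) : 'M[R]_3 :=
  \matrix_(i, j) [:: u j 0; v j 0; w j 0]`_i.

Lemma det_rows3 u v w : \det (rows3 u v w) = dot (cross u v) w.
Proof.
rewrite det3 /dot sum3 !mxE /=.
rewrite !add3.
by ring.
Qed.

Lemma rows3_mul (A : 'M[R]_3) u v w :
  rows3 (A *m u) (A *m v) (A *m w) = rows3 u v w *m A^T.
Proof.
apply/matrixP => i j; rewrite !mxE.
under [RHS]eq_bigr do rewrite !mxE.
by elim/ord3_ind: i; rewrite /= ?mxE; apply: eq_bigr => k _; rewrite mulrC.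
Qed.

Lemma dot_orth (A : 'M[R]_3) u v : orth A -> dot (A *m u) (A *m v) = dot u v.
Proof. by move=> oA; rewrite dot_mulmx mulmxA (mulmx1C oA) mul1mx. Qed.

(** The third column of a rotation is the cross product of the first two, so a
    rotation is determined by the images of two independent vectors. *)
Lemma rotation_eq1 (A : 'M[R]_3) u v : orth A -> \det A = 1 ->
  A *m u = u -> A *m v = v -> cross u v != 0 -> A = 1%:M.
Proof.
move=> oA dA Au Av x0; set x := cross u v in x0 *.
have dxx : dot x x != 0.
  apply: contraNneq x0; rewrite /dot sum3 => h; apply/eqP/matrixP => i j.
  rewrite ord1 [RHS]mxE; move: h; elim/ord3_ind: i; nra.
have Ax : A *m x = x.
  have h1 : dot x (A *m x) = dot x x.
    have := rows3_mul A u v x; rewrite Au Av => /(congr1 determinant).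
    by rewrite det_mulmx det_tr dA mulr1 !det_rows3.
  have h2 : dot (A *m x) (A *m x) = dot x x.
    exact: dot_orth.
  have h3 : dot (A *m x - x) (A *m x - x) = 0.
    have -> : dot (A *m x - x) (A *m x - x) =
      dot (A *m x) (A *m x) - 2 * dot x (A *m x) + dot x x.
      by rewrite /dot !sum3 !mxE; ring.
    by rewrite h1 h2; ring.
  apply/eqP; rewrite -subr_eq0; apply/eqP; move: h3; set y := A *m x - x => h3.
  apply/matrixP => i j; rewrite ord1 [RHS]mxE.
  by move: h3; rewrite /dot sum3; elim/ord3_ind: i => h3; nra.
have uN : rows3 u v x \in unitmx by rewrite unitmxE det_rows3 unitfE.
have := rows3_mul A u v x; rewrite Au Av Ax => /(congr1 (mulmx (invmx (rows3 u v x)))).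
by rewrite mulKmx// mulVmx// => /esym/(congr1 trmx); rewrite trmxK trmx1.
Qed.

End Evaluation.

Definition gpairs (vl : seq gvec) (c : gold) : seq (gvec * gvec) :=
  [seq p <- [seq (w1, w2) | w1 <- vl, w2 <- vl] | gip p.1 p.2 == c].

Section VertexTables.
Variables (vl : seq gvec) (v1 v2 : gvec) (el : gvec * gvec -> gmat).

(** Under rot_table_ok, twice the rotations that permute vl, one for each pair of vertices in the
    same relative position as v1 and v2; the factor 2 keeps the entries in
    Z[phi]. *)
Definition rot_table := map el (gpairs vl (gip v1 v2)).

Definition rot_table_ok :=
  [&& v1 \in vl, v2 \in vl, gcross v1 v2 != vec3 (fun=> gnat 0), uniq rot_table,
    all (fun p => (gmv (el p) v1 == gvscale (gnat 2) p.1) &&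
                  (gmv (el p) v2 == gvscale (gnat 2) p.2)) (gpairs vl (gip v1 v2)) &
    all (fun M => [&& gwf M, gmm M (gtr M) == gscal (gnat 4), gdet M == gnat 8,
      gtr M \in rot_table &
      all (fun w => gmv M w \in map (gvscale (gnat 2)) vl) vl]) rot_table].

Variable R : realType.
Variable V0 : set 'cV[R]_3.
Hypothesis tableP : rot_table_ok.
Hypothesis V0P : forall v, V0 v <-> exists2 w, w \in vl & v = evv R w.

Lemma table_facts M : M \in rot_table ->
  [/\ gwf M, gmm M (gtr M) = gscal (gnat 4), gdet M = gnat 8, gtr M \in rot_table &
    forall w, w \in vl -> exists2 w', w' \in vl & gmv M w = gvscale (gnat 2) w'].
Proof.
move: tableP => /andP[_ /and5P[_ _ _ _ /allP h]] /h /and5P[h1 /eqP h2 /eqP h3 h4 /allP h5].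
by split=> // w /h5 /mapP[w' w1 w2]; exists w'.
Qed.

(** A symmetry A sends v1, v2 to vertices w1, w2 with the same scalar product.
    The table entry for (w1, w2) agrees with A on v1 and v2, and so equals A
    by rotation_eq1. *)
Lemma rotational_symmetriesP A :
  rotational_symmetries V0 A <-> exists2 M, M \in rot_table & evm R M = 2 *: A.
Proof.
have n2 : (2 : R) != 0 by rewrite pnatr_eq0.
split=> [[oA dA AV]|[M Mt e]].
- have AV0 w : w \in vl -> exists2 w', w' \in vl & A *m evv R w = evv R w'.
    move=> wv; apply/V0P; rewrite -AV; exists (evv R w) => //; apply/V0P.
    by exists w.
  move: tableP => /andP[v1l /and5P[v2l cr _ /allP hp _]].
  have [w1 w1l e1] := AV0 _ v1l.
  have [w2 w2l e2] := AV0 _ v2l.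
  have ip12 : gip w1 w2 = gip v1 v2.
    by apply: (@gev_inj R); rewrite !gev_ip -e1 -e2 dot_orth.
  have pin : (w1, w2) \in gpairs vl (gip v1 v2).
    rewrite mem_filter /= ip12 eqxx; apply/allpairsP.
    by exists (w1, w2).
  pose M := el (w1, w2).
  have Mt : M \in rot_table by exact: map_f.
  exists M => //.
  have [_ h2 h3 _ _] := table_facts Mt.
  have /andP[/= /eqP k1 /eqP k2] := hp _ pin.
  pose B : 'M[R]_3 := 2^-1 *: evm R M.
  have oB : orth B.
    rewrite /orth /B linearZ /= -scalemxAl -scalemxAr scalerA -evm_tr -evm_mm h2.
    by rewrite evm_scal gev_nat scale_scalar_mx; congr (_%:M); field.
  have dB : \det B = 1.
    by rewrite /B detZ -gev_det h3 gev_nat; field.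
  have Bv1 : B *m evv R v1 = A *m evv R v1.
    by rewrite /B -scalemxAl -evv_mv k1 evv_scale gev_nat scalerA mulVf// scale1r e1.
  have Bv2 : B *m evv R v2 = A *m evv R v2.
    by rewrite /B -scalemxAl -evv_mv k2 evv_scale gev_nat scalerA mulVf// scale1r e2.
  have oBB : B^T *m B = 1%:M by exact: mulmx1C.
  have : B^T *m A = 1%:M.
    apply: (@rotation_eq1 _ _ (evv R v1) (evv R v2)).
    + by rewrite /orth trmx_mul trmxK mulmxA -[_ *m A *m A^T]mulmxA oA mulmx1.
    + by rewrite det_mulmx det_tr dB dA mulr1.
    + by rewrite -mulmxA -Bv1 mulmxA oBB mul1mx.
    + by rewrite -mulmxA -Bv2 mulmxA oBB mul1mx.
    + apply: contraNneq cr => h0; apply/eqP.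
      have e0 (i : 'I_3) : gv (gcross v1 v2) i = gnat 0.
        apply: (@gev_inj R); rewrite gev_nat.
        by have := congr1 (fun x : 'cV_3 => x i 0) h0; rewrite -evv_cross !mxE.
      exact: (f_equal3 (fun a b c => [:: a; b; c]) (e0 0) (e0 1) (e0 2)).
  move/(congr1 (mulmx B)); rewrite mulmxA oB mul1mx mulmx1 => ->.
  by rewrite /B scalerA mulfV// scale1r.
- have [_ h2 h3 ht hv] := table_facts Mt.
  have oA : A *m A^T = 1%:M.
    have : evm R M *m (evm R M)^T = 4%:M.
      by rewrite -evm_tr -evm_mm h2 evm_scal gev_nat.
    rewrite e linearZ /= -scalemxAl -scalemxAr scalerA => h.
    have : 4^-1 *: ((2 * 2) *: (A *m A^T)) = 4^-1 *: (4%:M : 'M[R]_3) by rewrite h.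
    rewrite scalerA scale_scalar_mx mulVf ?pnatr_eq0//.
    by rewrite (_ : 4^-1 * (2 * 2) = 1) ?scale1r//; field.
  have act N B w : N \in rot_table -> evm R N = 2 *: B -> w \in vl ->
      exists2 w', w' \in vl & B *m evv R w = evv R w'.
    move=> Nt eN wl; have [_ _ _ _ /(_ w wl)[w' w'l e']] := table_facts Nt.
    exists w' => //; apply: (scalerI n2).
    by rewrite scalemxAl -eN -evv_mv e' evv_scale gev_nat.
  split=> //.
    have : \det (evm R M) = 8 by rewrite -gev_det h3 gev_nat.
    rewrite e detZ => h; apply: (@mulfI _ (8 : R)); first by rewrite pnatr_eq0.
    by rewrite mulr1 -[RHS]h; ring.
  apply/seteqP; split=> [_ [v /V0P[w wl ->] <-]|v /V0P[w wl ->]].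
    by apply/V0P; have [w' w'l ->] := act _ _ _ Mt e wl; exists w'.
  have eT : evm R (gtr M) = 2 *: A^T by rewrite evm_tr e linearZ.
  have [w' w'l ew] := act _ _ _ ht eT wl.
  exists (evv R w'); first by apply/V0P; exists w'.
  by rewrite -ew mulmxA oA mul1mx.
Qed.

End VertexTables.

(** * Rotation groups of the cube, the tetrahedron and the icosahedron *)

Section TableOfGroup.
Variables (R : realType) (gT : finGroupType) (G : {group gT}).
Variables (rot : mx_representation R G 3) (V0 : set 'cV[R]_3).
Variables (vl : seq gvec) (v1 v2 : gvec) (el : gvec * gvec -> gmat).
Local Notation table := (rot_table vl v1 v2 el).
Hypothesis tableP : rot_table_ok vl v1 v2 el.
Hypothesis V0P : forall v, V0 v <-> exists2 w, w \in vl & v = evv R w.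

(** Q carries the standard polyhedron to the given one, up to scale; tab g is
    twice the matrix of g in the frame Q. *)
Record table_of (Q : 'M[R]_3) (tab : gT -> gmat) := TableOf {
  tab_orth : orth Q;
  tab_rot_orth : forall g, g \in G -> orth (rot g);
  tab_faithful : {in G &, injective rot};
  tab_in : forall g, g \in G -> tab g \in table;
  tab_ev : forall g, g \in G -> evm R (tab g) = 2 *: (Q^T *m rot g *m Q);
  tab_onto : forall M, M \in table -> exists2 g, g \in G & tab g = M }.

Lemma rotational_symmetries_copy c (Q A : 'M[R]_3) : 0 < c -> orth Q ->
  rotational_symmetries ((fun v => c *: (Q *m v)) @` V0) A <->
  rotational_symmetries V0 (Q^T *m A *m Q).
Proof.
move=> c0 oQ; have oQ' : Q^T *m Q = 1%:M by exact: mulmx1C.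
have QK (v : 'cV[R]_3) : Q *m (Q^T *m v) = v by rewrite mulmxA oQ mul1mx.
have QK' (v : 'cV[R]_3) : Q^T *m (Q *m v) = v by rewrite mulmxA oQ' mul1mx.
have cn : c != 0 by rewrite gt_eqF.
have dQ : \det Q * \det Q = 1 by rewrite -{2}det_tr -det_mulmx oQ det1.
have detE : \det (Q^T *m A *m Q) = \det A.
  by rewrite !det_mulmx det_tr mulrAC dQ mul1r.
have orthE : (Q^T *m A *m Q) *m (Q^T *m A *m Q)^T = Q^T *m (A *m A^T) *m Q.
  rewrite !trmx_mul trmxK !mulmxA; congr (_ *m _ *m _).
  by rewrite -mulmxA oQ mulmx1.
have cinj (u v : 'cV[R]_3) : c *: u = c *: v -> u = v by exact: scalerI.
split=> [[oA dA AV]|[oA dA AV]]; split.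
- by rewrite orthE oA mulmx1 oQ'.
- by rewrite detE.
- apply/seteqP; split=> [_ [v Vv <-]|v Vv].
    have : ((fun v => c *: (Q *m v)) @` V0) (A *m (c *: (Q *m v))).
      by rewrite -AV; exists (c *: (Q *m v)) => //; exists v.
    move=> [w Vw]; rewrite -scalemxAr => /cinj e.
    by rewrite -!mulmxA -e QK'.
  have : ((fun v => c *: (Q *m v)) @` V0) (c *: (Q *m v)) by exists v.
  rewrite -{1}AV => -[_ [w Vw <-]]; rewrite -scalemxAr => /cinj e.
  by exists w => //; rewrite -!mulmxA e QK'.
- have : Q *m (Q^T *m (A *m A^T) *m Q) *m Q^T = 1%:M by rewrite -orthE oA mulmx1 oQ.
  by rewrite !mulmxA oQ mul1mx -!mulmxA oQ !mulmx1.
- by rewrite -detE.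
- apply/seteqP; split=> [_ [_ [v Vv <-] <-]|_ [v Vv <-]].
    have : V0 (Q^T *m A *m Q *m v) by rewrite -AV; exists v.
    exists (Q^T *m A *m Q *m v) => //.
    by rewrite -!mulmxA QK scalemxAr.
  move: Vv; rewrite -{1}AV => -[w Vw <-].
  exists (c *: (Q *m w)); first by exists w.
  by rewrite -!mulmxA QK -scalemxAr.
Qed.

Lemma polyhedral_table : polyhedral_group V0 rot ->
  exists Q tab, table_of Q tab.
Proof.
move=> [faith [V [c [Q [c0 oQ ->]]] rotV]].
have sym A : (exists2 g, g \in G & rot g = A) <->
    exists2 M, M \in table & evm R M = 2 *: (Q^T *m A *m Q).
  rewrite -(rotational_symmetriesP tableP V0P) -(rotational_symmetries_copy _ c0 oQ).
  by rewrite -rotV.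
have inj : {in G &, injective rot} by exact: mx_faithful_inj.
have /choice[tab tabP] : forall g, exists M, g \in G ->
    M \in table /\ evm R M = 2 *: (Q^T *m rot g *m Q).
  move=> g; case: (boolP (g \in G)) => [Gg|]; last by exists [::].
  have [M Mt e] := (sym (rot g)).1 (ex_intro2 _ _ g Gg erefl).
  by exists M.
exists Q, tab; split=> // [g Gg|g Gg|g Gg|M Mt].
- have : rotational_symmetries ((fun v => c *: (Q *m v)) @` V0) (rot g).
    by rewrite -rotV; exists g.
  by case.
- by case: (tabP g Gg).
- by case: (tabP g Gg).
- have n2 : 2 != 0 :> R by rewrite pnatr_eq0.
  have oQ' : Q^T *m Q = 1%:M by exact: mulmx1C.
  have e : evm R M = 2 *: (Q^T *m (2^-1 *: (Q *m evm R M *m Q^T)) *m Q).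
    rewrite -scalemxAr -scalemxAl scalerA mulfV// scale1r !mulmxA oQ' mul1mx.
    by rewrite -mulmxA oQ' mulmx1.
  have [g Gg eg] := (sym _).2 (ex_intro2 _ _ M Mt e).
  exists g => //; have [tg eg'] := tabP g Gg.
  have [wM _ _ _ _] := table_facts tableP Mt.
  have [wg _ _ _ _] := table_facts tableP tg.
  by apply: (@evm_inj R) => //; rewrite eg' eg -e.
Qed.

Variables (Q : 'M[R]_3) (tab : gT -> gmat).
Hypothesis tabP : table_of Q tab.

Lemma tab_inj : {in G &, injective tab}.
Proof.
move=> g h Gg Gh e; apply: (tab_faithful tabP) => //.
have oQ := tab_orth tabP; have oQ' : Q^T *m Q = 1%:M by exact: mulmx1C.
have := tab_ev tabP Gg; rewrite e (tab_ev tabP Gh) => /(scalerI _) k.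
have {k} : Q^T *m rot h *m Q = Q^T *m rot g *m Q by apply: k; rewrite pnatr_eq0.
move/(congr1 (fun X => Q *m X *m Q^T)).
by rewrite !mulmxA oQ !mul1mx -!mulmxA oQ !mulmx1.
Qed.

Lemma card_tab : #|G| = size table.
Proof.
have ut : uniq table by move: tableP => /andP[_ /and5P[]].
rewrite cardE -(size_map tab); apply/perm_size/uniq_perm => //.
  rewrite map_inj_in_uniq ?enum_uniq// => g h; rewrite !mem_enum; exact: tab_inj.
move=> M; apply/mapP/idP => [[g]|Mt].
  by rewrite mem_enum => Gg ->; exact: (tab_in tabP).
by have [g Gg e] := tab_onto tabP Mt; exists g; rewrite ?mem_enum.
Qed.

Lemma tab_mul g h : g \in G -> h \in G ->
  gmm (tab g) (tab h) = gscale (gnat 2) (tab (g * h)%g).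
Proof.
move=> Gg Gh; apply: (@evm_inj R); rewrite ?gwf_mat3//.
rewrite evm_mm evm_scale gev_nat !(tab_ev tabP) ?groupM// repr_mxM//.
rewrite -scalemxAl -scalemxAr; congr (_ *: (_ *: _)).
have -> : Q^T *m rot g *m Q *m (Q^T *m rot h *m Q) =
   Q^T *m rot g *m (Q *m Q^T) *m rot h *m Q by rewrite !mulmxA.
by rewrite (tab_orth tabP) mulmx1 !mulmxA.
Qed.

Lemma tab_eq1 g : g \in G -> (tab g == gscal (gnat 2)) = (g == 1%g).
Proof.
move=> Gg; have t1 : tab 1%g = gscal (gnat 2).
  have [w1 _ _ _ _] := table_facts tableP (tab_in tabP (group1 G)).
  apply: (@evm_inj R) => //; rewrite evm_scal (tab_ev tabP)// gev_nat repr_mx1 mulmx1.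
  by rewrite (mulmx1C (tab_orth tabP)) scale_scalar_mx mulr1.
by rewrite -t1; apply/eqP/eqP => [/tab_inj->|->].
Qed.

End TableOfGroup.

Definition gsg (b : bool) : gold := if b then gopp (gnat 1) else gnat 1.
Definition gphi : gold := (Z0, Zpos xH).

Lemma gev_gsg (R : realType) b : gev R (gsg b) = (-1) ^+ b.
Proof. by case: b; rewrite /gsg ?gevN gev_nat ?expr1 ?expr0. Qed.

Lemma gev_phi (R : realType) : gev R gphi = phi R.
Proof. by rewrite /gev /zev /= add0r mul1r. Qed.

Definition frame (v w : gvec) : gmat := gtr [:: v; w; gcross v w].

(** When v and w are images of v1 and v2 under a rotation, that rotation is
    frame v w times the inverse of frame v1 v2, whose rows are cross products
    up to the determinant; mu / delta makes it twice the rotation. *)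
Definition frame_change (v1 v2 : gvec) (mu : gold) (delta : Z) (p : gvec * gvec) : gmat :=
  let: x := gcross v1 v2 in
  gmapm (fun c => (Z.div c.1 delta, Z.div c.2 delta))
    (gscale mu (gmm (frame p.1 p.2) [:: gcross v2 x; gcross x v1; x])).

Definition sign_vec (b : bool * bool * bool) : gvec :=
  [:: gsg b.1.1; gsg b.1.2; gsg b.2].

Definition bools := [:: false; true].

Definition cube_list : seq gvec :=
  [seq sign_vec (p, c) | p <- [seq (a, b) | a <- bools, b <- bools], c <- bools].
Definition tetra_list : seq gvec :=
  [seq sign_vec (p, addb p.1 p.2) | p <- [seq (a, b) | a <- bools, b <- bools]].
Definition icosa_vec (i : nat) (p : bool * bool) : gvec :=
  vec3 (fun k => if k == i then gnat 0 else
                 if k == (i + 1) %% 3 then gsg p.1 else gmul (gsg p.2) gphi)%N.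
Definition icosa_list : seq gvec :=
  [seq icosa_vec i p | i <- iota 0 3, p <- [seq (a, b) | a <- bools, b <- bools]].

Lemma mem_bools b : b \in bools. Proof. by case: b. Qed.

Lemma mem_pairs p : p \in [seq (a, b) | a <- bools, b <- bools].
Proof. by case: p => [[] []]. Qed.

Section Vertices.
Variable R : realType.

Lemma norm_sign (x y : R) : 0 < y -> `|x| = y -> exists b, x = gev R (gsg b) * y.
Proof.
move=> y0 h; case: (lerP 0 x) => x0.
  by exists false; rewrite gev_gsg mul1r -h ger0_norm.
by exists true; rewrite gev_gsg expr1 mulN1r -h ltr0_norm// opprK.
Qed.

Lemma cube_listP v : cube0 v <-> exists2 w, w \in cube_list & v = evv R w.
Proof.
split=> [h|[_ /allpairsP[[[a b] c] [_ _ ->]] -> i]].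
  have hs i := norm_sign ltr01 (h i).
  have [[a ea] [b eb] [c ec]] := And3 (hs 0) (hs 1) (hs 2).
  exists (sign_vec (a, b, c)).
    by apply/allpairsP; exists ((a, b), c); rewrite mem_pairs mem_bools.
  by apply/matrixP => i j; rewrite ord1 mxE; elim/ord3_ind: i; rewrite /= ?ea ?eb ?ec mulr1.
by rewrite mxE; elim/ord3_ind: i; rewrite /gv /= gev_gsg normrX normrN1 expr1n.
Qed.

Lemma tetra_listP v : tetrahedron0 v <-> exists2 w, w \in tetra_list & v = evv R w.
Proof.
have e a b c : evv R (sign_vec (a, b, c)) = col3 ((-1) ^+ a) ((-1) ^+ b) ((-1) ^+ c).
  by apply/matrixP => i j; rewrite !mxE; elim/ord3_ind: i; rewrite /gv /= gev_gsg.
split=> [|[_ /mapP[[a b] _ ->] ->]]; last first.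
  by rewrite e /tetrahedron0 /=; case: a; case: b; rewrite /= !(expr0, expr1); tauto.
have mem a b : sign_vec (a, b, addb a b) \in tetra_list.
  by apply: (map_f (fun p => sign_vec (p, addb p.1 p.2)) (mem_pairs (a, b))).
move=> [[[]|]|] ->.
- by exists (sign_vec (false, false, false)); rewrite ?e// (mem false false).
- by exists (sign_vec (false, true, true)); rewrite ?e// (mem false true).
- by exists (sign_vec (true, false, true)); rewrite ?e// (mem true false).
- by exists (sign_vec (true, true, false)); rewrite ?e// (mem true true).
Qed.

Lemma phi_gt0 : 0 < phi R.
Proof. by rewrite divr_gt0// ltr_wpDr// sqrtr_ge0. Qed.

Lemma evv_icosa (i j : 'I_3) p : evv R (icosa_vec i p) j 0 =
  if j == i then 0 else if j == i + 1 then gev R (gsg p.1) else gev R (gsg p.2) * phi R.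
Proof.
rewrite mxE gv_vec3 -gev_phi -gevM -val_eqE /=; case: eqP => _; first by rewrite gev_nat.
by elim/ord3_ind: i; elim/ord3_ind: j.
Qed.

Lemma icosa_listP v : icosahedron0 v <-> exists2 w, w \in icosa_list & v = evv R w.
Proof.
split=> [[i [v0 vn1 vn2]]|[_ /allpairsP[[i p] [/= il _ ->]] ->]].
  have [a ea] := norm_sign ltr01 vn1.
  have [b eb] := norm_sign phi_gt0 vn2.
  exists (icosa_vec i (a, b)).
    by apply/allpairsP; exists (nat_of_ord i, (a, b)); rewrite mem_pairs mem_iota /= ltn_ord.
  apply/matrixP => j k; rewrite ord1 evv_icosa {k} /=.
  case: eqP => [->//|ji]; case: eqP => [->|ji1]; first by rewrite ea mulr1.
  have -> : j = i + 2.
    move: ji ji1; elim/ord3_ind: i {v0 vn1 vn2 ea eb}; elim/ord3_ind: j => ji ji1;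
      by [exact: val_inj | case: ji; exact: val_inj | case: ji1; exact: val_inj].
  by [].
have i3 : (i < 3)%N by have := @mem_iota 0 3 i; rewrite il.
pose k := Ordinal i3; rewrite (_ : i = nat_of_ord k)//.
exists k; rewrite !evv_icosa; move: k => {il i3} k; split.
- by rewrite eqxx.
- rewrite eqxx (_ : (k + 1 == k) = false); last by elim/ord3_ind: k.
  by rewrite gev_gsg normrX normrN1 expr1n.
- rewrite (_ : (k + 2 == k) = false); last by elim/ord3_ind: k.
  rewrite (_ : (k + 2 == k + 1) = false); last by elim/ord3_ind: k.
  by rewrite normrM gev_gsg normrX normrN1 expr1n mul1r gtr0_norm// phi_gt0.
Qed.

End Vertices.

(** The determinant of the frame of v1 and v2 is 8 for the cube and for the
    tetrahedron, 4 phi^2 for the icosahedron, where 2 - phi is the inverse of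
    phi^2; in each case mu / delta is 2 divided by that determinant. *)
Definition cube_v1 := sign_vec (false, false, false).
Definition cube_v2 := sign_vec (false, false, true).
Definition cube_el := frame_change cube_v1 cube_v2 (gnat 1) 4.
Definition tetra_v2 := sign_vec (false, true, true).
Definition tetra_el := frame_change cube_v1 tetra_v2 (gnat 1) 4.
Definition icosa_v1 := icosa_vec 0 (false, false).
Definition icosa_v2 := icosa_vec 0 (true, false).
Definition icosa_el := frame_change icosa_v1 icosa_v2 (gadd (gnat 2) (gopp gphi)) 2.

Lemma cube_table_ok : rot_table_ok cube_list cube_v1 cube_v2 cube_el.
Proof. by vm_compute. Qed.

Lemma tetra_table_ok : rot_table_ok tetra_list cube_v1 tetra_v2 tetra_el.
Proof. by vm_compute. Qed.

Lemma icosa_table_ok : rot_table_ok icosa_list icosa_v1 icosa_v2 icosa_el.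
Proof. by vm_compute. Qed.

(** * Irreducible representations of the octahedral and icosahedral groups *)

Definition mip (R : realType) (X Y : 'M[R]_3) : R := \tr (X *m Y^T).

Section MatrixInnerProduct.
Variable R : realType.
Implicit Types X Y A B : 'M[R]_3.

Lemma mipC X Y : mip X Y = mip Y X.
Proof. by rewrite /mip -mxtrace_tr trmx_mul trmxK. Qed.
Lemma mipZr c X Y : mip X (c *: Y) = c * mip X Y.
Proof. by rewrite /mip linearZ /= -scalemxAr mxtraceZ. Qed.
Lemma mipZl c X Y : mip (c *: X) Y = c * mip X Y.
Proof. by rewrite mipC mipZr mipC. Qed.
Lemma mip_sumr X (I : finType) (F : I -> 'M[R]_3) : mip X (\sum_i F i) = \sum_i mip X (F i).
Proof. by rewrite /mip raddf_sum /= mulmx_sumr raddf_sum. Qed.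
Lemma mip_conj A B X Y : orth A -> orth B ->
  mip (A *m X *m B^T) (A *m Y *m B^T) = mip X Y.
Proof.
move=> oA oB; rewrite /mip !trmx_mul trmxK.
have -> : A *m X *m B^T *m (B *m (Y^T *m A^T)) = A *m (X *m (B^T *m B) *m Y^T *m A^T).
  by rewrite !mulmxA.
by rewrite (mulmx1C oB) mulmx1 mxtrace_mulC -!mulmxA (mulmx1C oA) mulmx1.
Qed.
End MatrixInnerProduct.

(** An invariant subspace of the action X |-> A(g) X B(g)^T on 3 x 3 matrices. *)
Section TensorRepresentation.
Variables (R : realType) (gT : finGroupType) (G : {group gT}).
Variables (A B : gT -> 'M[R]_3).
Hypothesis A1 : A 1%g = 1%:M.
Hypothesis B1 : B 1%g = 1%:M.
Hypothesis AM : {in G &, forall g h, A (g * h)%g = A g *m A h}.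
Hypothesis BM : {in G &, forall g h, B (g * h)%g = B g *m B h}.
Hypothesis oA : forall g, g \in G -> orth (A g).
Hypothesis oB : forall g, g \in G -> orth (B g).
Variables (d : nat) (b : 'I_d -> 'M[R]_3).
Hypothesis b_orth : forall s t, mip (b s) (b t) = (s == t)%:R.

Definition tensor_act g X := A g *m X *m (B g)^T.
Hypothesis b_inv : forall g t, g \in G ->
  tensor_act g (b t) = \sum_s mip (b s) (tensor_act g (b t)) *: b s.

Definition tensor_mx g : 'M[R]_d := \matrix_(s, t) mip (b s) (tensor_act g (b t)).

Lemma tensor_mx_repr : mx_repr G tensor_mx.
Proof.
split=> [|g h Gg Gh].
  apply/matrixP => s t; rewrite !mxE /tensor_act A1 B1 mul1mx trmx1 mulmx1.
  exact: b_orth.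
apply/matrixP => s t; rewrite !mxE.
have -> : tensor_act (g * h)%g (b t) = \sum_r mip (b r) (tensor_act h (b t)) *: tensor_act g (b r).
  transitivity (tensor_act g (tensor_act h (b t))).
    by rewrite /tensor_act AM// BM// trmx_mul !mulmxA.
  rewrite {1}b_inv// /tensor_act mulmx_sumr mulmx_suml; apply: eq_bigr => r _.
  by rewrite -scalemxAr -scalemxAl.
by rewrite mip_sumr; apply: eq_bigr => r _; rewrite mipZr !mxE mulrC.
Qed.

Definition tensor_repr := MxRepresentation tensor_mx_repr.

Lemma tensor_repr_orth g : g \in G -> tensor_repr g *m (tensor_repr g)^T = 1%:M.
Proof.
move=> Gg; apply: mulmx1C; apply/matrixP => s t; rewrite !mxE.
transitivity (mip (tensor_act g (b t)) (tensor_act g (b s))); last first.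
  by rewrite /tensor_act (mip_conj _ _ (oA Gg) (oB Gg)) b_orth eq_sym.
rewrite [X in mip _ X]b_inv// mip_sumr; apply: eq_bigr => r _.
by rewrite mipZr !mxE; congr (_ * _); rewrite mipC.
Qed.

End TensorRepresentation.

Definition gsum (s : seq nat) (F : nat -> gold) : gold :=
  foldr (fun i a => gadd (F i) a) (gnat 0) s.
Definition gmsum (s : seq nat) (F : nat -> gmat) : gmat :=
  foldr (fun i a => gplus (F i) a) (gscal (gnat 0)) s.

Section EvaluationSums.
Variable R : realType.

Lemma gev_sum n F : gev R (gsum (iota 0 n) F) = \sum_(i < n) gev R (F i).
Proof.
rewrite -[RHS](big_mkord xpredT (fun i => gev R (F i))) /index_iota subn0.
by elim: (iota 0 n) => [|i s IH]; rewrite ?big_nil ?gev_nat// big_cons -IH -gevD.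
Qed.

Lemma evm_sum n F : evm R (gmsum (iota 0 n) F) = \sum_(i < n) evm R (F i).
Proof.
rewrite -[RHS](big_mkord xpredT (fun i => evm R (F i))) /index_iota subn0.
elim: (iota 0 n) => [|i s IH]; last by rewrite big_cons -IH -evm_plus.
by rewrite big_nil -[gmsum _ _]/(gscal (gnat 0)) evm_scal gev_nat raddf0.
Qed.

Lemma gev_frob X Y : gev R (gfrob X Y) = mip (evm R X) (evm R Y).
Proof.
rewrite /gfrob gev_sum3 /mip /mxtrace; apply: eq_bigr => i _.
rewrite mxE gev_sum3; apply: eq_bigr => j _.
by rewrite gevM !mxE.
Qed.

End EvaluationSums.

(** ((a, b), basis): the action X |-> M X N^T on the span of the matrices of
    basis, where M (resp. N) is the rotation, or its twist tau when the flag a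
    (resp. b) is set.  A basis matrix with weight w has square norm 6 / w. *)
Definition tensor_spec := ((bool * bool) * seq (nat * gmat))%type.

Section SpecChecks.
Variables (table : seq gmat) (tau : gmat -> gmat).

Definition twist (f : bool) M := if f then tau M else M.

Section OneSpec.
Variable sp : tensor_spec.
Definition spec_dim := size sp.2.
Definition spec_w i := gnat (nth (0%N, [::]) sp.2 i).1.
Definition spec_b i := (nth (0%N, [::]) sp.2 i).2.
Definition spec_act M i :=
  gmm (gmm (twist sp.1.1 M) (spec_b i)) (gtr (twist sp.1.2 M)).
Definition spec_orth :=
  all (fun s => all (fun t => gmul (spec_w s) (gfrob (spec_b s) (spec_b t)) ==
    if s == t then gnat 6 else gnat 0) (iota 0 spec_dim)) (iota 0 spec_dim).
Definition spec_inv :=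
  all (fun M => all (fun t => let X := spec_act M t in
    gscale (gnat 6) X == gmsum (iota 0 spec_dim) (fun s =>
      gscale (gmul (spec_w s) (gfrob (spec_b s) X)) (spec_b s)))
    (iota 0 spec_dim)) table.
(** 24 times the trace in the orthonormal basis obtained from spec_b. *)
Definition spec_char M :=
  gsum (iota 0 spec_dim) (fun t => gmul (spec_w t) (gfrob (spec_b t) (spec_act M t))).
End OneSpec.

Variable specs : seq tensor_spec.
Local Notation nspec k := (nth (false, false, [::]) specs k).

(** The invariance of the given subspaces, and the two identities required by
    real_irreps. *)
Definition specs_ok :=
  [&& all (fun sp => [&& (0 < spec_dim sp)%N, spec_orth sp & spec_inv sp]) specs,
    all (fun M => gsum (iota 0 (size specs)) (fun k =>
        gmul (gnat (spec_dim (nspec k))) (spec_char (nspec k) M)) ==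
      if M == gscal (gnat 2) then gnat (24 * size table) else gnat 0) table &
    sumn [seq (spec_dim sp ^ 2)%N | sp <- specs] == size table].

End SpecChecks.

Section TableIrreps.
Variables (R : realType) (gT : finGroupType) (G : {group gT}).
Variables (rot : mx_representation R G 3).
Variables (vl : seq gvec) (v1 v2 : gvec) (el : gvec * gvec -> gmat).
Local Notation table := (rot_table vl v1 v2 el).
Hypothesis tableP : rot_table_ok vl v1 v2 el.
Variables (Q : 'M[R]_3) (tab : gT -> gmat).
Hypothesis tabP : table_of rot vl v1 v2 el Q tab.
Variables (tau : gmat -> gmat) (specs : seq tensor_spec).
Hypothesis tau_mul : {in table &, forall M N, gmm (tau M) (tau N) = tau (gmm M N)}.
Hypothesis tau_scale : {in table, forall M, tau (gscale (gnat 2) M) = gscale (gnat 2) (tau M)}.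
Hypothesis tau_orth : {in table, forall M, gmm (tau M) (gtr (tau M)) = gscal (gnat 4)}.
Hypothesis specsP : specs_ok table tau specs.

Definition half f g : 'M[R]_3 := 2^-1 *: evm R (twist tau f (tab g)).

Let n2 : (2 : R) != 0. Proof. by rewrite pnatr_eq0. Qed.

Lemma half_orth f g : g \in G -> orth (half f g).
Proof.
move=> Gg; rewrite /orth /half linearZ /= -scalemxAl -scalemxAr scalerA.
have -> : evm R (twist tau f (tab g)) *m (evm R (twist tau f (tab g)))^T = 4%:M.
  have tg := tab_in tabP Gg; rewrite -evm_tr -evm_mm.
  have -> : gmm (twist tau f (tab g)) (gtr (twist tau f (tab g))) = gscal (gnat 4).
    by case: f => /=; [exact: tau_orth|have [] := table_facts tableP tg].
  by rewrite evm_scal gev_nat.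
by rewrite scale_scalar_mx; congr (_%:M); field.
Qed.

Lemma halfM f : {in G &, forall g h, half f (g * h)%g = half f g *m half f h}.
Proof.
move=> g h Gg Gh; rewrite /half -scalemxAl -scalemxAr -evm_mm.
have -> : gmm (twist tau f (tab g)) (twist tau f (tab h)) =
    gscale (gnat 2) (twist tau f (tab (g * h)%g)).
  case: f; rewrite /= -?tau_scale ?(tab_in tabP) ?groupM//.
    by rewrite tau_mul ?(tab_in tabP)// (tab_mul tabP).
  exact: (tab_mul tabP).
by rewrite evm_scale gev_nat !scalerA; congr (_ *: _); field.
Qed.

Lemma half1 f : half f 1%g = 1%:M.
Proof.
have h := halfM f (group1 G) (group1 G); rewrite mulg1 in h.
have u : half f 1%g *m (half f 1%g)^T = 1%:M := half_orth f (group1 G).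
by have := congr1 (mulmx^~ (half f 1%g)^T) h; rewrite /= -mulmxA u mulmx1.
Qed.

Section OneSpecRep.
Variable sp : tensor_spec.
Hypothesis sp_in : sp \in specs.
Local Notation d := (spec_dim sp).

Let sp_ok : [&& (0 < d)%N, spec_orth sp & spec_inv table tau sp].
Proof. by move: specsP => /and3P[/allP h _ _]; exact: h. Qed.

Definition unit_b (t : 'I_d) : 'M[R]_3 :=
  Num.sqrt (gev R (spec_w sp t) / 6) *: evm R (spec_b sp t).

Lemma spec_w_sqr t : Num.sqrt (gev R (spec_w sp t) / 6) ^+ 2 = gev R (spec_w sp t) / 6.
Proof. by rewrite sqr_sqrtr// /spec_w gev_nat divr_ge0. Qed.

Lemma unit_b_orth s t : mip (unit_b s) (unit_b t) = (s == t)%:R.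
Proof.
have /and3P[_ /allP h _] := sp_ok.
have ins (r : 'I_d) : (r : nat) \in iota 0 d by rewrite mem_iota /= ltn_ord.
have /allP/(_ _ (ins t))/eqP := h _ (ins s).
move/(congr1 (gev R)); rewrite gevM gev_frob mipZl mipZr -val_eqE /= => {}h.
have /and3P[_ /allP h' _] := sp_ok.
have w0 (r : 'I_d) : gev R (spec_w sp r) != 0.
  have /allP/(_ _ (ins r))/eqP := h' _ (ins r).
  move/(congr1 (gev R)); rewrite gevM eqxx gev_nat => hr.
  by apply: contraPneq hr => ->; rewrite mul0r => /eqP; rewrite eq_sym pnatr_eq0.
case: eqP h => [st|_] h.
  have -> : s = t by exact: val_inj.
  rewrite mulrA -expr2 spec_w_sqr; move: h; rewrite gev_nat st => h.
  have -> : gev R (spec_w sp t) / 6 * mip (evm R (spec_b sp t)) (evm R (spec_b sp t)) =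
    gev R (spec_w sp t) * mip (evm R (spec_b sp t)) (evm R (spec_b sp t)) / 6 by field.
  by rewrite h divff// pnatr_eq0.
move: h; rewrite gev_nat => /eqP; rewrite mulf_eq0 (negbTE (w0 s)) /= => /eqP->.
by rewrite !mulr0.
Qed.

Local Notation act := (tensor_act (half sp.1.1) (half sp.1.2)).

Lemma act_unit_b g t : act g (unit_b t) =
  (Num.sqrt (gev R (spec_w sp t) / 6) / 4) *: evm R (spec_act tau sp (tab g) t).
Proof.
rewrite /tensor_act /half /unit_b /spec_act !evm_mm evm_tr.
have -> c (Y : 'M[R]_3) : (c *: Y)^T = c *: Y^T by rewrite linearZ.
rewrite -!(scalemxAl, scalemxAr) !scalerA; congr (_ *: _).
by field.
Qed.

Lemma unit_b_inv g t : g \in G ->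
  act g (unit_b t) = \sum_s mip (unit_b s) (act g (unit_b t)) *: unit_b s.
Proof.
move=> Gg; have /and3P[_ _ /allP h] := sp_ok.
have tin : (t : nat) \in iota 0 d by rewrite mem_iota /= ltn_ord.
have /allP/(_ _ tin)/eqP := h _ (tab_in tabP Gg).
move/(congr1 (evm R)); rewrite evm_scale evm_sum gev_nat => {}h.
have {}h : evm R (spec_act tau sp (tab g) t) = 6^-1 *: \sum_(s < d) evm R
    (gscale (gmul (spec_w sp s) (gfrob (spec_b sp s) (spec_act tau sp (tab g) t))) (spec_b sp s)).
  by rewrite -h scalerA mulVf ?scale1r// pnatr_eq0.
rewrite act_unit_b {1}h scalerA scaler_sumr; apply: eq_bigr => s _.
rewrite evm_scale gevM gev_frob mipZr mipZl scalerA /unit_b scalerA; congr (_ *: _).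
set X := mip _ _; have := spec_w_sqr s.
move: (Num.sqrt _) (Num.sqrt _) => y x hx.
have -> : y / 4 * (x * X) * x = x ^+ 2 * (y / 4 * X) by ring.
by rewrite hx; ring.
Qed.

Definition spec_repr : mx_representation R G d :=
  tensor_repr (half1 sp.1.1) (half1 sp.1.2) (@halfM sp.1.1) (@halfM sp.1.2)
    unit_b_orth unit_b_inv.

Lemma spec_repr_orth g : g \in G -> spec_repr g *m (spec_repr g)^T = 1%:M.
Proof. by apply: tensor_repr_orth => h Gh; exact: half_orth. Qed.

Lemma spec_repr_tr g : \tr (spec_repr g) = gev R (spec_char tau sp (tab g)) / 24.
Proof.
rewrite /mxtrace /spec_char gev_sum mulr_suml; apply: eq_bigr => t _.
rewrite mxE act_unit_b mipZr mipZl gevM gev_frob.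
have := spec_w_sqr t; move: (Num.sqrt _) => y hy.
set X := mip _ _; have -> : y / 4 * (y * X) = y ^+ 2 * X / 4 by ring.
by rewrite hy; field.
Qed.

End OneSpecRep.

Local Notation nspec k := (nth (false, false, [::]) specs k).

Lemma table_irreps : real_irreps R G.
Proof.
pose n := size specs.
have sin (k : 'I_n) : nspec k \in specs by exact: mem_nth.
have /and3P[/allP hs /allP hc /eqP hd] := specsP.
apply: (@RealIrreps R gT G n (fun k => spec_dim (nspec k)) (fun k => spec_repr (sin k))).
- by move=> k; have /and3P[] := hs _ (sin k).
- by move=> k g Gg; exact: spec_repr_orth.
- move=> g Gg; have := hc _ (tab_in tabP Gg).
  rewrite (tab_eq1 tableP tabP Gg) => /eqP/(congr1 (gev R)).
  rewrite gev_sum => h.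
  transitivity (gev R (if g == 1%g then gnat (24 * size table) else gnat 0) / 24).
    rewrite -h mulr_suml; apply: eq_bigr => k _.
    by rewrite spec_repr_tr gevM gev_nat mulrA.
  rewrite (card_tab tableP tabP); case: eqP => _; rewrite gev_nat ?natrM; last by rewrite !mul0r.
  rewrite [true%:R]mulr1n.
  by field.
- rewrite (card_tab tableP tabP) -hd; rewrite sumnE big_map.
  by rewrite (big_nth (false, false, [::])) big_mkord.
Qed.

End TableIrreps.

Definition mE i j c : gmat := mat3 (fun a b => if (a == i) && (b == j) then c else gnat 0).
Definition cyc3 : seq (nat * nat) := [:: (0, 1); (1, 2); (2, 0)]%N.

(** The trivial representation, or the sign representation when one factor
    is twisted by the sign. *)
Definition id_basis := [:: (2%N, gscal (gnat 1))].
(** The antisymmetric matrices, equivalent to vectors. *)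
Definition anti_basis :=
  [seq (3%N, gplus (mE p.1 p.2 (gnat 1)) (mE p.2 p.1 (gopp (gnat 1)))) | p <- cyc3].
Definition offdiag_basis :=
  [seq (3%N, gplus (mE p.1 p.2 (gnat 1)) (mE p.2 p.1 (gnat 1))) | p <- cyc3].
(** The diagonal matrices of trace 0. *)
Definition diag_basis :=
  [:: (3%N, gplus (mE 0 0 (gnat 1)) (mE 1 1 (gopp (gnat 1))));
      (1%N, gplus (gscal (gopp (gnat 1))) (mE 2 2 (gnat 3)))].
(** The span of these matrices is invariant under X |-> M X N^T for M an
    icosahedral rotation and N its Galois conjugate; it is the part of
    dimension 4 in the tensor product 4 + 5 of the two vector representations. *)
Definition golden_basis := id_basis ++
  [seq (2%N, gplus (mE p.1 p.2 gphi) (mE p.2 p.1 (gadd gphi (gopp (gnat 1))))) | p <- cyc3].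

Definition cube_table := rot_table cube_list cube_v1 cube_v2 cube_el.
Definition icosa_table := rot_table icosa_list icosa_v1 icosa_v2 icosa_el.

(** The sign of the permanent is the sign of the permutation underlying a
    signed permutation matrix. *)
Definition gperm (M : gmat) : gold :=
  let m i j k := gmul (ge M 0 i) (gmul (ge M 1 j) (ge M 2 k)) in
  gadd (gadd (gadd (m 0 1 2) (m 1 2 0)) (m 2 0 1))
       (gadd (gadd (m 0 2 1) (m 1 0 2)) (m 2 1 0))%N.
Definition sign_twist (M : gmat) : gmat := gscale (Z.sgn (gperm M).1, Z0) M.

Definition galois_twist (M : gmat) : gmat := gmapm gconj M.

(** Dimensions 1, 1, 2, 3, 3. *)
Definition cube_specs : seq tensor_spec :=
  [:: ((false, false), id_basis); ((false, true), id_basis);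
      ((false, false), diag_basis); ((false, false), anti_basis);
      ((false, false), offdiag_basis)].
(** Dimensions 1, 3, 3, 4, 5. *)
Definition icosa_specs : seq tensor_spec :=
  [:: ((false, false), id_basis); ((false, false), anti_basis);
      ((true, true), anti_basis); ((false, true), golden_basis);
      ((false, false), offdiag_basis ++ diag_basis)].

Lemma cube_specs_ok : specs_ok cube_table sign_twist cube_specs.
Proof. by vm_compute. Qed.

Lemma icosa_specs_ok : specs_ok icosa_table galois_twist icosa_specs.
Proof. by vm_compute. Qed.

Definition twist_ok (table : seq gmat) (tau : gmat -> gmat) :=
  all (fun M => (tau (gscale (gnat 2) M) == gscale (gnat 2) (tau M)) &&
    (gmm (tau M) (gtr (tau M)) == gscal (gnat 4))) table.

Lemma sign_twist_ok : twist_ok cube_table sign_twist.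
Proof. by vm_compute. Qed.

Lemma galois_twist_ok : twist_ok icosa_table galois_twist.
Proof. by vm_compute. Qed.

Lemma sign_twistM : all (fun M => all (fun N =>
  gmm (sign_twist M) (sign_twist N) == sign_twist (gmm M N)) cube_table) cube_table.
Proof. by vm_compute. Qed.

Lemma gconjD x y : gconj (gadd x y) = gadd (gconj x) (gconj y).
Proof. by rewrite /gconj /gadd /=; congr pair; lia. Qed.

Lemma gconjM x y : gconj (gmul x y) = gmul (gconj x) (gconj y).
Proof. by rewrite /gconj /gmul /=; congr pair; lia. Qed.

Lemma galois_twistM M N :
  gmm (galois_twist M) (galois_twist N) = galois_twist (gmm M N).
Proof.
by rewrite /galois_twist /gmapm /gmm /mat3 /vec3 /ge /gv /= /gsum3 /= !(gconjD, gconjM).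
Qed.

Lemma octahedral_irreps (R : realType) (gT : finGroupType) (G : {group gT})
  (rot : mx_representation R G 3) : is_octahedral rot -> inhabited (real_irreps R G).
Proof.
move=> /(polyhedral_table cube_table_ok (@cube_listP R))[Q [tab tabP]].
have /allP ok := sign_twist_ok; have /allP okM := sign_twistM.
constructor; apply: (table_irreps cube_table_ok tabP _ _ _ cube_specs_ok).
- by move=> M N Mt Nt; have /allP/(_ N Nt)/eqP := okM M Mt.
- by move=> M /ok/andP[/eqP].
- by move=> M /ok/andP[_ /eqP].
Qed.

Lemma icosahedral_irreps (R : realType) (gT : finGroupType) (G : {group gT})
  (rot : mx_representation R G 3) : is_icosahedral rot -> inhabited (real_irreps R G).
Proof.
move=> /(polyhedral_table icosa_table_ok (@icosa_listP R))[Q [tab tabP]].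
have /allP ok := galois_twist_ok.
constructor; apply: (table_irreps icosa_table_ok tabP _ _ _ icosa_specs_ok).
- by move=> M N _ _; exact: galois_twistM.
- by move=> M /ok/andP[/eqP].
- by move=> M /ok/andP[_ /eqP].
Qed.

Lemma octa_icosa_basis (R : realType) (gT : finGroupType) (G : {group gT})
    (rot : mx_representation R G 3) :
  is_octahedral rot \/ is_icosahedral rot -> inhabited (admissible_real_basis rot).
Proof.
by move=> [] h; [have [I] := octahedral_irreps h|have [I] := icosahedral_irreps h];
  apply: (real_irreps_basis I); [
  have [Q [tab []]] := polyhedral_table cube_table_ok (@cube_listP R) h |
  have [Q [tab []]] := polyhedral_table icosa_table_ok (@icosa_listP R) h].
Qed.

(** * The tetrahedral obstruction *)

Section L2OfPolynomials.
Variable R : realType.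
Local Notation V := 'cV[R]_3.
Local Notation C := R[i].
Local Notation rc := (@real_complex R).
Local Notation Re := (@complex.Re R).
Local Notation Im := (@complex.Im R).

Lemma normc_sqr (x : C) : ComplexField.Normc.normc x ^+ 2 = Re (Num.conj x * x).
Proof.
case: x => a b; rewrite /= sqr_sqrtr ?addr_ge0 ?sqr_ge0// /=.
by ring.
Qed.

Lemma polyfun_normc_sqr L (f : V -> C) : cpf L f -> polyfun (fun u => ComplexField.Normc.normc (f u) ^+ 2).
Proof.
move=> hf; rewrite (_ : (fun _ => _) = fun u => Re (Num.conj (f u) * f u)).
  by have [] := cpf_re_im (cpf_ip hf hf).
by apply/funext => u; rewrite normc_sqr.
Qed.

Lemma L2normsq_cpf L (f : V -> C) : cpf L f -> L2normsq f = (Re (ip f f))%:E.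
Proof.
move=> hf; have hp := polyfun_normc_sqr hf.
rewrite /ip cintE /= (@eq_avg _ _ (fun u => ComplexField.Normc.normc (f u) ^+ 2)); last first.
  by move=> u _; rewrite normc_sqr.
rewrite /avg /Rintegral fineK//.
apply: integrable_fin_num; first exact: measurable_S2.
exact: polyfun_integrable.
Qed.

Lemma cpf_L2 L (f : V -> C) : cpf L f -> in_L2 f.
Proof.
move=> hf; have [h1 h2] := cpf_re_im hf.
split; last by rewrite (L2normsq_cpf hf) ltry.
- have := polyfun_integrable h1 => /integrableP[+ _].
  by move/measurable_EFinP.
- have := polyfun_integrable h2 => /integrableP[+ _].
  by move/measurable_EFinP.
Qed.

Lemma ipDr L M N (f g h : V -> C) : cpf L f -> cpf M g -> cpf N h ->
  ip f (fun u => g u + h u) = ip f g + ip f h.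
Proof.
move=> hf hg hh; rewrite -(cintD (cpf_le (leq_maxl _ _) (cpf_ip hf hg))
  (cpf_le (leq_maxr _ _) (cpf_ip hf hh))).
by apply: eq_cint => u _; rewrite mulrDr.
Qed.

Lemma ipZr L M (f g : V -> C) c : cpf L f -> cpf M g ->
  ip f (fun u => c * g u) = c * ip f g.
Proof.
move=> hf hg; rewrite -(cintZ c (cpf_ip hf hg)).
by apply: eq_cint => u _; rewrite mulrCA.
Qed.

Lemma pythagoras L M (f g : V -> C) : cpf L f -> cpf M g -> ip f g = 0 ->
  ip (fun u => f u - g u) (fun u => f u - g u) = ip f f + ip g g.
Proof.
move=> hf hg fg.
have gf : ip g f = 0 by rewrite (ipC hf hg) fg rmorph0.
have hg' : cpf M (fun u => (-1) * g u) by exact: cpfZ.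
have hs : cpf (maxn L M) (fun u => f u + (-1) * g u).
  by apply: cpfD; [exact: cpf_le (leq_maxl _ _) hf|exact: cpf_le (leq_maxr _ _) hg'].
have e (u : V) : S2 u -> f u - g u = f u + (-1) * g u by rewrite mulN1r.
have conjN1 : Num.conj (-1 : C) = -1 by rewrite rmorphN1.
have gs : ip g (fun u => f u + (-1) * g u) = - ip g g.
  by rewrite (ipDr hg hf hg') gf (ipZr _ hg hg) mulN1r add0r.
have fs : ip f (fun u => f u + (-1) * g u) = ip f f.
  by rewrite (ipDr hf hf hg') (ipZr _ hf hg) fg mulr0 addr0.
rewrite (eq_ip e e) (ipDr hs hf hg') (ipZr _ hs hg).
rewrite (ipC hf hs) (ipC hg hs) gs fs -(ipC hf hf) rmorphN /= -(ipC hg hg).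
by rewrite mulN1r opprK.
Qed.

End L2OfPolynomials.

Section Obstruction.
Variables (R : realType) (gT : finGroupType) (G : {group gT}).
Variable rot : mx_representation R G 3.
Hypothesis rot_orth : forall g, g \in G -> orth (rot g).
Local Notation V := 'cV[R]_3.
Local Notation C := R[i].
Local Notation Re := (@complex.Re R).
Variables (F : V -> C) (L : nat) (chi : gT -> C).
Hypothesis cF : cpf L F.
Hypothesis F_neq0 : exists2 u, S2 u & F u != 0.
Hypothesis F_chi : forall g u, g \in G -> S2 u -> F (rot g *m u) = chi g * F u.
Hypothesis chi_nonreal : exists2 g, g \in G & chi g \isn't Num.real.

Variable B : admissible_real_basis rot.

Let cB (b : bindex B) : cpf (tag b).2 (basisFb b).
Proof.
case: b => -[p l] [n j] /=; apply: Vl_cpf; exact: basisF_harmonic.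
Qed.

Let rotV g : g \in G -> invmx (rot g) = (rot g)^T.
Proof.
move=> Gg; have h : rot g *m (rot g)^T = 1%:M := rot_orth Gg.
by rewrite -[LHS]mulmx1 -h mulKmx// repr_mx_unit.
Qed.

(** The components of F along the j-indexed functions form a row c with
    c Gamma(g) = conj (chi g) c.  If c were nonzero, irreducibility would make
    Gamma(g) scalar, and the real functions would satisfy
    f (R_g^-1 u) = conj (chi g) f u with conj (chi g) nonreal. *)
Lemma ip_basis0 (b : bindex B) : ip F (basisFb b) = 0.
Proof.
case: b => -[p l] [n j]; rewrite /basisFb /=.
pose Fb j := basisF (a := B) n j : V -> C.
pose c : 'rV[C]_(irrdim p) := \row_j ip F (Fb j).
have cFb j' : cpf l (Fb j') by exact: (cB (existT _ (p, l) (n, j'))).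
have equi g u j' : g \in G -> S2 u ->
    Fb j' (invmx (rot g) *m u) = \sum_i Gam p g i j' * Fb i u.
  move=> Gg Su; have := basisF_equivariant n Gg Su.
  move/matrixP => /(_ j' 0); rewrite !mxE => h; apply: etrans h _.
  by apply: eq_bigr => i _; rewrite !mxE.
have cG g : g \in G -> c *m Gam p g = Num.conj (chi g) *: c.
  move=> Gg; apply/rowP => j'; rewrite !mxE.
  have oT : orth (rot g)^T by apply: orth_tr; exact: rot_orth.
  have oG := rot_orth Gg.
  transitivity (ip F (fun u => Fb j' (invmx (rot g) *m u))).
    rewrite (eq_ip (fun u _ => erefl _) (fun u Su => equi g u j' Gg Su)).
    rewrite (ip_sumr _ _ cF cFb); apply: eq_bigr => i _.
    by rewrite !mxE mulrC.
  have cR : cpf l (fun u => Fb j' (invmx (rot g) *m u)).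
    by rewrite rotV//; exact: cpf_rot oT (cFb j').
  rewrite -(ip_rot oG cF cR).
  rewrite (eq_ip (fun u Su => F_chi Gg Su) (g' := Fb j')); last first.
    by move=> u _; rewrite mulKmx// repr_mx_unit.
  rewrite (ipC (cFb j') (cpfZ _ cF)) (ipZr _ (cFb j') cF) rmorphM /=.
  by rewrite -(ipC (cFb j') cF).
have [c0|c0] := eqVneq c 0.
  by move/rowP: c0 => /(_ j); rewrite !mxE.
have [_ _ s1] := Gam_irr p.
have full : (1%:M <= c)%MS.
  rewrite -(genmxE c); apply: s1; [|exact: submx1|by rewrite (eqmx_eq0 (genmxE c))].
  apply/mxmoduleP => g Gg.
  by rewrite (eqmxMr _ (genmxE c)) genmxE cG// scalemx_sub.
have [g Gg /negP[]] := chi_nonreal.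
have Gscal : Gam p g = (Num.conj (chi g))%:M.
  have [D eD] := submxP full; rewrite -[LHS]mul1mx eD.
  by rewrite -mulmxA cG// -scalemxAr -eD scalemx1.
have eqj u : S2 u -> Fb j (invmx (rot g) *m u) = Num.conj (chi g) * Fb j u.
  move=> Su; rewrite equi// Gscal (bigD1 j)//= big1 ?addr0.
    by rewrite mxE eqxx mulr1n.
  by move=> i ij; rewrite mxE (negbTE ij) mulr0n mul0r.
have [u Su Fu] : exists2 u, S2 u & Fb j u != 0.
  apply: contrapT => h.
  have z u : S2 u -> Fb j u * Fb j u = 0.
    move=> Su; have -> : Fb j u = 0 by apply/eqP; apply: contrapT => /negP k; apply: h; exists u.
    by rewrite mulr0.
  have := basisF_orthonormal (existT _ (p, l) (n, j) : bindex B) (existT _ (p, l) (n, j)).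
  rewrite eqxx (eq_cint (g := fun=> 0) z) cint0 => /eqP.
  by rewrite eq_sym oner_eq0.
have SA : S2 (invmx (rot g) *m u).
  by rewrite rotV//; apply: orth_S2 => //; apply: orth_tr; exact: rot_orth.
have r1 := basisF_real n j Su.
have r2 := basisF_real n j SA.
have : Num.conj (chi g) \is Num.real.
  have -> : Num.conj (chi g) = Fb j (invmx (rot g) *m u) / Fb j u by rewrite eqj// mulfK.
  by rewrite realM// realV.
by rewrite !CrealE conjCK eq_sym.
Qed.

(** By ip_basis0, F stays at distance at least its norm from every combination
    of basis functions. *)
Lemma no_admissible_basis : False.
Proof.
have F0 : 0 < ip F F.
  rewrite lt_def (ip_ge0 cF) andbT; apply/negP => /eqP z.
  by have [u Su /eqP[]] := F_neq0; apply: (Ysp_definite cF z).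
have Re0 : 0 < Re (ip F F) by move: F0; rewrite ltcE => /andP[].
have [s [c]] := basisF_complete B (cpf_L2 cF) Re0.
pose S (s : seq (bindex B)) u := \sum_(b <- s) c b * basisFb b u.
have [M cS FS] : exists2 M, cpf M (S s) & ip F (S s) = 0.
  elim: {+}s => [|b t [M cS FS]].
    exists 0%N.
      have -> : S [::] = fun=> 0 by apply/funext => u; rewrite /S big_nil.
      exact: cpf_cst.
    rewrite (eq_ip (g' := fun u => 0 * F u) (fun u _ => erefl _)).
      by rewrite (ipZr _ cF cF) mul0r.
    by move=> u _; rewrite /S big_nil mul0r.
  have hb := cpfZ (c b) (cB b).
  exists (maxn (tag b).2 M).
    apply: cpf_ext (cpfD (cpf_le (leq_maxl _ _) hb) (cpf_le (leq_maxr _ _) cS)) => u _.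
    by rewrite /S big_cons.
  rewrite (eq_ip (fun u _ => erefl _) (g' := fun u => c b * basisFb b u + S t u)).
    by rewrite (ipDr cF hb cS) (ipZr _ cF (cB b)) ip_basis0 mulr0 add0r.
  by move=> u _; rewrite /S big_cons.
have cFS : cpf (maxn L M) (fun u => F u - S s u).
  apply: cpf_ext (cpfD (cpf_le (leq_maxl _ _) cF) (cpf_le (leq_maxr _ _) (cpfZ (-1) cS))) => u _.
  by rewrite mulN1r.
rewrite -/(S s) (L2normsq_cpf cFS) (pythagoras cF cS FS) lte_fin cReD.
rewrite gtrDl => /(le_lt_trans _); have := ip_ge0 cS; rewrite lecE => /andP[_ h].
by move=> /(_ _ h); rewrite ltxx.
Qed.

End Obstruction.

Definition tetra_table := rot_table tetra_list cube_v1 tetra_v2 tetra_el.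

(** The square of M u is the square of u with coordinates shifted by s. *)
Definition shifts (M : gmat) (s : nat) :=
  all (fun i => all (fun j => gmul (ge M i j) (ge M i j) ==
    if j == ((i + s) %% 3)%N then gnat 4 else gnat 0) (iota 0 3)) (iota 0 3).

Lemma tetra_shifts : all (fun M => has (shifts M) (iota 0 3)) tetra_table &&
  has (fun M => shifts M 1) tetra_table.
Proof. by vm_compute. Qed.

Section Tetrahedral.
Variables (R : realType) (gT : finGroupType) (G : {group gT}).
Variable rot : mx_representation R G 3.
Local Notation V := 'cV[R]_3.
Local Notation C := R[i].
Local Notation rc := (@real_complex R).

Definition omega : C := Complex (- 2^-1) (Num.sqrt 3 / 2).

Lemma omega3 : omega ^+ 3 = 1.
Proof.
have h : (Num.sqrt 3 : R) ^+ 2 = 3 by rewrite sqr_sqrtr.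
rewrite !exprS expr0 mulr1 /omega; move: h; move: (Num.sqrt _) => s h.
by apply: complex_eq; rewrite !(cReM, cImM) /=; [field: h|field: h].
Qed.

Lemma omega_nonreal : omega \isn't Num.real.
Proof.
rewrite CrealE; apply/eqP => /(congr1 (@complex.Im R)); rewrite cconjE /= => /eqP.
rewrite -subr_eq0 -opprD oppr_eq0 -mulr2n mulrn_eq0 /= mulf_eq0 invr_eq0 pnatr_eq0 orbF.
by rewrite sqrtr_eq0 leNgt ltr0n.
Qed.

(** x^2 + omega y^2 + omega^2 z^2, an eigenfunction of the tetrahedral group. *)
Definition quad (u : V) : C := \sum_(i < 3) omega ^+ i * rc (u i 0 ^+ 2).

Lemma quad_cpf : cpf 2 quad.
Proof.
apply: cpf_sum => i; apply: cpfZ.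
apply: cpf_ext (cpfX 2 (cpf_coord R i)) => u _; by rewrite rmorphXn.
Qed.

Lemma quadE u : quad u =
  rc (u 0 0 ^+ 2) + omega * rc (u 1 0 ^+ 2) + omega ^+ 2 * rc (u 2 0 ^+ 2).
Proof. by rewrite /quad sum3 expr0 mul1r. Qed.

(** The coordinates of A u are, up to sign, those of u shifted by s. *)
Lemma quad_shift (M : gmat) s (A : 'M[R]_3) u : (s < 3)%N -> shifts M s ->
  evm R M = 2 *: A -> quad u = omega ^+ s * quad (A *m u).
Proof.
move=> s3 /allP sM eM.
have hA (i j : 'I_3) : A i j ^+ 2 = (j == ((i + s) %% 3)%N :> nat)%:R.
  have ins (k : 'I_3) : (k : nat) \in iota 0 3 by rewrite mem_iota /= ltn_ord.
  have /allP/(_ _ (ins j))/eqP/(congr1 (gev R)) := sM _ (ins i).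
  have -> : gev R (gmul (ge M i j) (ge M i j)) = 4 * A i j ^+ 2.
    have := congr1 (fun X : 'M[R]_3 => X i j) eM; rewrite !mxE => e.
    by rewrite gevM e; ring.
  move=> h; apply: (@mulfI _ (4 : R)); first by rewrite pnatr_eq0.
  by rewrite h; case: eqP => _; rewrite gev_nat ?mulr1 ?mulr0.
pose t (i : 'I_3) : 'I_3 := Ordinal (ltn_pmod (i + s) (isT : 0 < 3)%N).
have A0 (i j : 'I_3) : j != t i -> A i j = 0.
  move=> ne; apply/eqP; rewrite -sqrf_eq0 hA; rewrite -val_eqE /= in ne.
  by rewrite (negbTE ne).
have At i : A i (t i) ^+ 2 = 1 by rewrite hA /= eqxx.
have Au i : (A *m u) i 0 ^+ 2 = u (t i) 0 ^+ 2.
  rewrite mxE (bigD1 (t i))//= big1 ?addr0; last by move=> j ji; rewrite A0// mul0r.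
  by rewrite exprMn At mul1r.
rewrite !quadE !Au; have o3 := omega3.
case: s s3 {sM hA A0 At Au} @t => [|[|[|//]]] _ t.
- have -> : t 0 = 0 by exact: val_inj.
  have -> : t 1 = 1 by exact: val_inj.
  have -> : t 2 = 2 by exact: val_inj.
  by rewrite expr0 mul1r.
- have -> : t 0 = 1 by exact: val_inj.
  have -> : t 1 = 2 by exact: val_inj.
  have -> : t 2 = 0 by exact: val_inj.
  by move: omega o3 => w h; ring: h.
- have -> : t 0 = 2 by exact: val_inj.
  have -> : t 1 = 0 by exact: val_inj.
  have -> : t 2 = 1 by exact: val_inj.
  by move: omega o3 => w h; ring: h.
Qed.

Lemma tetrahedral_no_basis : is_tetrahedral rot -> ~ inhabited (admissible_real_basis rot).
Proof.
move=> /(polyhedral_table tetra_table_ok (@tetra_listP R))[Q [tab tabP]] [B].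
have oQ := tab_orth tabP; have oT := orth_tr oQ.
have /andP[/allP sh /hasP[M1 M1t sM1]] := tetra_shifts.
have /choice[s sP] : forall g, exists s, g \in G -> (s < 3)%N /\ shifts (tab g) s.
  move=> g; case: (boolP (g \in G)) => [Gg|]; last by exists 0%N.
  have /hasP[s] := sh _ (tab_in tabP Gg); rewrite mem_iota /= => s3 hs.
  by exists s.
pose chi g : C := (omega ^+ s g)^-1.
have o0 : omega != 0.
  by apply: contra_eq_neq omega3 => ->; rewrite expr0n eq_sym oner_eq0.
have step g u s' : g \in G -> (s' < 3)%N -> shifts (tab g) s' ->
    quad (Q^T *m (rot g *m u)) = (omega ^+ s')^-1 * quad (Q^T *m u).
  move=> Gg s3 hs; rewrite (quad_shift (Q^T *m u) s3 hs (tab_ev tabP Gg)).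
  rewrite mulrA mulVf ?mul1r ?expf_neq0//; congr quad.
  by rewrite !mulmxA -(mulmxA _ Q) oQ mulmx1.
have quad_e0 : exists2 u, S2 u & quad (Q^T *m u) != 0.
  exists (Q *m ev R 0); first by apply: orth_S2 => //; rewrite /S2 /= trmx_delta mul_delta_mx;
    by apply/matrixP => i j; rewrite !mxE !ord1.
  rewrite mulmxA (mulmx1C oQ) mul1mx quadE !mxE /=.
  by rewrite expr0n /= expr1n rmorph0 rmorph1 !mulr0 !addr0 oner_eq0.
apply: (no_admissible_basis (tab_rot_orth tabP) (cpf_rot oT quad_cpf) quad_e0 (chi := chi)) B.
- by move=> g u Gg _; have [s3 hs] := sP g Gg; exact: step.
- have [g Gg tg] := tab_onto tabP M1t; exists g => //.
  have [u _ qu] := quad_e0; have [s3 hs] := sP g Gg.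
  have e : chi g = (omega ^+ 1)^-1.
    by apply: (mulIf qu); rewrite -(step g u _ Gg s3 hs) -(step g u 1%N Gg)// tg.
  by rewrite e expr1 realV omega_nonreal.
Qed.

End Tetrahedral.

Theorem mainTheorem1 (R : realType) (gT : finGroupType) (G : {group gT})
    (rot : mx_representation R G 3) :
  (is_octahedral rot \/ is_icosahedral rot ->
     inhabited (admissible_real_basis rot)) /\
  (is_tetrahedral rot -> ~ inhabited (admissible_real_basis rot)).
Proof.
by split; [exact: octa_icosa_basis|exact: tetrahedral_no_basis].
Qed.
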